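(* Let $T>0$, let $u_0:\mathbb R\to\mathbb R$ be bounded and Borel measurable, and let $K$ be a positive integer. Then the random field $u^K:[0,T]\times\mathbb R\times\Omega\to\mathbb R$ defined by $$u^K_{t,x}=\mathbb E^B\left[u_0(B^x_t)\exp\left\{\int_{\mathbb R}\sum_{j=1}^K\left(\int_0^t e_j(B^x_s)\,ds\right)e_j(y)\,dW_y-\frac12\sum_{j=1}^K\left(\int_0^t e_j(B^x_s)\,ds\right)^2\right\}\right]$$ is a weak solution of the approximating stochastic heat equation $$\partial_t u^K_{t,x}=\tfrac12\partial^2_{xx}u^K_{t,x}+u^K_{t,x}\diamond\dot W^K_x,\quad (t,x)\in[0,T]\times\mathbb R,\qquad u^K_{0,x}=u_0(x),$$ in the following sense: for every fixed $(t,x)\in[0,T]\times\mathbb R$ one has $u^K_{t,x}\in\mathbb L^2(\mathbb P^W)$, and for every random variable $F\in\mathbb D^{1,2}$, $$\mathbb E^W\left[u^K_{t,x}F\right]=(P_tu_0)(x)\,\mathbb E^W[F]+\mathbb E^W\left[\left\langle\int_0^t\int_{\mathbb R}p_{t-s}(x-y)\left(\sum_{j=1}^K e_j(y)e_j(\bullet)\right)u^K_{s,y}\,dy\,ds,\;D_{(\bullet)}F\right\rangle_{\mathbb L^2(\mathbb R)}\right].$$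
   Context: $(\Omega,\mathfrak B,\mathbb P^W)$ is a complete probability space carrying a one-dimensional Brownian motion $\{W_x\}_{x\in\mathbb R}$ indexed by the whole real line, and $\mathfrak B$ is the sigma-algebra generated by the Wiener integrals $\int_{\mathbb R}h(y)\,dW_y$, $h\in\mathbb L^2(\mathbb R)$. $\mathbb E^W$ is expectation under $\mathbb P^W$ and $\mathbb L^2(\mathbb P^W)=\mathbb L^2(\Omega,\mathfrak B,\mathbb P^W)$. $D$ is the Malliavin derivative with respect to $W$ and $\mathbb D^{1,2}$ is its domain in $\mathbb L^2(\mathbb P^W)$ (the Sobolev–Malliavin space). $\{B_t\}_{t\in[0,T]}$ is a one-dimensional standard Brownian motion on an auxiliary filtered probability space $(\tilde\Omega,\mathcal G,\{\mathcal G^B_t\}_{t\in[0,T]},\mathbb P^B)$; $W$ and $B$ are considered jointly on the product space with measure $\mathbb P^W\otimes\mathbb P^B$ (so they are independent). $\mathbb E^B$ is expectation with respect to $\mathbb P^B$ only, and $B^x_t:=x+B_t$. $\{e_j\}_{j\ge1}$ are the Hermite functions $$e_j(x)=(-1)^{j-1}\left(\sqrt\pi\,2^{j-1}(j-1)!\right)^{-1/2}e^{x^2/2}\left(\frac{d}{dx}\right)^{j-1}e^{-x^2},$$ a complete orthonormal system of $\mathbb L^2(\mathbb R)$. The smoothed white noise is $\dot W^K_x:=\sum_{j=1}^K e_j(x)\int_{\mathbb R}e_j(y)\,dW_y$, and $\diamond$ is the Wick product (the meaning of the equation is entirely given by the weak formulation in the claim). $p_t(x)=\frac1{\sqrt{2\pi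 t}}e^{-x^2/(2t)}$ is the heat kernel and $(P_tf)(x)=\int_{\mathbb R}p_t(x-y)f(y)\,dy$ for $t>0$, $P_0f=f$. *)

(* Defs.v *)
From HB Require Import structures.
From mathcomp Require Import all_boot all_order all_algebra.
From mathcomp Require Import all_classical all_reals all_analysis.
Set Implicit Arguments.
Unset Strict Implicit.
Unset Printing Implicit Defensive.
Import Order.TTheory GRing.Theory Num.Theory.
Import numFieldNormedType.Exports.
Local Open Scope classical_set_scope.
Local Open Scope ring_scope.

Definition L2_cvg {d} {T : measurableType d} {R : realType}
    (mu : {measure set T -> \bar R}) (fn : nat -> T -> R) (f : T -> R) : Prop :=
  ('N[mu]_2%:E[EFin \o (fn n \- f)%R])%E @[n --> \oo] --> 0%E.

Section deterministic.
Context {R : realType}.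
Local Notation leb := (@lebesgue_measure R).

(* Only the indices [j >= 1] are meaningful. *)
Definition hermite_fun (j : nat) (x : R) : R :=
  (-1) ^+ j.-1 * (Num.sqrt (Num.sqrt pi * 2 ^+ j.-1 * (j.-1)`!%:R))^-1
  * expR (x ^+ 2 / 2) * derive1n j.-1 (fun y : R => expR (- y ^+ 2)) x.

Definition heat_kernel (t x : R) : R :=
  (Num.sqrt (2 * pi * t))^-1 * expR (- x ^+ 2 / (2 * t)).

Definition heat_semigroup (t : R) (f : R -> R) (x : R) : R :=
  if t == 0 then f x else \int[leb]_y (heat_kernel t (x - y) * f y).

(* The list [:: (c_1, (a_1, b_1)); ...] encodes \sum_i c_i 1_{]a_i, b_i]}. *)
Definition step_ok (s : seq (R * (R * R))) : bool :=
  all (fun p => p.2.1 <= p.2.2) s.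

Definition step_fun (s : seq (R * (R * R))) (y : R) : R :=
  \sum_(p <- s) p.1 * \1_(`]p.2.1, p.2.2]%classic : set R) y.

Definition iter_partial n (f : 'rV[R]_n.+1 -> R) (l : seq 'I_n.+1) :
    'rV[R]_n.+1 -> R :=
  foldr (fun i g (v : 'rV[R]_n.+1) => 'D_(delta_mx ord0 i) g v) f l.

(* C_p^oo: smooth, with all partial derivatives of polynomial growth. *)
Definition smooth_poly_growth n (f : 'rV[R]_n.+1 -> R) : Prop :=
  forall l : seq 'I_n.+1,
    (forall v, differentiable (iter_partial f l) v) /\
    exists (C : R) (m : nat),
      forall v, `|iter_partial f l v| <= C * (1 + `|v|) ^+ m.

End deterministic.

Section wiener.
Context {R : realType} {d : measure_display} {Omega : measurableType d}.
Variables (P : probability Omega R) (W : R -> Omega -> R).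
Local Notation leb := (@lebesgue_measure R).

Definition brownian_line : Prop :=
  [/\ forall x, measurable_fun setT (W x),
      {ae P, forall w, W 0 w = 0},
      forall w, continuous (W ^~ w),
      forall x y : R, x < y -> forall A : set R, measurable A ->
        P [set w | A (W y w - W x w)] = normal_prob 0 (Num.sqrt (y - x)) A
    & forall (n : nat) (x : nat -> R), {homo x : i j / (i <= j)%N >-> i <= j} ->
        forall A : 'I_n -> set R, (forall i, measurable (A i)) ->
        P (\bigcap_(i in [set: 'I_n]) [set w | A i (W (x i.+1) w - W (x i) w)])
        = (\prod_(i < n) P [set w | A i (W (x i.+1) w - W (x i) w)%R])%E].

Definition step_integral (s : seq (R * (R * R))) (w : Omega) : R :=
  \sum_(p <- s) p.1 * (W p.2.2 w - W p.2.1 w).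

(* [I] is a version of \int h dW, i.e. an L^2(P)-limit of the integrals of
   step functions converging to [h] in L^2(R). *)
Definition wiener_integral (h : R -> R) (I : Omega -> R) : Prop :=
  [/\ h \in Lfun leb 2%:E, I \in Lfun P 2%:E
    & exists s : nat -> seq (R * (R * R)),
      [/\ forall n, step_ok (s n),
          L2_cvg leb (fun n => step_fun (s n)) h
        & L2_cvg P (fun n => step_integral (s n)) I]].

(* Versions are only determined up to null sets, so that the right-hand side
   contains the measurable null sets: together with completeness this says that
   the sigma-algebra of [Omega] is the completion of the one generated by [W]. *)
Definition generated_by_wiener_integrals : Prop :=
  @measurable d Omega =
  <<s [set A | exists h I (C : set R),
         [/\ wiener_integral h I, measurable C & A = I @^-1` C]] >>.

(* [F = f(\int h_0 dW, ..., \int h_n dW)], [DF(w, y) = \sum_i (d_i f)(...) h_i(y)]. *)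
Definition smooth_functional (F : Omega -> R) (DF : Omega * R -> R) : Prop :=
  exists (n : nat) (f : 'rV[R]_n.+1 -> R)
         (h : 'I_n.+1 -> R -> R) (I : 'I_n.+1 -> Omega -> R),
  [/\ smooth_poly_growth f,
      forall i, wiener_integral (h i) (I i),
      F = (fun w => f (\row_i I i w))
    & DF = (fun z => \sum_(i < n.+1)
                'D_(delta_mx ord0 i) f (\row_k I k z.1) * h i z.2)].

(* [F] is in D^{1,2} and [DF], an element of L^2(Omega; L^2(R)) seen as a
   jointly measurable function, is its Malliavin derivative: closure of
   [smooth_functional] in L^2(P) x L^2(P \x dx). *)
Definition malliavin_derivative (F : Omega -> R) (DF : Omega * R -> R) : Prop :=
  [/\ F \in Lfun P 2%:E,
      DF \in Lfun (P \x leb)%E 2%:E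
    & exists (Fn : nat -> Omega -> R) (DFn : nat -> Omega * R -> R),
      [/\ forall n, smooth_functional (Fn n) (DFn n),
          L2_cvg P Fn F
        & L2_cvg (P \x leb)%E DFn DF]].

Definition duhamel (K : nat) (u : R -> R -> Omega -> R)
    (t x : R) (w : Omega) (z : R) : R :=
  \int[leb]_(s in `[0, t]) \int[leb]_y
    (heat_kernel (t - s) (x - y) *
     (\sum_(1 <= j < K.+1) hermite_fun j y * hermite_fun j z) * u s y w).

(* Weak solution of d_t u = 1/2 d_xx u + u <> \dot W^K, u_0 = [u0]. *)
Definition weak_solution (T : R) (u0 : R -> R) (K : nat)
    (u : R -> R -> Omega -> R) : Prop :=
  forall t x : R, 0 <= t <= T ->
    u t x \in Lfun P 2%:E /\
    forall F DF, malliavin_derivative F DF ->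
      ('E_P[(u t x \* F)%R] =
       (heat_semigroup t u0 x)%:E * 'E_P[F] +
       'E_P[fun w => (\int[leb]_z (duhamel K u t x w z * DF (w, z)))%R])%E.

End wiener.

Section brownian.
Context {R : realType} {d : measure_display} {Omega : measurableType d}.
Variables (P : probability Omega R) (T : R).

Definition filtration (G : R -> set (set Omega)) : Prop :=
  (forall t : R, 0 <= t <= T -> sigma_algebra setT (G t) /\ G t `<=` measurable) /\
  (forall s t : R, 0 <= s -> s <= t -> t <= T -> G s `<=` G t).

Definition brownian (G : R -> set (set Omega)) (B : R -> Omega -> R) : Prop :=
  [/\ forall t : R, 0 <= t <= T -> forall C : set R, measurable C ->
        G t (B t @^-1` C),
      {ae P, forall w, B 0 w = 0},
      forall w, {within `[0, T], continuous (B ^~ w)},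
      forall s t : R, 0 <= s -> s < t -> t <= T ->
        forall C : set R, measurable C ->
        P [set w | C (B t w - B s w)] = normal_prob 0 (Num.sqrt (t - s)) C
    & forall s t : R, 0 <= s -> s < t -> t <= T ->
        forall (A : set Omega) (C : set R), G s A -> measurable C ->
        P (A `&` [set w | C (B t w - B s w)]) =
        (P A * P [set w | C (B t w - B s w)%R])%E].

Definition occupation (B : R -> Omega -> R) (j : nat) (t x : R) (w : Omega) : R :=
  \int[@lebesgue_measure R]_(s in `[0, t]) hermite_fun j (x + B s w).

End brownian.

Section field.
Context {R : realType} {dW dB : measure_display}
        {OmegaW : measurableType dW} {OmegaB : measurableType dB}.
Variables (PW : probability OmegaW R) (PB : probability OmegaB R).
Variables (W : R -> OmegaW -> R) (B : R -> OmegaB -> R).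

(* [Phi] is a version of
     (t, x, w, v) |-> \int \sum_{j=1}^K (\int_0^t e_j(B^x_s(v)) ds) e_j(y) dW_y(w).
   Each Wiener integral being defined up to a null set depending on (t, x, v),
   one has to take a version measurable in all variables for the expectation in
   [v] and the time-space integrals of the field to make sense. *)
Definition occupation_wiener_integral (T : R) (K : nat)
    (Phi : (R * R) * (OmegaW * OmegaB) -> R) : Prop :=
  measurable_fun ((`[0, T]%classic `*` [set: R]) `*` [set: OmegaW * OmegaB]) Phi
  /\ forall t x : R, 0 <= t <= T ->
     {ae PB, forall v, wiener_integral PW W
        (fun y => \sum_(1 <= j < K.+1) occupation B j t x v * hermite_fun j y)
        (fun w => Phi ((t, x), (w, v)))}.

Definition feynman_kac (u0 : R -> R) (K : nat)
    (Phi : (R * R) * (OmegaW * OmegaB) -> R) (t x : R) (w : OmegaW) : R :=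
  \int[PB]_v (u0 (x + B t v) *
    expR (Phi ((t, x), (w, v)) -
          2^-1 * \sum_(1 <= j < K.+1) occupation B j t x v ^+ 2)).

End field.

(* Main.v *)
(** For a smooth functional [F = f(I(h_0), ..., I(h_n))] and almost every
    Brownian path [B], the Cameron-Martin formula turns the exponential weight
    in [u(t, x)] into a shift of the Wiener integrals by
    [\int_0^t \sum_j e_j(B^x_s) <e_j, h_i> ds].  Shifting only by the part of the
    path after time [s] and differentiating in [s] writes the effect of the full
    shift as a time integral of [e_j(B^x_s) <e_j, DF>], shifted along the path
    after [s].  The Markov property at time [s] identifies the [B]-mean of this
    integrand with
    [\int p_s(x - y) e_j(y) E^W(u(t - s, y) <e_j, DF>) dy], which is the Duhamel
    term after [s |-> t - s].  Both sides are continuous in [(F, DF)] for the L^2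
    norms because [u] is bounded in [L^2(P^W)] uniformly on [[0, T] x R], and
    smooth functionals are dense by the definition of the Malliavin derivative. *)

Require Import Defs.
From HB Require Import structures.
From mathcomp Require Import all_boot all_order all_algebra.
From mathcomp Require Import all_classical all_reals all_analysis.
From mathcomp Require Import measurable_realfun.
From mathcomp Require Import ring lra.
Set Implicit Arguments.
Unset Strict Implicit.
Unset Printing Implicit Defensive.
Import Order.TTheory GRing.Theory Num.Theory.
Import numFieldNormedType.Exports.
Local Open Scope classical_set_scope.
Local Open Scope ring_scope.

(** * Square-integrable functions and real-valued integrals *)

(** Two facts that the overview quotes are themselves proved here, both by reduction to finitely
    many independent Gaussian increments. The Cameron-Martin formula is a product of one-dimensional
    Gaussian translations on a common grid of step functions; Wiener integrals are known only as L^2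
    limits of step integrals, hence the almost surely convergent subsequences and the passage from
    bounded to nonnegative to polynomially growing test functions. The Markov property comes from
    comparing laws of increment vectors of paths sampled on a grid; the grid contains both end
    times, because [u0] is merely measurable and must be evaluated exactly. After Cameron-Martin a
    smooth functional enters only through a function of the K occupation integrals, so the Duhamel
    identity becomes a statement about [B] alone, with abstract [Psi0] and [Psi]. The bookkeeping
    has three causes: [B] is constrained on [[0, T]] only and starts at 0 only almost surely; [Phi]
    is a Wiener integral for almost every path at each fixed [(t, x)]; real-valued integrals take a
    default value where integrability fails. *)

Section L2.
Context d (T : measurableType d) (R : realType) (mu : {measure set T -> \bar R}).
Implicit Types f g h : T -> R.

Definition sqint f := measurable_fun [set: T] f /\
  mu.-integrable [set: T] (EFin \o (fun x => f x ^+ 2)).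

Lemma Lfun2P f : f \in Lfun mu 2%:E <-> sqint f.
Proof.
split=> [lf|[mf /integrableP[mf2 fi]]].
  split; last exact: Lfun2_integrable_sqr.
  by move: lf; rewrite inE => /andP[]; rewrite inE.
rewrite inE; apply/andP; rewrite !inE/=; split => //.
rewrite /finite_norm unlock poweR_lty//; apply: le_lt_trans fi.
by under eq_integral => x _ do rewrite /= powR_mulrn// -normrX.
Qed.

Lemma Lnorm2E f : ('N[mu]_2%:E[EFin \o f] =
  (\int[mu]_x (f x ^+ 2)%:E) `^ 2^-1)%E.
Proof.
rewrite unlock; congr (_ `^ _)%E; apply: eq_integral => x _ /=.
by rewrite powR_mulrn// -normrX ger0_norm// sqr_ge0.
Qed.

Lemma integrable_le f g : measurable_fun [set: T] f ->
  (forall x, `|f x| <= g x) -> mu.-integrable [set: T] (EFin \o g) ->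
  mu.-integrable [set: T] (EFin \o f).
Proof.
move=> mf fg ig; apply: le_integrable ig => //; first exact/measurable_EFinP.
by move=> x _; rewrite /= lee_fin (le_trans (fg x))// ler_norm.
Qed.

Lemma integrable_ge0 f : measurable_fun [set: T] f -> (forall x, 0 <= f x) ->
  (\int[mu]_x (f x)%:E < +oo)%E -> mu.-integrable [set: T] (EFin \o f).
Proof.
move=> mf f0 fi; apply/integrableP; split; first exact/measurable_EFinP.
by under eq_integral => x _ do rewrite /= ger0_norm//.
Qed.

Lemma EFin_Rintegral f : mu.-integrable [set: T] (EFin \o f) ->
  (\int[mu]_x f x)%:E = (\int[mu]_x (f x)%:E)%E.
Proof. by move=> fi; rewrite /Rintegral fineK// integrable_fin_num. Qed.

Lemma Rintegral_le f g : (forall x, f x <= g x) ->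
  mu.-integrable [set: T] (EFin \o f) -> mu.-integrable [set: T] (EFin \o g) ->
  \int[mu]_x f x <= \int[mu]_x g x.
Proof. by move=> fg fi gi; apply: le_Rintegral => // x _. Qed.

Lemma RintegrableD f g : mu.-integrable [set: T] (EFin \o f) ->
  mu.-integrable [set: T] (EFin \o g) ->
  mu.-integrable [set: T] (EFin \o (fun x => f x + g x)).
Proof. by move=> fi gi; exact: (integrableD measurableT fi gi). Qed.

Lemma RintegrableZ a f : mu.-integrable [set: T] (EFin \o f) ->
  mu.-integrable [set: T] (EFin \o (fun x => a * f x)).
Proof. by move=> fi; exact: (integrableZl measurableT a fi). Qed.

Lemma RintegrableB f g : mu.-integrable [set: T] (EFin \o f) ->
  mu.-integrable [set: T] (EFin \o g) ->
  mu.-integrable [set: T] (EFin \o (fun x => f x - g x)).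
Proof. by move=> fi gi; exact: (integrableB measurableT fi gi). Qed.

Lemma Rintegrable_norm f : mu.-integrable [set: T] (EFin \o f) ->
  mu.-integrable [set: T] (EFin \o (fun x => `|f x|)).
Proof. by move=> fi; exact: integrable_norm fi. Qed.

Lemma Rintegrable_sum (I : Type) (s : seq I) (P : pred I) (F : I -> T -> R) :
  (forall i, P i -> mu.-integrable [set: T] (EFin \o F i)) ->
  mu.-integrable [set: T] (EFin \o (fun x => \sum_(i <- s | P i) F i x)).
Proof.
move=> Fi; elim: s => [|i s ih].
  by under eq_fun do rewrite /= big_nil; exact: integrable0.
under eq_fun do rewrite /= big_cons.
by case Pi: (P i) => //; apply: RintegrableD => //; exact: Fi.
Qed.

Lemma Rintegrable_measurable f : mu.-integrable [set: T] (EFin \o f) ->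
  measurable_fun [set: T] f.
Proof. by move/measurable_int/measurable_EFinP. Qed.

Lemma Rintegral_sum (I : Type) (s : seq I) (P : pred I) (F : I -> T -> R) :
  (forall i, P i -> mu.-integrable [set: T] (EFin \o F i)) ->
  \int[mu]_x (\sum_(i <- s | P i) F i x) =
  \sum_(i <- s | P i) \int[mu]_x F i x.
Proof.
move=> Fi; elim: s => [|i s ih].
  by under eq_Rintegral do rewrite big_nil; rewrite big_nil /Rintegral integral0.
under eq_Rintegral do rewrite big_cons; rewrite big_cons.
case Pi: (P i) => //; rewrite -ih (RintegralD measurableT (Fi _ Pi))//.
exact: Rintegrable_sum.
Qed.

Lemma sqintM f g : sqint f -> sqint g ->
  mu.-integrable [set: T] (EFin \o (fun x => f x * g x)).
Proof.
by move=> /Lfun2P lf /Lfun2P lg; apply/Lfun1_integrable; exact: Lfun2_mul_Lfun1.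
Qed.

Lemma sqintD f g : sqint f -> sqint g -> sqint (fun x => f x + g x).
Proof.
move=> sf sg; split; first by apply: measurable_funD; [case: sf|case: sg].
apply: (@integrable_le _ (fun x => 2 * f x ^+ 2 + 2 * g x ^+ 2)).
- by apply: measurable_funX; apply: measurable_funD; [case: sf|case: sg].
- move=> x; rewrite ger0_norm ?sqr_ge0//.
  by have := sqr_ge0 (f x - g x); nra.
- by apply: RintegrableD; apply: RintegrableZ; [case: sf|case: sg].
Qed.

Lemma sqintZ a f : sqint f -> sqint (fun x => a * f x).
Proof.
move=> [mf fi]; split; first exact: measurable_funM.
by under eq_fun do rewrite /= exprMn; exact: RintegrableZ.
Qed.

Lemma sqintB f g : sqint f -> sqint g -> sqint (fun x => f x - g x).
Proof.
move=> sf sg; have := sqintD sf (sqintZ (-1) sg).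
by under eq_fun do rewrite mulN1r.
Qed.

Lemma sqint0 : sqint (cst 0).
Proof.
split => //=; under eq_fun do rewrite /= expr0n/=.
exact: integrable0.
Qed.

Lemma sqint_sum (I : Type) (s : seq I) (P : pred I) (F : I -> T -> R) :
  (forall i, P i -> sqint (F i)) -> sqint (fun x => \sum_(i <- s | P i) F i x).
Proof.
move=> sF; elim: s => [|i s ih].
  by under eq_fun do rewrite big_nil; exact: sqint0.
under eq_fun do rewrite big_cons.
by case Pi: (P i) => //; apply: sqintD => //; exact: sF.
Qed.

(** Real-valued counterpart of the L^2 norm. The two agree on [sqint] functions ([Lnorm2_l2n]), so
    that Cauchy-Schwarz, Minkowski and limits can be handled in [R]. *)
Definition l2n f := Num.sqrt (\int[mu]_x (f x ^+ 2)).

Lemma l2n_ge0 f : 0 <= l2n f. Proof. exact: sqrtr_ge0. Qed.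

Lemma Rint_sqr_ge0 f : 0 <= \int[mu]_x (f x ^+ 2).
Proof. by apply: Rintegral_ge0 => x _; exact: sqr_ge0. Qed.

Lemma Lnorm2_l2n f : sqint f -> 'N[mu]_2%:E[EFin \o f]%E = (l2n f)%:E.
Proof.
move=> [_ fi]; rewrite Lnorm2E -EFin_Rintegral// poweR_EFin /l2n.
by rewrite -powR12_sqrt// Rint_sqr_ge0.
Qed.

Lemma cauchy_schwarz f g : sqint f -> sqint g ->
  \int[mu]_x `|f x * g x| <= l2n f * l2n g.
Proof.
move=> sf sg.
have := @hoelder _ _ _ mu f g 2 2 sf.1 sg.1 (ltr0n _ 2) (ltr0n _ 2).
rewrite [2^-1 + _](_ : _ = 1) => [/(_ erefl)|]; last by lra.
rewrite !Lnorm2_l2n// -EFinM Lnorm1 -lee_fin EFin_Rintegral//.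
exact/Rintegrable_norm/sqintM.
Qed.

Lemma L2_cvgP (fn : nat -> T -> R) f : (forall n, sqint (fn n)) -> sqint f ->
  L2_cvg mu fn f -> l2n (fun x => fn n x - f x) @[n --> \oo] --> 0.
Proof.
move=> sn sf; rewrite /L2_cvg => /fine_cvgP[_]; apply: cvg_trans.
apply: near_eq_cvg; near=> n => /=.
by rewrite (Lnorm2_l2n (sqintB (sn n) sf)).
Unshelve. all: by end_near. Qed.

Lemma l2n_D f g : sqint f -> sqint g -> l2n (fun x => f x + g x) <= l2n f + l2n g.
Proof.
move=> sf sg; rewrite -lee_fin EFinD -!Lnorm2_l2n//; last exact: sqintD.
by apply: eminkowski; rewrite ?lee1n//; [exact: sf.1|exact: sg.1].
Qed.

Lemma ler_norm_Rint f : mu.-integrable [set: T] (EFin \o f) ->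
  `|\int[mu]_x f x| <= \int[mu]_x `|f x|.
Proof. by move=> fi; exact: le_normr_Rintegral. Qed.

Lemma Rdct (fn : nat -> T -> R) f g : (forall n, measurable_fun [set: T] (fn n)) ->
  measurable_fun [set: T] f ->
  {ae mu, forall x, fn n x @[n --> \oo] --> f x} ->
  (forall n x, `|fn n x| <= g x) -> mu.-integrable [set: T] (EFin \o g) ->
  \int[mu]_x fn n x @[n --> \oo] --> \int[mu]_x f x.
Proof.
move=> mfn mf fnf fng gi.
have [] := @dominated_convergence _ _ _ mu setT measurableT
  (fun n x => (fn n x)%:E) (EFin \o f) (EFin \o g).
- by move=> n; exact/measurable_EFinP.
- exact/measurable_EFinP.
- by apply: filterS fnf => x fx _; apply: cvg_EFin => //; exact: nearW.
- by [].
- by apply: nearW => x n _; rewrite /= lee_fin.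
- by move=> fi _ /=; rewrite -EFin_Rintegral// => /fine_cvg.
Qed.

End L2.

(** * Fubini's theorem for real-valued integrals *)

Section Rfubini.
Context d1 d2 (T1 : measurableType d1) (T2 : measurableType d2) (R : realType).
Context (m1 : {sigma_finite_measure set T1 -> \bar R})
        (m2 : {sigma_finite_measure set T2 -> \bar R}).
Local Notation m12 := (m1 \x m2)%E.
Implicit Type f : T1 * T2 -> R.

Lemma Rfubini1 f : m12.-integrable setT (EFin \o f) ->
  m1.-integrable setT (EFin \o (fun x => \int[m2]_y f (x, y))) /\
  \int[m1]_x \int[m2]_y f (x, y) = \int[m12]_z f z.
Proof.
move=> fi; have fi' := integrable_fubini_F fi.
have ae1 := ae_integrable1 fi.
(* The real inner integral is [fine] of the extended one, so the two are identified only where the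
   section is integrable, that is almost everywhere. *)
have H : {ae m1, forall x, setT x ->
    (\int[m2]_y f (x, y))%:E = fubini_F m2 (EFin \o f) x}.
  by apply: filterS ae1 => x xi _; rewrite EFin_Rintegral.
have mF : measurable_fun setT (fun x => \int[m2]_y f (x, y)).
  by apply: (@measurableT_comp _ _ _ _ _ _ fine) => //; case/integrableP : fi'.
have eqi : (\int[m1]_x (\int[m2]_y f (x, y))%:E =
    \int[m1]_x fubini_F m2 (EFin \o f) x)%E.
  apply: ae_eq_integral => //; first exact/measurable_EFinP.
  by case/integrableP : fi'.
split; last by rewrite /Rintegral eqi -integral12_prod_meas1.
apply/integrableP; split; first exact/measurable_EFinP.
have /integrableP[mF' lF] := fi'.
apply: le_lt_trans lF; rewrite le_eqVlt; apply/orP; left; apply/eqP.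
apply: ae_eq_integral => //.
- exact/measurableT_comp/measurable_EFinP.
- exact: measurableT_comp.
- by apply: filterS H => x /= h _; rewrite -h.
Qed.

Lemma Rfubini2 f : m12.-integrable setT (EFin \o f) ->
  m2.-integrable setT (EFin \o (fun y => \int[m1]_x f (x, y))) /\
  \int[m2]_y \int[m1]_x f (x, y) = \int[m12]_z f z.
Proof.
move=> fi.
have mG := measurable_fubini_G fi.
have mg : measurable_fun setT (fun y => \int[m1]_x f (x, y)).
  exact: (@measurableT_comp _ _ _ _ _ _ fine).
have ae1 := ae_integrable2 fi.
have H : {ae m2, forall y, setT y ->
    (\int[m1]_x f (x, y))%:E = fubini_G m1 (EFin \o f) y}.
  by apply: filterS ae1 => x xi _; rewrite EFin_Rintegral.
have mf := measurable_int _ fi.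
have eqi : (\int[m2]_y (\int[m1]_x f (x, y))%:E =
    \int[m2]_y fubini_G m1 (EFin \o f) y)%E.
  by apply: ae_eq_integral => //; exact/measurable_EFinP.
split; last by rewrite /Rintegral eqi integral21_prod_meas1.
apply/integrableP; split; first exact/measurable_EFinP.
apply: le_lt_trans ((integrable21ltyP _ _ mf).1 fi).
apply: (@le_trans _ _ (\int[m2]_y `|fubini_G m1 (EFin \o f) y|)%E); last first.
  apply: ge0_le_integral => //.
  - exact: measurableT_comp.
  - apply: (measurable_fun_fubini_tonelli_G (abse \o (EFin \o f))) => //=.
    exact: measurableT_comp.
  - move=> y _; apply: le_abse_integral => //.
    by apply: measurableT_comp => //; exact: measurable_pair2.
rewrite le_eqVlt; apply/orP; left; apply/eqP; apply: ae_eq_integral => //.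
- exact/measurableT_comp/measurable_EFinP.
- exact: measurableT_comp.
- by apply: filterS H => x /= h _; rewrite -h.
Qed.

Lemma Rfubini f : m12.-integrable setT (EFin \o f) ->
  \int[m1]_x \int[m2]_y f (x, y) = \int[m2]_y \int[m1]_x f (x, y).
Proof. by move=> fi; rewrite (Rfubini1 fi).2 (Rfubini2 fi).2. Qed.

(** No integrability is assumed: the inner integral is a difference of two Tonelli integrals, and
    [fine] is measurable, so the default values taken on bad sections do no harm. *)
Lemma measurable_Rint1 f : measurable_fun setT f ->
  measurable_fun setT (fun x => \int[m2]_y f (x, y)).
Proof.
move=> mf; apply: (@measurableT_comp _ _ _ _ _ _ fine) => //.
have mf' : measurable_fun setT (EFin \o f) by exact/measurable_EFinP.
under eq_fun do rewrite integralE.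
apply: emeasurable_funB.
- rewrite (_ : (fun x => _) = fubini_F m2 (EFin \o f)^\+%E).
    apply: measurable_fun_fubini_tonelli_F => //; exact: measurable_funepos.
  by apply/funext => x; apply: eq_integral => y _; rewrite !funeposE.
- rewrite (_ : (fun x => _) = fubini_F m2 (EFin \o f)^\-%E).
    apply: measurable_fun_fubini_tonelli_F => //; exact: measurable_funeneg.
  by apply/funext => x; apply: eq_integral => y _; rewrite !funenegE.
Qed.

Lemma integrable_prod f (g : T1 -> R) (h : T2 -> R) :
  measurable_fun setT f -> (forall x y, `|f (x, y)| <= g x * h y) ->
  m1.-integrable setT (EFin \o g) -> m2.-integrable setT (EFin \o h) ->
  m12.-integrable setT (EFin \o f).
Proof.
move=> mf fgh gi hi; have mf' : measurable_fun setT (EFin \o f).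
  exact/measurable_EFinP.
apply/(integrable12ltyP _ _ mf').
have [_ gi'] := integrableP _ _ _ gi.
have hi' := Rintegrable_norm hi.
apply: (@le_lt_trans _ _ (\int[m1]_x (`|g x|%:E * (\int[m2]_y `|h y|)%:E))%E).
  apply: ge0_le_integral => //.
  - by move=> x _; exact: integral_ge0.
  - apply: (measurable_fun_fubini_tonelli_F (abse \o (EFin \o f))) => //=.
    exact: measurableT_comp.
  - apply: emeasurable_funM => //; apply/measurable_EFinP.
    by apply: measurableT_comp => //; exact: Rintegrable_measurable gi.
  - move=> x _; rewrite EFin_Rintegral//.
    rewrite -ge0_integralZl//; last first.
      exact/measurable_EFinP/(Rintegrable_measurable hi').
    apply: ge0_le_integral => //.
    + apply/measurable_EFinP/measurableT_comp => //.
      by apply: (measurableT_comp mf); exact: measurable_pair1.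
    + apply/measurable_EFinP/measurable_funM => //.
      exact: (Rintegrable_measurable hi').
    + move=> y _; rewrite /= -EFinM lee_fin (le_trans (fgh x y))//.
      by rewrite -normrM ler_norm.
rewrite ge0_integralZr//.
- rewrite lte_mul_pinfty//; last exact: ltry.
    by apply: integral_ge0 => x _; rewrite lee_fin.
  by rewrite ge0_fin_numE//; apply: integral_ge0 => x _; rewrite lee_fin.
- apply/measurable_EFinP; apply: measurableT_comp => //.
  exact: Rintegrable_measurable gi.
- by rewrite lee_fin; apply: Rintegral_ge0.
Qed.

End Rfubini.

(** * Laws of random tuples *)

Section tuple_law.
Context (R : realType) (n : nat).
Local Notation tup := (n.-tuple R).

Definition rectangles : set (set tup) :=
  [set C | exists2 A : 'I_n -> set R, (forall i, measurable (A i))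
    & C = [set t | forall i, A i (tnth t i)]].

Lemma measurable_rectangle (A : 'I_n -> set R) : (forall i, measurable (A i)) ->
  measurable [set t : tup | forall i, A i (tnth t i)].
Proof.
move=> mA.
have -> : [set t : tup | forall i, A i (tnth t i)] =
    \bigcap_(i in [set: 'I_n]) ((@tnth n R)^~ i @^-1` A i).
  by apply/seteqP; split => [t At i _|t At i]; [exact: At|exact: (At i)].
apply: fin_bigcap_measurable => // i _.
by rewrite -[X in measurable X]setTI; exact: measurable_tnth.
Qed.

(** A cylinder on one coordinate is a rectangle whose other factors are [setT]. Rectangles are
    moreover stable under intersection, which [measure_unique] needs in [tuple_law]. *)
Lemma measurable_tuple_rectangles : (measurable : set (set tup)) = <<s rectangles >>.
Proof.
apply/seteqP; split.
- apply: smallest_sub; [exact: smallest_sigma_algebra|].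
  move=> Y /=; rewrite -bigcup_seq => -[i _ [B mB <-]].
  apply: sub_sigma_algebra.
  exists (fun j => if j == i then B else setT); first by move=> j; case: ifP.
  apply/seteqP; split => [t [_ Bt] j|t /(_ i)]; last by rewrite /= eqxx.
  by have [->|] := eqVneq j i.
- apply: smallest_sub; first exact: sigma_algebra_measurable.
  by move=> _ [A mA ->]; exact: measurable_rectangle.
Qed.

Context d1 d2 (T1 : measurableType d1) (T2 : measurableType d2).
Context (P1 : probability T1 R) (P2 : probability T2 R).
Variables (X1 : T1 -> tup) (X2 : T2 -> tup).
Hypotheses (mX1 : measurable_fun setT X1) (mX2 : measurable_fun setT X2).

(** A probability is determined by its values on a generating family stable under intersection, here
    the rectangles, so the two image laws coincide. Every later comparison of laws goes through
    this. *)
Lemma tuple_law : (forall A : 'I_n -> set R, (forall i, measurable (A i)) ->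
    P1 [set w | forall i, A i (tnth (X1 w) i)] =
    P2 [set w | forall i, A i (tnth (X2 w) i)]) ->
  forall g : tup -> \bar R, measurable_fun setT g -> (forall t, 0 <= g t)%E ->
  (\int[P1]_w g (X1 w) = \int[P2]_w g (X2 w))%E.
Proof.
move=> H g mg g0.
transitivity (\int[pushforward P1 X1]_t g t)%E.
  by rewrite (ge0_integral_pushforward mX1).
transitivity (\int[pushforward P2 X2]_t g t)%E; last first.
  by rewrite (ge0_integral_pushforward mX2).
apply: eq_measure_integral => A mA _.
apply: (measure_unique rectangles (fun=> setT)) => //.
- exact: measurable_tuple_rectangles.
- move=> _ _ [A1 mA1 ->] [A2 mA2 ->].
  exists (fun i => A1 i `&` A2 i); first by move=> i; exact: measurableI.
  by apply/seteqP; split => [t [? ?] i|t h]; [split|split=> i; case: (h i)].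
- by move=> _; exists (fun=> setT) => //; apply/seteqP; split.
- by rewrite bigcup_const.
- by move=> _ [B mB ->]; exact: H.
- by move=> _; rewrite /= /pushforward/= preimage_setT probability_setT ltry.
Qed.

End tuple_law.

(** * Translations, reflections and Gaussian densities *)

Section lebesgue_affine.
Context (R : realType).
Local Notation leb := (@lebesgue_measure R).

Let shiftR (c : R) : measurableTypeR R -> measurableTypeR R := fun x => x + c.
Let reflR (c : R) : measurableTypeR R -> measurableTypeR R := fun x => c - x.

Let measurable_shiftR c : measurable_fun setT (shiftR c).
Proof. exact: measurable_funD. Qed.

Let measurable_reflR c : measurable_fun setT (reflR c).
Proof. exact: measurable_funB. Qed.

Lemma lebesgue_shift (c : R) (A : set R) : measurable A ->
  leb (shiftR c @^-1` A) = leb A.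
Proof.
move=> mA; have mf := @measurable_shiftR c.
apply/esym; apply: (@lebesgue_measure_unique R (pushforward leb (shiftR c))) => // _ [[a b] /= _ <-].
rewrite /pushforward /shiftR /reflR /=.
rewrite (_ : _ @^-1` _ = `]a - c, b - c]%classic); last first.
  by apply/seteqP; split => x /=; rewrite !in_itv/= ltrBlDr lerBrDr.
by rewrite !lebesgue_measure_itv/= !lte_fin ltrD2r -!EFinB opprB addrA subrK.
Qed.

Lemma lebesgue_reflect (c : R) (A : set R) : measurable A ->
  leb (reflR c @^-1` A) = leb A.
Proof.
move=> mA; have mf := @measurable_reflR c.
apply/esym; apply: (@lebesgue_measure_unique R (pushforward leb (reflR c))) => // _ [[a b] /= _ <-].
rewrite /pushforward /shiftR /reflR /=.
rewrite (_ : _ @^-1` _ = `[c - b, c - a[%classic); last first.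
  apply/seteqP; split => x /=; rewrite !in_itv/= => /andP[h1 h2]; apply/andP; split; lra.
rewrite !lebesgue_measure_itv/= !lte_fin.
rewrite (_ : (c - b < c - a) = (a < b)); last by apply/idP/idP => ?; lra.
by case: ifP => // _; rewrite -!EFinB; congr _%:E; lra.
Qed.

Lemma integral_shift (c : R) (f : R -> \bar R) : measurable_fun setT f ->
  (\int[leb]_x f (x + c)%R = \int[leb]_x f x)%E.
Proof.
have mf := @measurable_shiftR c.
have H (g : R -> \bar R) : measurable_fun setT g -> (forall x, 0 <= g x)%E ->
    (\int[leb]_x g (x + c)%R = \int[leb]_x g x)%E.
  move=> mg g0; transitivity (\int[pushforward leb (shiftR c)]_x g x)%E.
    by rewrite ge0_integral_pushforward.
  by apply: eq_measure_integral => A mA _; exact: lebesgue_shift.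
move=> mf'; rewrite [LHS]integralE [RHS]integralE; congr (_ - _)%E.
- rewrite -(H f^\+%E)//; last exact: measurable_funepos.
  by apply: eq_integral => x _; rewrite !funeposE.
- rewrite -(H f^\-%E)//; last exact: measurable_funeneg.
  by apply: eq_integral => x _; rewrite !funenegE.
Qed.

Lemma integral_reflect (c : R) (f : R -> \bar R) : measurable_fun setT f ->
  (\int[leb]_x f (c - x)%R = \int[leb]_x f x)%E.
Proof.
have mf := @measurable_reflR c.
have H (g : R -> \bar R) : measurable_fun setT g -> (forall x, 0 <= g x)%E ->
    (\int[leb]_x g (c - x)%R = \int[leb]_x g x)%E.
  move=> mg g0; transitivity (\int[pushforward leb (reflR c)]_x g x)%E.
    by rewrite ge0_integral_pushforward.
  by apply: eq_measure_integral => A mA _; exact: lebesgue_reflect.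
move=> mf'; rewrite [LHS]integralE [RHS]integralE; congr (_ - _)%E.
- rewrite -(H f^\+%E)//; last exact: measurable_funepos.
  by apply: eq_integral => x _; rewrite !funeposE.
- rewrite -(H f^\-%E)//; last exact: measurable_funeneg.
  by apply: eq_integral => x _; rewrite !funenegE.
Qed.

(** The Radon-Nikodym derivative of [normal_prob] is almost everywhere [normal_pdf], because both
    have the same integral over every measurable set. *)
Lemma ge0_integral_normal (m s : R) (f : R -> \bar R) :
  measurable_fun setT f -> (forall x, 0 <= f x)%E ->
  (\int[normal_prob m s]_x f x = \int[leb]_x (f x * (normal_pdf m s x)%:E))%E.
Proof.
move=> mf f0; have dom := normal_prob_dominates m s.
rewrite -(Radon_Nikodym_SigmaFinite.change_of_variables dom)//.
apply: ae_eq_integral => //.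
- apply: emeasurable_funM => //.
  have fi := Radon_Nikodym_SigmaFinite.f_integrable dom.
  by have [] := integrableP _ _ _ fi.
- apply: (emeasurable_funM mf); apply/measurable_EFinP.
  exact: measurable_normal_pdf.
apply: ae_eqe_mul2l; apply: integral_ae_eq => //=.
- have := Radon_Nikodym_SigmaFinite.f_integrable dom; exact.
- apply/measurable_EFinP; exact: measurable_normal_pdf.
- by move=> E _ mE; rewrite -Radon_Nikodym_SigmaFinite.f_integral.
Qed.

(** Completing the square: the exponential weight turns the centred density of variance [v] into the
    density of mean [b * v]. This is the one-dimensional Cameron-Martin formula. *)
Lemma normal_shift (v b : R) (g : R -> \bar R) : 0 < v ->
  measurable_fun setT g -> (forall x, 0 <= g x)%E ->
  (\int[normal_prob 0 (Num.sqrt v)]_x ((expR (b * x - b ^+ 2 * v / 2))%:E * g x) =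
   \int[normal_prob 0 (Num.sqrt v)]_x g (x + b * v)%R)%E.
Proof.
move=> v0 mg g0.
rewrite !ge0_integral_normal//.
- rewrite -(integral_shift (- (b * v)) (f := fun x => g (x + b * v)%R * _)%E).
    apply: eq_integral => x _; rewrite subrK muleAC muleC; congr (_ * _)%E.
    rewrite -EFinM; congr _%:E.
    have sv : Num.sqrt v != 0 by rewrite gt_eqF// sqrtr_gt0.
    rewrite !normal_pdfE// mulrCA; congr (_ * _).
    rewrite /normal_fun -expRD; congr expR.
    rewrite sqr_sqrtr ?ltW//; field.
    by rewrite gt_eqF.
  apply: emeasurable_funM.
    by apply: measurableT_comp => //; exact: measurable_funD.
  apply/measurable_EFinP; exact: measurable_normal_pdf.
- by apply: measurableT_comp => //; exact: measurable_funD.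
- apply: emeasurable_funM => //; apply/measurable_EFinP; apply: measurableT_comp => //.
  by apply: measurable_funB => //; apply: measurable_funM.
- by move=> x; rewrite mule_ge0// lee_fin expR_ge0.
Qed.

End lebesgue_affine.

(** * The Cameron-Martin formula *)

Section cameron_martin_finite.
Context (R : realType) (n : nat) d (T : measurableType d) (P : probability T R).
Variables (X : T -> n.-tuple R) (v b : 'I_n -> R).
Hypotheses (mX : measurable_fun setT X) (v0 : forall i, 0 < v i).
Local Notation N i := (normal_prob 0 (Num.sqrt (v i))).
Hypothesis X_law : forall A : 'I_n -> set R, (forall i, measurable (A i)) ->
  P [set w | forall i, A i (tnth (X w) i)] = (\prod_(i < n) N i (A i))%E.

Definition tuple_set (t : n.-tuple R) k y : n.-tuple R :=
  [tuple if i == k then y else tnth t i | i < n].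

(** Shifts only the coordinates listed in [s], so that the formula can be proved by induction on the
    coordinates already treated. *)
Definition tuple_shift (s : seq 'I_n) (c : 'I_n -> R) (t : n.-tuple R) : n.-tuple R :=
  [tuple if i \in s then tnth t i + c i else tnth t i | i < n].

Lemma measurable_tuple_set k :
  measurable_fun setT (fun z : R * n.-tuple R => tuple_set z.2 k z.1).
Proof.
apply/measurable_fun_tnthP => i /=.
rewrite (_ : _ \o _ = fun z => if i == k then z.1 else tnth z.2 i); last first.
  by apply/funext => z /=; rewrite tnth_mktuple.
case: eqP => _; first exact: measurable_fst.
exact: (measurableT_comp (measurable_tnth i) measurable_snd).
Qed.

Lemma measurable_tuple_shift s c : measurable_fun setT (tuple_shift s c).
Proof.
apply/measurable_fun_tnthP => i /=.
rewrite (_ : _ \o _ = fun z => if i \in s then tnth z i + c i else tnth z i); last first.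
  by apply/funext => z /=; rewrite tnth_mktuple.
case: (i \in s); last exact: measurable_tnth.
by apply: measurable_funD => //; exact: measurable_tnth.
Qed.

(** By independence, coordinate [k] may be replaced by a fresh sample of its own law without
    changing the law of the vector. This isolates one Gaussian variable to integrate. *)
Lemma integral_resample k (g : n.-tuple R -> \bar R) :
  measurable_fun setT g -> (forall t, 0 <= g t)%E ->
  (\int[P]_w g (X w) = \int[P]_w \int[N k]_y g (tuple_set (X w) k y))%E.
Proof.
move=> mg g0.
have mX2 : measurable_fun setT (fun z : T * R => tuple_set (X z.1) k z.2).
  apply: (measurableT_comp (@measurable_tuple_set k) (g := fun z : T * R => (z.2, X z.1))).
  apply: measurable_fun_pair; first exact: measurable_snd.
  exact: (measurableT_comp mX measurable_fst).
rewrite (@tuple_law R n _ _ _ _ P (P \x N k)%E X (fun z => tuple_set (X z.1) k z.2))//.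
  rewrite fubini_tonelli1//=; first exact: (measurableT_comp mg mX2).
move=> A mA; rewrite X_law// (bigD1 k)//=.
have mA' i : measurable (if i == k then setT else A i) by case: ifP.
have mB : measurable [set w | forall i, (if i == k then setT else A i) (tnth (X w) i)].
  by have := mX measurableT (measurable_rectangle mA'); rewrite setTI.
rewrite (_ : [set w | _] = [set w | forall i, (if i == k then setT else A i) (tnth (X w) i)] `*` A k).
  rewrite product_measure1E//; last exact: mA.
  rewrite muleC; congr (_ * _)%E.
  symmetry; apply: (etrans (X_law mA')).
  rewrite (bigD1 k)//= eqxx probability_setT mul1e.
  by apply: eq_bigr => i /negbTE ->.
apply/seteqP; split => [[w y] /= h|[w y] /= [h1 h2] i].
  split => [i|]; last by have := h k; rewrite tnth_mktuple eqxx.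
  by have := h i; rewrite tnth_mktuple; case: ifP.
by rewrite tnth_mktuple; have := h1 i; case: eqP => [->|].
Qed.

(** Induction on the list of coordinates. The weight of [k] is untouched by the shift of [s], since
    [k] is not in [s]; after resampling coordinate [k] it is the weight of [normal_shift]. *)
Lemma cameron_martin_seq (s : seq 'I_n) (g : n.-tuple R -> \bar R) :
  uniq s -> measurable_fun setT g -> (forall t, 0 <= g t)%E ->
  (\int[P]_w ((expR (\sum_(i <- s) (b i * tnth (X w) i - b i ^+ 2 * v i / 2)))%:E * g (X w))
  = \int[P]_w g (tuple_shift s (fun i => b i * v i)%R (X w)))%E.
Proof.
elim: s g => [|k s ih] g.
  move=> _ mg g0; apply: eq_integral => w _; rewrite big_nil expR0 mul1e; congr g.
  by apply: eq_from_tnth => i; rewrite tnth_mktuple.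
move=> /= /andP[ks us] mg g0.
pose e (t : n.-tuple R) := expR (b k * tnth t k - b k ^+ 2 * v k / 2).
have me : measurable_fun setT e.
  apply: measurableT_comp => //; apply: measurable_funB => //; apply: measurable_funM => //.
  exact: measurable_tnth.
have mEg : measurable_fun setT (fun t => (e t)%:E * g t)%E.
  by apply: emeasurable_funM => //; exact/measurable_EFinP.
transitivity (\int[P]_w ((expR (\sum_(i <- s) (b i * tnth (X w) i - b i ^+ 2 * v i / 2)))%:E
    * ((e (X w))%:E * g (X w))))%E.
  apply: eq_integral => w _; rewrite big_cons expRD muleA -EFinM.
  by rewrite [X in (X%:E * _)%E]mulrC.
(* The weight of [k] is absorbed into the test function before the induction hypothesis shifts the
   coordinates in [s]. *)
rewrite (ih (fun t => (e t)%:E * g t)%E)//; last first.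
  by move=> t; rewrite mule_ge0// lee_fin expR_ge0.
have msh := @measurable_tuple_shift.
pose c := (fun i => b i * v i).
rewrite (@integral_resample k (fun t => (e (tuple_shift s c t))%:E * g (tuple_shift s c t))%E); first last.
- by move=> t; rewrite mule_ge0// lee_fin expR_ge0.
- exact: (measurableT_comp mEg).
rewrite (@integral_resample k (fun t => g (tuple_shift (k :: s) c t))); first last.
- by [].
- exact: (measurableT_comp mg).
apply: eq_integral => w _.
pose h y := g (tuple_shift s c (tuple_set (X w) k y)).
have mh : measurable_fun setT h.
  apply: (measurableT_comp mg); apply: (measurableT_comp (msh s c)).
  apply: (measurableT_comp (@measurable_tuple_set k) (g := fun y => (y, X w))).
  exact: measurable_pair2.
have := @normal_shift R (v k) (b k) h (v0 k) mh (fun=> g0 _).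
rewrite /h => E; transitivity (\int[N k]_x ((expR (b k * x - b k ^+ 2 * v k / 2))%:E * h x))%E.
  apply: eq_integral => y _; rewrite /e tnth_mktuple (negbTE ks) tnth_mktuple eqxx.
  by [].
rewrite /h E; apply: eq_integral => y _; congr g; apply: eq_from_tnth => i.
rewrite !tnth_mktuple in_cons; have [->|ik] := eqVneq i k => //=.
by rewrite (negbTE ks).
Qed.

Lemma cameron_martin_tuple (g : n.-tuple R -> \bar R) :
  measurable_fun setT g -> (forall t, 0 <= g t)%E ->
  (\int[P]_w ((expR (\sum_(i < n) b i * tnth (X w) i - (\sum_(i < n) b i ^+ 2 * v i) / 2))%:E * g (X w))
  = \int[P]_w g [tuple tnth (X w) i + b i * v i | i < n]%R)%E.
Proof.
move=> mg g0; have := cameron_martin_seq (index_enum_uniq 'I_n) mg g0.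
under eq_integral do rewrite sumrB -mulr_suml.
move=> ->; apply: eq_integral => w _; congr g; apply: eq_from_tnth => i.
by rewrite !tnth_mktuple mem_index_enum.
Qed.

End cameron_martin_finite.

(** * Step functions on a common grid *)

Section step_functions.
Context (R : realType).
Local Notation leb := (@lebesgue_measure R).
Implicit Types (s : seq (R * (R * R))) (pts : seq R).

Definition endpoints s : seq R := flatten [seq [:: p.2.1; p.2.2] | p <- s].

(** The default value repeats the last point, so the sequence is monotone on all of [nat], which is
    the form of partition that [brownian_line] quantifies over. *)
Definition grid pts (k : nat) : R := nth (last 0 pts) pts k.

(** An interval of [s] covers cell [k] exactly when [k] lies between the positions of its endpoints
    in [pts]. *)
Definition grid_coef pts s (k : nat) : R :=
  \sum_(p <- s) p.1 * (index p.2.1 pts <= k < index p.2.2 pts)%N%:R.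

Lemma telescope_grid pts (f : R -> R) n (a b : R) : size pts = n.+1 ->
  a \in pts -> b \in pts -> (index a pts <= index b pts)%N ->
  f b - f a = \sum_(k < n) (index a pts <= k < index b pts)%N%:R
                * (f (grid pts k.+1) - f (grid pts k)).
Proof.
move=> sp ap bp ab.
have ib : (index b pts <= n)%N by rewrite -ltnS -sp index_mem.
rewrite -{1}(nth_index (last 0 pts) ap) -{1}(nth_index (last 0 pts) bp) -!/(grid _ _).
rewrite -(telescope_sumr (fun k => f (grid pts k)) ab).
rewrite -(big_mkord xpredT (fun k => (index a pts <= k < index b pts)%N%:R
                * (f (grid pts k.+1) - f (grid pts k)))).
have ia := leq_trans ab ib.
rewrite [RHS](big_cat_nat _ (n := index a pts)) //=.
rewrite [X in _ = _ + X](big_cat_nat _ (n := index b pts)) //=.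
rewrite [X in _ = X + _]big_nat [X in _ = X + _]big1 ?add0r; last first.
  by move=> i /andP[_ ji]; rewrite leqNgt ji mul0r.
rewrite [X in _ = _ + X]big_nat [X in _ = _ + X]big1 ?addr0; last first.
  by move=> i /andP[ji _]; rewrite [(i < _)%N]ltnNge ji andbF mul0r.
by rewrite big_nat [RHS]big_nat; apply: eq_bigr => i ->; rewrite mul1r.
Qed.

Section fixed_grid.
Variables (pts : seq R) (n : nat).
Hypotheses (pts_sorted : sorted <%R pts) (size_pts : size pts = n.+1).

Lemma grid_lt k : (k < n)%N -> grid pts k < grid pts k.+1.
Proof.
move=> kn; apply: (sorted_ltn_nth lt_trans) => //.
  by rewrite inE size_pts ltnS ltnW.
by rewrite inE size_pts ltnS.
Qed.

Lemma grid_homo : {homo grid pts : i j / (i <= j)%N >-> i <= j}.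
Proof.
apply: homo_leq => //; first exact: le_trans.
move=> k; case: (ltnP k n) => [/grid_lt/ltW//|nk].
rewrite /grid (@nth_default _ _ _ k.+1) ?size_pts//.
move: nk; rewrite leq_eqVlt => /orP[/eqP <-|nk].
  have -> : n = (size pts).-1 by rewrite size_pts.
  by rewrite nth_last; case: pts size_pts.
by rewrite nth_default// size_pts.
Qed.

Lemma index_le a b : a \in pts -> b \in pts -> a <= b ->
  (index a pts <= index b pts)%N.
Proof.
move=> ap bp; apply: contraTT; rewrite -ltnNge -ltNge => ba.
rewrite -(nth_index 0 ap) -(nth_index 0 bp).
by apply: (sorted_ltn_nth lt_trans) => //; rewrite inE index_mem.
Qed.

Definition on_grid s := step_ok s /\ {subset endpoints s <= pts}.

Lemma on_gridP s p : on_grid s -> p \in s -> [/\ p.2.1 <= p.2.2, p.2.1 \in pts & p.2.2 \in pts].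
Proof.
move=> [/allP ok sub] ps; split; first exact: ok.
- by apply: sub; apply/flatten_mapP; exists p; rewrite ?inE ?eqxx.
- by apply: sub; apply/flatten_mapP; exists p; rewrite ?inE ?eqxx ?orbT.
Qed.

(** Stated for an arbitrary [f] because it is used twice: with a Brownian path it expands the step
    integral over increments, and with [x |-> (y <= x)] it expands the step function over indicators
    of cells. *)
Lemma telescope_step s (f : R -> R) : on_grid s ->
  \sum_(p <- s) p.1 * (f p.2.2 - f p.2.1) =
  \sum_(k < n) grid_coef pts s k * (f (grid pts k.+1) - f (grid pts k)).
Proof.
move=> os; under [RHS]eq_bigr do rewrite /grid_coef mulr_suml.
rewrite exchange_big/= big_seq [RHS]big_seq; apply: eq_bigr => p ps.
have [pab pa pb] := on_gridP os ps.
rewrite (@telescope_grid pts f n)//; last exact: index_le.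
by rewrite mulr_sumr; apply: eq_bigr => k _; rewrite mulrA.
Qed.

Definition cell (k : nat) : set R := `]grid pts k, grid pts k.+1]%classic.

Lemma indic_itv_oc (a b y : R) : a <= b ->
  \1_(`]a, b]%classic : set R) y = (y <= b)%R%:R - (y <= a)%R%:R :> R.
Proof.
move=> ab; rewrite indicE /=; case: (leP y a) => ya.
- rewrite (le_trans ya ab) memNset ?subrr//= in_itv/= => /andP[].
  by rewrite ltNge ya.
- case: (leP y b) => yb; last first.
    by rewrite memNset ?subrr//= in_itv/= => /andP[_]; rewrite leNgt yb.
  by rewrite mem_set ?subr0//= in_itv/= ya yb.
Qed.

Lemma step_fun_grid s y : on_grid s ->
  step_fun s y = \sum_(k < n) grid_coef pts s k * \1_(cell k) y.
Proof.
move=> os; rewrite /step_fun.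
transitivity (\sum_(p <- s) p.1 * ((y <= p.2.2)%R%:R - (y <= p.2.1)%R%:R)).
  rewrite big_seq [RHS]big_seq; apply: eq_bigr => p ps.
  by rewrite indic_itv_oc//; have [] := on_gridP os ps.
rewrite (telescope_step (fun x => (y <= x)%R%:R) os).
by apply: eq_bigr => k _; rewrite indic_itv_oc// ltW// grid_lt.
Qed.

Lemma cell_indicM (k l : 'I_n) y :
  \1_(cell k) y * \1_(cell l) y = (k == l)%:R * \1_(cell k) y :> R.
Proof.
wlog kl : k l / (k <= l)%N.
  move=> H; case/orP: (leq_total k l) => h; first exact: H.
  rewrite mulrC H// eq_sym; have [->//|] := eqVneq k l.
  by rewrite !mul0r.
have [->|kl'] := eqVneq k l.
  by rewrite mul1r indicE; case: (_ \in _); rewrite ?mulr1 ?mulr0.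
have {}kl : (k < l)%N by rewrite ltn_neqAle kl andbT.
rewrite mul0r !indicE; case: (boolP (y \in cell k)) => [|_]; last by rewrite mul0r.
rewrite inE /cell/= in_itv/= => /andP[_ yk]; rewrite memNset ?mulr0// /cell/= in_itv/= => /andP[yl _].
have := lt_le_trans yl yk; rewrite ltNge => /negP; apply.
exact: grid_homo.
Qed.

Lemma integrable_cell k : leb.-integrable setT (EFin \o (\1_(cell k) : R -> R)).
Proof. exact: integrable_indic_itv. Qed.

Lemma Rintegral_cell (k : 'I_n) :
  \int[leb]_y (\1_(cell k) y) = grid pts k.+1 - grid pts k.
Proof.
rewrite /Rintegral integral_indic//= ?setIT; last exact: measurable_itv.
by rewrite lebesgue_measure_itv/= lte_fin grid_lt.
Qed.

Lemma Rintegral_stepM s s' : on_grid s -> on_grid s' ->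
  \int[leb]_y (step_fun s y * step_fun s' y) =
  \sum_(k < n) grid_coef pts s k * grid_coef pts s' k
     * (grid pts k.+1 - grid pts k).
Proof.
move=> os os'.
transitivity (\int[leb]_y (\sum_(k < n) (grid_coef pts s k * grid_coef pts s' k)
   * \1_(cell k) y)).
  apply: eq_Rintegral => y _; rewrite !step_fun_grid// mulr_suml; apply: eq_bigr => k _.
  rewrite mulr_sumr (bigD1 k)//= big1 => [|l lk].
    by rewrite addr0 mulrACA cell_indicM eqxx mul1r.
  by rewrite mulrACA cell_indicM eq_sym (negbTE lk) mul0r mulr0.
rewrite Rintegral_sum/=; last by move=> k _; apply: RintegrableZ; exact: integrable_cell.
apply: eq_bigr => k _; rewrite RintegralZl//; last exact: integrable_cell.
by rewrite Rintegral_cell.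
Qed.

End fixed_grid.

Lemma exists_grid (I : finType) (S : I -> seq (R * (R * R))) :
  (forall i, step_ok (S i)) ->
  exists pts n, [/\ sorted <%R pts, size pts = n.+1 & forall i, on_grid pts (S i)].
Proof.
(* The extra point 0 keeps the grid nonempty when no interval is present, so that its size is a
   successor. *)
move=> ok; pose all := 0 :: flatten [seq endpoints (S i) | i <- enum I].
pose pts := sort <=%R (undup all).
exists pts, (size pts).-1; split.
- by rewrite sort_lt_sorted undup_uniq.
- rewrite prednK// size_sort; have : (0 : R) \in undup all by rewrite mem_undup mem_head.
  by case: (undup all).
- move=> i; split => // x xi; rewrite mem_sort mem_undup inE; apply/orP; right.
  by apply/flatten_mapP; exists i => //; rewrite mem_enum.
Qed.

End step_functions.

(** * The Cameron-Martin formula for step functions *)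

Section brownian_steps.
Context (R : realType) d (T : measurableType d) (P : probability T R).
Variable W : R -> T -> R.
Hypothesis W_brownian : brownian_line P W.
Local Notation leb := (@lebesgue_measure R).

Lemma measurable_step_integral s : measurable_fun setT (step_integral W s).
Proof.
have [mW _ _ _ _] := W_brownian; rewrite /step_integral.
apply: measurable_sum => p; apply: measurable_funM => //.
by apply: measurable_funB; exact: mW.
Qed.

Section grid.
Variables (pts : seq R) (n : nat).
Hypotheses (pts_sorted : sorted <%R pts) (size_pts : size pts = n.+1).

Definition increments (w : T) : n.-tuple R :=
  [tuple W (grid pts i.+1) w - W (grid pts i) w | i < n].

Lemma measurable_increments : measurable_fun setT increments.
Proof.
have [mW _ _ _ _] := W_brownian; apply/measurable_fun_tnthP => i.
rewrite (_ : _ \o _ = fun w => W (grid pts i.+1) w - W (grid pts i) w).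
  by apply: measurable_funB; exact: mW.
by apply/funext => w /=; rewrite tnth_mktuple.
Qed.

Lemma increments_law (A : 'I_n -> set R) : (forall i, measurable (A i)) ->
  P [set w | forall i, A i (tnth (increments w) i)] =
  (\prod_(i < n) normal_prob 0 (Num.sqrt (grid pts i.+1 - grid pts i)) (A i))%E.
Proof.
move=> mA; have [_ _ _ gW iW] := W_brownian.
have := iW n (grid pts) (grid_homo pts_sorted size_pts) A mA.
under eq_bigr => i _ do rewrite gW ?(grid_lt pts_sorted size_pts)//.
move=> <-; congr (P _); apply/seteqP; split => w /= h i.
- by move=> _; have := h i; rewrite tnth_mktuple.
- by rewrite tnth_mktuple; exact: h.
Qed.

Lemma step_integral_grid s w : on_grid pts s ->
  step_integral W s w = \sum_(i < n) grid_coef pts s i * tnth (increments w) i.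
Proof.
move=> os; rewrite /step_integral (telescope_step pts_sorted size_pts (fun x => W x w) os).
by apply: eq_bigr => i _; rewrite tnth_mktuple.
Qed.

End grid.

(** On a common grid all step integrals are linear forms in the independent increments. With [b] the
    grid values of [s] and [v] the cell lengths, the shifts [b i * v i] add up to L^2 inner
    products. *)
Lemma cameron_martin_step m (s : seq (R * (R * R))) (S : 'I_m -> seq (R * (R * R)))
    (g : m.-tuple R -> \bar R) : step_ok s -> (forall i, step_ok (S i)) ->
  measurable_fun setT g -> (forall t, 0 <= g t)%E ->
  (\int[P]_w ((expR (step_integral W s w - (\int[leb]_y (step_fun s y ^+ 2)) / 2)%R)%:E
       * g [tuple step_integral W (S i) w | i < m]) =
   \int[P]_w g [tuple step_integral W (S i) w
                + \int[leb]_y (step_fun s y * step_fun (S i) y) | i < m]%R)%E.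
Proof.
move=> ok okS mg g0.
(* [None] indexes the density [s] and [Some i] the test functions, so that one grid serves them
   all. *)
have [|pts [n [ps sp og]]] := @exists_grid R (option 'I_m)
   (fun o => if o is Some i then S i else s); first by case.
have os : on_grid pts s := og None.
have oS i : on_grid pts (S i) := og (Some i).
pose v (i : 'I_n) := grid pts i.+1 - grid pts i.
pose b (i : 'I_n) := grid_coef pts s i.
have v0 i : 0 < v i by rewrite subr_gt0 (grid_lt ps sp).
pose L (t : n.-tuple R) : m.-tuple R :=
  [tuple \sum_(k < n) grid_coef pts (S i) k * tnth t k | i < m].
have mL : measurable_fun setT L.
  apply/measurable_fun_tnthP => i.
  rewrite (_ : _ \o _ = fun t => \sum_(k < n) grid_coef pts (S i) k * tnth t k); last first.
    by apply/funext => t /=; rewrite tnth_mktuple.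
  apply: measurable_sum => k; apply: measurable_funM => //; exact: measurable_tnth.
have := @cameron_martin_tuple R n _ _ P (increments pts n) v b
  (@measurable_increments pts n) v0 (increments_law ps sp) (g \o L)
  (measurableT_comp mg mL) (fun t => g0 _).
move=> E; etransitivity; last (etransitivity; first exact: E).
- apply: eq_integral => w _; congr (_ * _)%E; last first.
    congr g; apply: eq_from_tnth => i.
    by rewrite !tnth_mktuple (step_integral_grid ps sp).
  rewrite (step_integral_grid ps sp)//; congr (expR (_ - _))%:E; congr (_ / _).
  rewrite (Rintegral_stepM ps sp os os).
  by apply: eq_bigr => k _; rewrite expr2.
- apply: eq_integral => w _; congr g; apply: eq_from_tnth => i.
  rewrite !tnth_mktuple (step_integral_grid ps sp)// (Rintegral_stepM ps sp)//.
  rewrite -big_split/=; apply: eq_bigr => k _.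
  by rewrite !tnth_mktuple mulrDr; congr (_ + _); rewrite /b /v; ring.
Qed.

End brownian_steps.

(** * Limits in L^2 and almost sure subsequences *)

Section L2_limits.
Context d (T : measurableType d) (R : realType) (mu : {measure set T -> \bar R}).
Implicit Types f g h : T -> R.

Lemma Rint_cauchy_schwarz f g : sqint mu f -> sqint mu g ->
  `|\int[mu]_x (f x * g x)| <= l2n mu f * l2n mu g.
Proof.
move=> sf sg; apply: le_trans (cauchy_schwarz sf sg).
by apply: ler_norm_Rint; exact: sqintM.
Qed.

Lemma l2n_sqr f : l2n mu f ^+ 2 = \int[mu]_x (f x ^+ 2).
Proof. by rewrite sqr_sqrtr// Rint_sqr_ge0. Qed.

Lemma l2n_dist f g : sqint mu f -> sqint mu g ->
  `|l2n mu f - l2n mu g| <= l2n mu (fun x => f x - g x).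
Proof.
move=> sf sg; rewrite ler_norml; apply/andP; split.
  have := l2n_D sf (sqintZ (-1) (sqintB sf sg)).
  rewrite (_ : (fun x => _ + _) = g); last by apply/funext => x; ring.
  rewrite [X in _ <= _ + X](_ : _ = l2n mu (fun x => f x - g x)).
    by move=> ?; lra.
  by rewrite /l2n; congr Num.sqrt; apply: eq_Rintegral => x _; ring.
have := l2n_D sg (sqintB sf sg).
rewrite (_ : (fun x => _ + _) = f); first by move=> ?; lra.
by apply/funext => x; ring.
Qed.

Lemma cvg_l2n (fn : nat -> T -> R) f : (forall n, sqint mu (fn n)) -> sqint mu f ->
  l2n mu (fun x => fn n x - f x) @[n --> \oo] --> 0 ->
  l2n mu (fn n) @[n --> \oo] --> l2n mu f.
Proof.
move=> sn sf fnf; apply/cvgrPdist_le => e e0.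
move/cvgrPdist_le : fnf => /(_ e e0); apply: filterS => n; rewrite sub0r normrN => h.
rewrite distrC (le_trans (l2n_dist (sn n) sf))//.
by rewrite (le_trans _ h)// ler_norm.
Qed.

Lemma cvg_inner (fn gn : nat -> T -> R) f g :
  (forall n, sqint mu (fn n)) -> sqint mu f ->
  (forall n, sqint mu (gn n)) -> sqint mu g ->
  l2n mu (fun x => fn n x - f x) @[n --> \oo] --> 0 ->
  l2n mu (fun x => gn n x - g x) @[n --> \oo] --> 0 ->
  \int[mu]_x (fn n x * gn n x) @[n --> \oo] --> \int[mu]_x (f x * g x).
Proof.
move=> sn sf tn sg fnf gng.
apply/subr_cvg0; apply/norm_cvg0P.
apply: (@squeeze_cvgr _ _ _ _ (cst 0) (fun n => l2n mu (fun x => fn n x - f x) * l2n mu (gn n)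
  + l2n mu f * l2n mu (fun x => gn n x - g x))).
- apply: nearW => n; rewrite normr_ge0/=.
  rewrite [X in `|X|](_ : _ = \int[mu]_x ((fn n x - f x) * gn n x)
     + \int[mu]_x (f x * (gn n x - g x))); last first.
    rewrite -RintegralB//; [|exact: sqintM..].
    rewrite -RintegralD//; [|apply: sqintM => //; exact: sqintB..].
    by apply: eq_Rintegral => x _; ring.
  rewrite (le_trans (ler_normD _ _))// lerD// Rint_cauchy_schwarz//; exact: sqintB.
- exact: cvg_cst.
- rewrite [X in _ --> X](_ : _ = 0 * l2n mu g + l2n mu f * 0); last by ring.
  apply: cvgD; apply: cvgM => //; last exact: cvg_cst.
  exact: cvg_l2n.
Qed.

(** Choosing [phi k] with integral at most [1 / 2 ^ k.+1] makes the series of the [q (phi k)]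
    integrable, hence finite almost everywhere, and each term is bounded by the tail of the series.
    [phi] need not be increasing: [n <= phi n] is enough to preserve limits ([cvg_subseq]). *)
Lemma subseq_ae_cvg0 (q : nat -> T -> R) : (forall n, measurable_fun setT (q n)) ->
  (forall n x, 0 <= q n x) -> (forall n, mu.-integrable setT (EFin \o q n)) ->
  \int[mu]_x q n x @[n --> \oo] --> 0 ->
  exists2 phi : nat -> nat, (forall n, n <= phi n)%N &
    {ae mu, forall x, q (phi n) x @[n --> \oo] --> 0}.
Proof.
move=> mq q0 iq /cvgrPdist_le qc.
have ex k : exists n, (k <= n)%N /\ \int[mu]_x q n x <= 1 / (2 ^ k.+1)%:R.
  have k0 : 0 < 1 / (2 ^ k.+1)%:R :> R by rewrite divr_gt0// ltr0n expn_gt0.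
  have [N _ HN] := qc _ k0; exists (maxn k N); split; first exact: leq_maxl.
  have := HN (maxn k N) (leq_maxr _ _); rewrite sub0r normrN.
  exact: le_trans (ler_norm _).
have [phi Hphi] := choice ex.
exists phi; first by move=> n; have [] := Hphi n.
pose S x := (\sum_(n <oo) (q (phi n) x)%:E)%E.
have mS : measurable_fun setT S.
  apply: ge0_emeasurable_sum => //.
    by move=> k x _ _; rewrite lee_fin.
  by move=> k _; exact/measurable_EFinP.
have S0 x : (0 <= S x)%E by apply: nneseries_ge0 => n _ _; rewrite lee_fin.
have iS : mu.-integrable setT S.
  apply/integrableP; split => //.
  under eq_integral => x _ do rewrite gee0_abs//.
  rewrite integral_nneseries//; last 2 first.
    by move=> n; exact/measurable_EFinP.
    by move=> n x _; rewrite lee_fin.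
  apply: le_lt_trans (ltry 1); apply: le_trans (epsilon_trick0 xpredT ler01).
  apply: lee_nneseries => [n _ _|n _]; first by apply: integral_ge0 => x _; rewrite lee_fin.
  by rewrite -EFin_Rintegral// lee_fin; have [] := Hphi n.
have := integrable_ae measurableT iS; apply: filterS => x /(_ I) Sfin.
suff : (q (phi n) x)%:E @[n --> \oo] --> 0%E by move/fine_cvg.
have Sx : (S x < +oo)%E by move: Sfin; rewrite fin_numE => /andP[_]; rewrite ltey.
have q0' n : (0 <= (q (phi n) x)%:E)%E by rewrite lee_fin.
have := nneseries_tail_cvg Sx (fun k _ => q0' k).
apply: (@squeeze_cvge _ _ _ _ (cst 0%E)) => //; last exact: cvg_cst.
apply: nearW => n; rewrite q0'/=.
rewrite (@nneseries_split _ _ n 1)// addn1 big_nat1 leeDl//.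
by apply: nneseries_ge0 => k _ _; exact: q0'.
Qed.

End L2_limits.

(** * Elementary bounds on the exponential *)

Section exp_bounds.
Context (R : realType).
Implicit Types x y : R.

(** For nonnegative [y], squaring [1 + y / 2 <= expR (y / 2)] gives the constant 4. The symmetric
    right-hand side is a sum of exponential moments, which are computable. *)
Lemma sqr_le_expR x : x ^+ 2 <= 4 * (expR x + expR (- x)).
Proof.
have H y : 0 <= y -> y ^+ 2 <= 4 * expR y.
  move=> y0; have := expR_ge1Dx (y / 2) => h.
  have -> : expR y = expR (y / 2) ^+ 2 by rewrite -expRM_natl; congr expR; field.
  by nra.
have := expR_ge0 x; have := expR_ge0 (- x).
case: (leP 0 x) => [/H|/ltW]; first by lra.
by rewrite -oppr_ge0 => /H; rewrite sqrrN; lra.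
Qed.

(** By convexity the slope between [x] and [y] is at most the larger of the two exponentials. The
    bound keeps their sum because its L^2 norm is under control in [cvg_wexp_L1]. *)
Lemma expR_lip x y : `|expR x - expR y| <= `|x - y| * (expR x + expR y).
Proof.
wlog xy : x y / x <= y.
  move=> H; have [/H//|/ltW/H] := leP x y.
  by rewrite distrC (distrC y) (addrC (expR y)).
have h1 : expR x - expR y <= 0 by rewrite subr_le0 ler_expR.
have h2 : x - y <= 0 by rewrite subr_le0.
rewrite !ler0_norm//.
have -> : expR x = expR y * expR (x - y) by rewrite -expRD; congr expR; ring.
have h3 : 0 <= expR y * (expR (x - y) - (1 + (x - y))).
  by rewrite mulr_ge0 ?expR_ge0// subr_ge0 expR_ge1Dx.
have h4 : 0 <= - (x - y) * (expR y * expR (x - y)).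
  by rewrite !mulr_ge0 ?expR_ge0// oppr_ge0.
by lra.
Qed.

End exp_bounds.

(** * Exponential moments of step integrals *)

Section step_moments.
Context (R : realType) d (T : measurableType d) (P : probability T R).
Variable W : R -> T -> R.
Hypothesis W_brownian : brownian_line P W.
Local Notation leb := (@lebesgue_measure R).

Definition scale_step (a : R) (s : seq (R * (R * R))) := [seq (a * p.1, p.2) | p <- s].

Lemma scale_step_ok a s : step_ok s -> step_ok (scale_step a s).
Proof. by rewrite /step_ok all_map. Qed.

Lemma step_fun_scale a s y : step_fun (scale_step a s) y = a * step_fun s y.
Proof.
by rewrite /step_fun big_map mulr_sumr; apply: eq_bigr => p _; rewrite mulrA.
Qed.

Lemma step_integral_scale a s w :
  step_integral W (scale_step a s) w = a * step_integral W s w.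
Proof.
by rewrite /step_integral big_map mulr_sumr; apply: eq_bigr => p _; rewrite mulrA.
Qed.

Lemma sqint_step_fun s : sqint leb (step_fun s).
Proof.
rewrite /step_fun; apply: sqint_sum => p _; apply: sqintZ; split.
  exact: measurable_indic.
rewrite (_ : (fun x => _) = (\1_(`]p.2.1, p.2.2]%classic : set R) : R -> R)); last first.
  by apply/funext => x; rewrite indicE; case: (_ \in _); rewrite ?expr1n// expr0n.
exact: integrable_indic_itv.
Qed.

(** This is Cameron-Martin without test variables ([m = 0]) and with [g = 1]. *)
Lemma step_exp_moment s : step_ok s ->
  (\int[P]_w (expR (step_integral W s w - (\int[leb]_y (step_fun s y ^+ 2)) / 2))%:E = 1)%E.
Proof.
move=> ok.
have := @cameron_martin_step _ _ _ P W W_brownian 0 s (fun=> [::]) (cst 1%E) ok (fun=> erefl)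
  (measurable_cst _) (fun=> lee01).
rewrite integral_cst//= probability_setT mule1 => <-.
by apply: eq_integral => w _; rewrite mule1.
Qed.

Lemma measurable_expR_comp (f : T -> R) : measurable_fun setT f ->
  measurable_fun setT (fun w => expR (f w)).
Proof. by move=> mf; apply: measurableT_comp. Qed.

(** The preceding identity for [scale_step a s] yields the Laplace transform of a centred Gaussian
    variable. *)
Lemma step_exp_integrable a s : step_ok s ->
  P.-integrable setT (EFin \o (fun w => expR (a * step_integral W s w))) /\
  \int[P]_w expR (a * step_integral W s w) =
  expR (a ^+ 2 * (\int[leb]_y (step_fun s y ^+ 2)) / 2).
Proof.
move=> ok; have mJ := @measurable_step_integral _ _ _ P _ W_brownian s.
have E : (\int[P]_w (expR (a * step_integral W s w))%:E =
    (expR (a ^+ 2 * (\int[leb]_y (step_fun s y ^+ 2)) / 2))%:E)%E.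
  have := step_exp_moment (scale_step_ok a ok).
  under eq_Rintegral do rewrite step_fun_scale exprMn.
  rewrite RintegralZl//; last by have [] := sqint_step_fun s.
  under eq_integral do rewrite step_integral_scale expRD EFinM.
  rewrite ge0_integralZr//; first last.
  - by apply/measurable_EFinP/measurable_expR_comp; exact: measurable_funM.
  - move=> /(congr1 (fun x => x * (expR (a ^+ 2 * \int[leb]_y (step_fun s y ^+ 2) / 2)%R)%:E)%E).
    rewrite -muleA -EFinM -expRD mul1e addNr expR0 mule1 => <-.
    by [].
split; last by rewrite /Rintegral E.
apply: integrable_ge0 => //; last by rewrite E ltry.
by apply: measurable_expR_comp; exact: measurable_funM.
Qed.

(** Read off from the exponential moments at 1 and -1, so no variance has to be computed. *)
Lemma sqint_step_integral s : step_ok s -> sqint P (step_integral W s).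
Proof.
move=> ok; have mJ := @measurable_step_integral _ _ _ P _ W_brownian s.
split => //.
apply: (@integrable_le _ _ _ _ _ (fun w => 4 * (expR (1 * step_integral W s w)
   + expR (-1 * step_integral W s w)))).
- exact: measurable_funX.
- by move=> w; rewrite ger0_norm ?sqr_ge0// mul1r mulN1r sqr_le_expR.
- apply: RintegrableZ; apply: RintegrableD; exact: (step_exp_integrable _ ok).1.
Qed.

End step_moments.

(** * Stochastic exponentials of Wiener integrals *)

Section wiener_limits.
Context (R : realType) d (T : measurableType d) (P : probability T R).
Variable W : R -> T -> R.
Hypothesis W_brownian : brownian_line P W.
Local Notation leb := (@lebesgue_measure R).
Local Notation sq f := (\int[leb]_y (f y ^+ 2)).

Lemma integrable_cst (c : R) : P.-integrable setT (EFin \o cst c).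
Proof. exact: finite_measure_integrable_cst. Qed.

Lemma Rintegral_cst_prob (c : R) : \int[P]_w c = c.
Proof. by rewrite Rintegral_cst//= probability_setT mulr1. Qed.

Lemma sqint_cst (c : R) : sqint P (cst c).
Proof. by split => //; exact: (integrable_cst (c ^+ 2)). Qed.

Lemma wiener_seq h J : wiener_integral P W h J ->
  [/\ sqint leb h, sqint P J &
    exists s : nat -> seq (R * (R * R)),
    [/\ forall n, step_ok (s n),
       l2n leb (fun y => step_fun (s n) y - h y) @[n --> \oo] --> 0 &
       l2n P (fun w => step_integral W (s n) w - J w) @[n --> \oo] --> 0]].
Proof.
move=> [/Lfun2P sh /Lfun2P sJ [s [ok c1 c2]]]; split => //; exists s; split => //.
- by apply: L2_cvgP => // n; exact: sqint_step_fun.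
- by apply: L2_cvgP => // n; exact: sqint_step_integral.
Qed.

Lemma step_sq_cvg h (s : nat -> seq (R * (R * R))) : sqint leb h ->
  l2n leb (fun y => step_fun (s n) y - h y) @[n --> \oo] --> 0 ->
  \int[leb]_y (step_fun (s n) y ^+ 2) @[n --> \oo] --> \int[leb]_y (h y ^+ 2).
Proof.
move=> sh c; have := cvg_inner (fun n => sqint_step_fun (s n)) sh
  (fun n => sqint_step_fun (s n)) sh c c.
by under eq_fun do under eq_Rintegral do rewrite -expr2;
   under eq_Rintegral do rewrite -expr2.
Qed.

(** The stochastic exponential, or Cameron-Martin density in direction [h], when [J] is a version of
    the Wiener integral of [h]. *)
Definition wexp h J (w : T) := expR (J w - sq h / 2).

(** The square has exponent [2 J - |h|^2], of mean [exp (2 |h|^2 - |h|^2)]; the norm is the square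
    root of this. *)
Lemma step_wexp s : step_ok s ->
  sqint P (wexp (step_fun s) (step_integral W s)) /\
  l2n P (wexp (step_fun s) (step_integral W s)) = expR (sq (step_fun s) / 2).
Proof.
move=> ok; have [i2 e2] := step_exp_integrable W_brownian 2 ok.
have mJ := @measurable_step_integral _ _ _ P _ W_brownian s.
have E w : wexp (step_fun s) (step_integral W s) w ^+ 2 =
    expR (- sq (step_fun s)) * expR (2 * step_integral W s w).
  by rewrite /wexp -expRM_natl -expRD; congr expR; field.
split.
  split.
    by apply: measurable_expR_comp; exact: measurable_funB.
  rewrite (_ : (fun w => _) = (fun w =>
    expR (- sq (step_fun s)) * expR (2 * step_integral W s w))); last exact/funext.
  exact: RintegrableZ.
rewrite /l2n; under eq_Rintegral do rewrite E.
rewrite RintegralZl// e2 -expRD -[X in Num.sqrt X](_ : expR (sq (step_fun s) / 2) ^+ 2 = _).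
  by rewrite sqrtr_sqr ger0_norm// expR_ge0.
by rewrite -expRM_natl; congr expR; field.
Qed.

Lemma cvg_sqr (u : nat -> R) (l : R) : u n @[n --> \oo] --> l -> u n ^+ 2 @[n --> \oo] --> l ^+ 2.
Proof. by move=> ul; under eq_fun do rewrite expr2; rewrite expr2; exact: cvgM. Qed.

Lemma cvg0_sqr (u : nat -> R) : u n @[n --> \oo] --> 0 -> u n ^+ 2 @[n --> \oo] --> 0.
Proof. by move=> /cvg_sqr; rewrite expr0n. Qed.

Lemma cvg_sqr0 (u : nat -> R) : u n ^+ 2 @[n --> \oo] --> 0 -> u n @[n --> \oo] --> 0.
Proof.
move=> /cvgrPdist_lt h; apply/cvgrPdist_lt => e e0.
have e20 : 0 < e ^+ 2 by rewrite exprn_gt0.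
have := h _ e20; apply: filterS => n; rewrite !sub0r !normrN normrX.
by rewrite ltr_pXn2r// nnegrE ltW.
Qed.

Lemma cvg_wexp (hn : nat -> R -> R) h (Jn : nat -> T -> R) J w :
  sq (hn n) @[n --> \oo] --> sq h -> (Jn n w - J w) ^+ 2 @[n --> \oo] --> 0 ->
  wexp (hn n) (Jn n) w @[n --> \oo] --> wexp h J w.
Proof.
move=> ch cJ; have c : Jn n w - sq (hn n) / 2 @[n --> \oo] --> J w - sq h / 2.
  apply: cvgB; first by apply/subr_cvg0; exact: cvg_sqr0.
  by apply: cvgM => //; exact: cvg_cst.
exact: (cvg_comp _ _ c (@continuous_expR R _)).
Qed.

Lemma cvg_subseq (phi : nat -> nat) (U : topologicalType) (u : nat -> U) (l : U) :
  (forall n, n <= phi n)%N -> u n @[n --> \oo] --> l -> u (phi n) @[n --> \oo] --> l.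
Proof.
move=> phige cu; apply: (cvg_comp phi u _ cu).
move=> A [N _ NA]; exists N => // n /= Nn; apply: NA => /=.
exact: leq_trans (phige n).
Qed.

Lemma measurable_wexp h J : measurable_fun setT J -> measurable_fun setT (wexp h J).
Proof. by move=> mJ; apply: measurable_expR_comp; exact: measurable_funB. Qed.

(** An upper bound is enough, so Fatou's lemma along an almost surely convergent subsequence of step
    approximations replaces any argument of uniform integrability. *)
Lemma wexp_second_moment h J : wiener_integral P W h J ->
  (\int[P]_w (wexp h J w ^+ 2)%:E <= (expR (sq h))%:E)%E.
Proof.
move=> /wiener_seq[sh sJ [s [ok c1 c2]]].
have sJn n := sqint_step_integral W_brownian (ok n).
have [phi phige phiae] : exists2 phi : nat -> nat, (forall n, n <= phi n)%N &
    {ae P, forall w, (step_integral W (s (phi n)) w - J w) ^+ 2 @[n --> \oo] --> 0}.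
  apply: (@subseq_ae_cvg0 _ _ _ P (fun n w => (step_integral W (s n) w - J w) ^+ 2)).
  - by move=> n; apply: measurable_funX; have [] := sqintB (sJn n) sJ.
  - by move=> n w; exact: sqr_ge0.
  - by move=> n; have [] := sqintB (sJn n) sJ.
  - have := cvg0_sqr c2.
    by apply: cvg_trans; apply: near_eq_cvg; apply: nearW => n /=; rewrite l2n_sqr.
have mE : measurable_fun setT (wexp h J) by apply: measurable_wexp; case: sJ.
have csq := cvg_subseq phige (step_sq_cvg sh c1).
pose en n w := wexp (step_fun (s (phi n))) (step_integral W (s (phi n))) w ^+ 2.
have en0 n w : 0 <= en n w by exact: sqr_ge0.
have men n : measurable_fun setT (EFin \o en n).
  by apply/measurable_EFinP; apply: measurable_funX; have [[]] := step_wexp (ok (phi n)).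
have F := @fatou _ _ _ P setT measurableT (fun n w => (en n w)%:E) men
  (fun n w _ => en0 n w).
have -> : (\int[P]_w (wexp h J w ^+ 2)%:E = \int[P]_w limn_einf (fun n => (en n w)%:E))%E.
  apply: ae_eq_integral => //.
  - by apply/measurable_EFinP; exact: measurable_funX.
  (* The lower limit is measurable because, up to sign, it is the upper limit of the opposite
     sequence. *)
  - rewrite (_ : (fun w => _) = fun w => (- limn_esup (fun n => - (en n w)%:E))%E).
      apply: measurableT_comp => //; apply: measurable_fun_limn_esup => n.
      by apply: measurableT_comp => //; exact: men.
    apply/funext => w; rewrite -limn_einfN; congr limn_einf.
    by apply/funext => n /=; rewrite ?opprK.
  - apply: filterS phiae => w cw _; apply/esym.
    have c : (en n w)%:E @[n --> \oo] --> (wexp h J w ^+ 2)%:E.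
      apply: cvg_EFin; first exact: nearW.
      have c := @cvg_wexp (fun n => step_fun (s (phi n))) h
        (fun n => step_integral W (s (phi n))) J w csq cw.
      exact: cvg_sqr c.
    by rewrite is_cvg_limn_einfE; [exact: cvg_lim|apply/cvg_ex; eexists; exact: c].
apply: le_trans F _.
have c : (\int[P]_w (en n w)%:E)%E @[n --> \oo] --> (expR (sq h))%:E.
  have E n : (\int[P]_w (en n w)%:E)%E = (expR (sq (step_fun (s (phi n)))))%:E.
    have [[_ i] e] := step_wexp (ok (phi n)).
    rewrite /en -EFin_Rintegral; last exact: i.
    rewrite -l2n_sqr e -expRM_natl; congr (expR _)%:E.
    by rewrite mulrCA divff ?mulr1.
  rewrite (funext E).
  apply: cvg_EFin; first exact: nearW.
  exact: (cvg_comp _ _ csq (@continuous_expR R _)).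
rewrite is_cvg_limn_einfE; last by apply/cvg_ex; eexists; exact: c.
by rewrite (cvg_lim _ c).
Qed.

Lemma sqint_wexp h J : wiener_integral P W h J -> sqint P (wexp h J).
Proof.
move=> wJ; have mE : measurable_fun setT (wexp h J).
  by apply: measurable_wexp; have [_ []] := wiener_seq wJ.
split => //; apply: integrable_ge0.
- exact: measurable_funX.
- by move=> w; exact: sqr_ge0.
- exact: le_lt_trans (wexp_second_moment wJ) (ltry _).
Qed.

End wiener_limits.

(** * From step functions to Wiener integrals *)

Section cameron_martin.
Context (R : realType) d (T : measurableType d) (P : probability T R).
Variable W : R -> T -> R.
Hypothesis W_brownian : brownian_line P W.
Local Notation leb := (@lebesgue_measure R).
Local Notation sq f := (\int[leb]_y (f y ^+ 2)).

(** Coordinatewise sequential continuity, which is exactly what almost sure limits along a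
    subsequence consume; tuples need no topology for it. *)
Definition tuple_continuous m (f : m.-tuple R -> R) := forall (u : nat -> m.-tuple R) t,
  (forall i, tnth (u n) i @[n --> \oo] --> tnth t i) -> f (u n) @[n --> \oo] --> f t.

Lemma cvg0_Mr (c : R) (u : nat -> R) :
  u n @[n --> \oo] --> 0 -> u n * c @[n --> \oo] --> 0.
Proof.
move=> u0; have : u n * c @[n --> \oo] --> 0 * c by apply: cvgM => //; exact: cvg_cst.
by rewrite mul0r.
Qed.

Lemma eq_cvgn (u v : nat -> R) (l l' : R) : u =1 v -> l = l' ->
  u n @[n --> \oo] --> l -> v n @[n --> \oo] --> l'.
Proof. by move=> /funext -> ->. Qed.

Lemma cvg_sumr (I : Type) (r : seq I) (u : I -> nat -> R) (l : I -> R) :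
  (forall i, u i n @[n --> \oo] --> l i) ->
  \sum_(i <- r) u i n @[n --> \oo] --> \sum_(i <- r) l i.
Proof.
move=> ul; elim: r => [|i r ih].
  by under eq_fun do rewrite big_nil; rewrite big_nil; exact: cvg_cst.
by under eq_fun do rewrite big_cons; rewrite big_cons; exact: cvgD.
Qed.

Lemma l2n_cst (c : R) : l2n P (cst c) = `|c|.
Proof. by rewrite /l2n (Rintegral_cst_prob P (c ^+ 2)) sqrtr_sqr. Qed.

Lemma sqint_integrable (f : T -> R) : sqint P f -> P.-integrable setT (EFin \o f).
Proof.
move=> /Lfun2P sf; apply/Lfun1_integrable.
have Pfin : P setT \is a fin_num by exact: fin_num_measure.
exact: (Lfun_subset12 Pfin sf).
Qed.

(** By [expR_lip] the difference is at most the difference of the exponents times the sum of the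
    exponentials. Cauchy-Schwarz concludes: the first factor tends to 0 in L^2 and the norm of the
    second stays bounded. *)
Lemma cvg_wexp_L1 h J (s : nat -> seq (R * (R * R))) : wiener_integral P W h J ->
  (forall n, step_ok (s n)) ->
  l2n leb (fun y => step_fun (s n) y - h y) @[n --> \oo] --> 0 ->
  l2n P (fun w => step_integral W (s n) w - J w) @[n --> \oo] --> 0 ->
  \int[P]_w `|wexp (step_fun (s n)) (step_integral W (s n)) w - wexp h J w|
    @[n --> \oo] --> 0.
Proof.
move=> wJ ok c1 c2; have sE := sqint_wexp W_brownian wJ.
have [sh sJ _] := wiener_seq W_brownian wJ.
have sJn n := sqint_step_integral W_brownian (ok n).
have csq := step_sq_cvg sh c1.
have cE : l2n P (wexp (step_fun (s n)) (step_integral W (s n))) @[n --> \oo] --> expR (sq h / 2).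
  under eq_fun do rewrite (step_wexp W_brownian (ok _)).2.
  have c : sq (step_fun (s n)) / 2 @[n --> \oo] --> sq h / 2.
    by apply: cvgM => //; exact: cvg_cst.
  exact: (cvg_comp _ _ c (@continuous_expR R _)).
have sX n : sqint P (fun w => (step_integral W (s n) w - J w) - (sq (step_fun (s n)) - sq h) / 2).
  by apply: sqintB; [exact: sqintB|exact: sqint_cst].
apply: (@squeeze_cvgr _ _ _ _ (cst 0) (fun n =>
   (l2n P (fun w => step_integral W (s n) w - J w) + `|(sq (step_fun (s n)) - sq h) / 2|) *
   (l2n P (wexp (step_fun (s n)) (step_integral W (s n))) + l2n P (wexp h J)))).
- apply: nearW => n; have [sEn _] := step_wexp W_brownian (ok n).
  rewrite Rintegral_ge0//=.
  apply: (@le_trans _ _ (\int[P]_w `|((step_integral W (s n) w - J w) - (sq (step_fun (s n)) - sq h) / 2) *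
     (wexp (step_fun (s n)) (step_integral W (s n)) w + wexp h J w)|)).
    apply: Rintegral_le.
    + move=> w; apply: le_trans (expR_lip _ _) _; rewrite normrM.
      rewrite [X in _ <= _ * X]ger0_norm ?addr_ge0 ?expR_ge0//.
      by rewrite le_eqVlt; apply/orP; left; apply/eqP; congr (`|_| * _); ring.
    + apply: Rintegrable_norm; apply: (@RintegrableB _ _ _ P).
        exact: sqint_integrable sEn.
      exact: sqint_integrable sE.
    + by apply: Rintegrable_norm; apply: sqintM => //; exact: sqintD.
  apply: le_trans (cauchy_schwarz (sX n) (sqintD sEn sE)) _.
  apply: ler_pM; rewrite ?l2n_ge0//; last exact: l2n_D.
  apply: le_trans (l2n_D (sqintB (sJn n) sJ) (sqint_cst P (- ((sq (step_fun (s n)) - sq h) / 2)))) _.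
  by rewrite l2n_cst normrN.
- exact: cvg_cst.
- have c : `|(sq (step_fun (s n)) - sq h) / 2| @[n --> \oo] --> 0.
    apply/norm_cvg0P; have : sq (step_fun (s n)) - sq h @[n --> \oo] --> 0 by apply/subr_cvg0.
    by move=> /(cvg0_Mr 2^-1).
  have : (l2n P (fun w => step_integral W (s n) w - J w) + `|(sq (step_fun (s n)) - sq h) / 2|) *
    (l2n P (wexp (step_fun (s n)) (step_integral W (s n))) + l2n P (wexp h J)) @[n --> \oo] -->
    (0 + 0) * (expR (sq h / 2) + l2n P (wexp h J)).
    by apply: cvgM; apply: cvgD => //; exact: cvg_cst.
  by rewrite addr0 mul0r.
Qed.

Lemma measurable_mktuple m (g : 'I_m -> T -> R) : (forall i, measurable_fun setT (g i)) ->
  measurable_fun setT (fun w => [tuple g i w | i < m]).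
Proof.
move=> mg; apply/measurable_fun_tnthP => i.
by rewrite (_ : _ \o _ = g i)//; apply/funext => w /=; rewrite tnth_mktuple.
Qed.

Variables (m : nat) (h : R -> R) (J : T -> R) (hs : 'I_m -> R -> R) (Is : 'I_m -> T -> R).
Hypotheses (wJ : wiener_integral P W h J) (wI : forall i, wiener_integral P W (hs i) (Is i)).

(** Boundedness of [f] makes L^1 convergence of the densities sufficient, and nonnegativity is what
    the step version asks for. Truncation and splitting into parts lift both restrictions later. *)
Lemma cameron_martin_bounded (f : m.-tuple R -> R) (M : R) :
  measurable_fun setT f -> tuple_continuous f -> (forall t, 0 <= f t <= M) ->
  \int[P]_w (wexp h J w * f [tuple Is i w | i < m]) =
  \int[P]_w f [tuple Is i w + \int[leb]_y (h y * hs i y) | i < m].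
Proof.
move=> mf cf f0M.
have sE := sqint_wexp W_brownian wJ.
have [sh sJ [s [ok c1 c2]]] := wiener_seq W_brownian wJ.
have /choice[S HS] : forall i, exists s : nat -> seq (R * (R * R)),
    [/\ forall n, step_ok (s n),
       l2n leb (fun y => step_fun (s n) y - hs i y) @[n --> \oo] --> 0 &
       l2n P (fun w => step_integral W (s n) w - Is i w) @[n --> \oo] --> 0].
  by move=> i; have [] := wiener_seq W_brownian (wI i).
have okS i n : step_ok (S i n) by have [] := HS i.
have shs i : sqint leb (hs i) by have [] := wiener_seq W_brownian (wI i).
have sI i : sqint P (Is i) by have [] := wiener_seq W_brownian (wI i).
have sJn n := sqint_step_integral W_brownian (ok n).
have sIn i n := sqint_step_integral W_brownian (okS i n).
(* A single error term controls [J] and every [Is i], so that one subsequence makes all of them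
   converge almost surely. *)
pose q n w := (step_integral W (s n) w - J w) ^+ 2 +
  \sum_(i < m) (step_integral W (S i n) w - Is i w) ^+ 2.
have iq1 n : P.-integrable setT (EFin \o (fun w => (step_integral W (s n) w - J w) ^+ 2)).
  by have [] := sqintB (sJn n) sJ.
have iq2 i n : P.-integrable setT (EFin \o (fun w => (step_integral W (S i n) w - Is i w) ^+ 2)).
  by have [] := sqintB (sIn i n) (sI i).
have iq n : P.-integrable setT (EFin \o q n).
  by apply: RintegrableD => //; apply: Rintegrable_sum => i _.
have [phi phige phiae] : exists2 phi : nat -> nat, (forall n, n <= phi n)%N &
    {ae P, forall w, q (phi n) w @[n --> \oo] --> 0}.
  apply: subseq_ae_cvg0 => //.
  - by move=> n; exact: Rintegrable_measurable (iq n).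
  - by move=> n w; rewrite addr_ge0 ?sqr_ge0// sumr_ge0// => i _; exact: sqr_ge0.
  - rewrite (_ : (fun n => _) = fun n => l2n P (fun w => step_integral W (s n) w - J w) ^+ 2 +
       \sum_(i < m) l2n P (fun w => step_integral W (S i n) w - Is i w) ^+ 2); last first.
      apply/funext => n; rewrite RintegralD//; last by apply: Rintegrable_sum => i _.
      by rewrite Rintegral_sum// l2n_sqr; congr (_ + _); apply: eq_bigr => i _; rewrite l2n_sqr.
    rewrite [X in _ --> X](_ : _ = 0 + \sum_(i < m) 0); last by rewrite big1// addr0.
    apply: cvgD; first exact: cvg0_sqr.
    apply: cvg_sumr => i; apply: cvg0_sqr; by have [] := HS i.
have cS i : l2n leb (fun y => step_fun (S i n) y - hs i y) @[n --> \oo] --> 0.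
  by have [] := HS i.
pose In n w := [tuple step_integral W (S i n) w | i < m].
pose cn n i := \int[leb]_y (step_fun (s n) y * step_fun (S i n) y).
pose c i := \int[leb]_y (h y * hs i y).
have ccn i : cn n i @[n --> \oo] --> c i.
  apply: cvg_inner => //; first by move=> n; exact: sqint_step_fun.
  by move=> n; exact: sqint_step_fun.
have aeI : {ae P, forall w, forall i, step_integral W (S i (phi n)) w @[n --> \oo] --> Is i w}.
  apply: filterS phiae => w cw i; apply/subr_cvg0/cvg_sqr0.
  apply: (@squeeze_cvgr _ _ _ _ (cst 0) (fun n => q (phi n) w)) => //; last exact: cvg_cst.
  apply: nearW => n; rewrite sqr_ge0/= /q (bigD1 i)//= addrCA lerDl addr_ge0 ?sqr_ge0//.
  by apply: sumr_ge0 => j _; exact: sqr_ge0.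
have mIn n : measurable_fun setT (In n) by apply: measurable_mktuple => i; case: (sIn i n).
have mI : measurable_fun setT (fun w => [tuple Is i w | i < m]).
  by apply: measurable_mktuple => i; case: (sI i).
have step n : \int[P]_w (wexp (step_fun (s n)) (step_integral W (s n)) w * f (In n w)) =
    \int[P]_w f [tuple step_integral W (S i n) w + cn n i | i < m].
  rewrite /Rintegral; congr fine.
  have := @cameron_martin_step _ _ _ P W W_brownian m (s n) (S^~ n) (EFin \o f) (ok n)
    (okS^~ n) ((measurable_EFinP _ _).2 mf).
  by move=> /(_ (fun t => (andP (f0M t)).1)); exact.
have fM t : `|f t| <= M by have /andP[f0 fM] := f0M t; rewrite ger0_norm.
have B : \int[P]_w f [tuple step_integral W (S i (phi n)) w + cn (phi n) i | i < m] @[n --> \oo]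
    --> \int[P]_w f [tuple Is i w + c i | i < m].
  apply: (@Rdct _ _ _ P _ _ (cst M)).
  - move=> n; apply: (measurableT_comp mf); apply: measurable_mktuple => i.
    by apply: measurable_funD => //; case: (sIn i (phi n)).
  - apply: (measurableT_comp mf); apply: measurable_mktuple => i.
    by apply: measurable_funD => //; case: (sI i).
  - apply: filterS aeI => w cw; apply: cf => i; rewrite tnth_mktuple.
    under eq_fun do rewrite tnth_mktuple.
    by apply: cvgD => //; exact: cvg_subseq (ccn i).
  - by move=> n w; exact: fM.
  - exact: integrable_cst.
have iE := sqint_integrable sE.
have iEf g : measurable_fun setT g -> P.-integrable setT (EFin \o (fun w => wexp h J w * f (g w))).
  move=> mg; apply: (@integrable_le _ _ _ _ _ (fun w => M * wexp h J w)).
  - by apply: measurable_funM; [case: sE|exact: (measurableT_comp mf)].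
  - by move=> w; rewrite normrM mulrC ler_pM// ger0_norm// expR_ge0.
  - exact: RintegrableZ.
(* The change of the test variables and the change of the density are separated: here the density is
   fixed and dominated convergence applies, while [A1] uses the L^1 convergence of the densities
   against the bound [M]. *)
have A2 : \int[P]_w (wexp h J w * f (In (phi n) w)) @[n --> \oo] -->
    \int[P]_w (wexp h J w * f [tuple Is i w | i < m]).
  apply: (@Rdct _ _ _ P _ _ (fun w => M * wexp h J w)).
  - by move=> n; exact: Rintegrable_measurable (iEf _ (mIn _)).
  - exact: Rintegrable_measurable (iEf _ mI).
  - apply: filterS aeI => w cw; apply: cvgM; first exact: cvg_cst.
    apply: cf => i; rewrite tnth_mktuple; under eq_fun do rewrite tnth_mktuple.
    exact: cw.
  - by move=> n w; rewrite normrM mulrC ler_pM// ger0_norm// expR_ge0.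
  - exact: RintegrableZ.
have A1 : \int[P]_w ((wexp (step_fun (s (phi n))) (step_integral W (s (phi n))) w - wexp h J w) * f (In (phi n) w))
    @[n --> \oo] --> 0.
  apply/norm_cvg0P.
  have L1 := cvg_subseq phige (cvg_wexp_L1 wJ ok c1 c2).
  apply: (@squeeze_cvgr _ _ _ _ (cst 0) (fun n => M * \int[P]_w `|wexp (step_fun (s (phi n))) (step_integral W (s (phi n))) w - wexp h J w|)).
  - apply: nearW => n; rewrite normr_ge0/=.
    have [sEn _] := step_wexp W_brownian (ok (phi n)).
    have iD := Rintegrable_norm (RintegrableB (sqint_integrable sEn) iE).
    have iDM : P.-integrable setT (EFin \o (fun w => M * `|wexp (step_fun (s (phi n))) (step_integral W (s (phi n))) w - wexp h J w|)).
      exact: RintegrableZ.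
    have iDf : P.-integrable setT (EFin \o (fun w => (wexp (step_fun (s (phi n))) (step_integral W (s (phi n))) w - wexp h J w) * f (In (phi n) w))).
      apply: (@integrable_le _ _ _ _ _ _ _ _ iDM).
      + apply: measurable_funM; last exact: (measurableT_comp mf).
        exact: Rintegrable_measurable (RintegrableB (sqint_integrable sEn) iE).
      + by move=> w; rewrite normrM mulrC ler_wpM2r.
    apply: le_trans (ler_norm_Rint iDf) _; rewrite -RintegralZl//.
    apply: Rintegral_le => //; last exact: Rintegrable_norm.
    by move=> w; rewrite normrM mulrC ler_wpM2r.
  - exact: cvg_cst.
  - by under eq_fun do rewrite mulrC; exact: cvg0_Mr L1.
have A : \int[P]_w (wexp (step_fun (s (phi n))) (step_integral W (s (phi n))) w * f (In (phi n) w))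
    @[n --> \oo] --> \int[P]_w (wexp h J w * f [tuple Is i w | i < m]).
  apply: (eq_cvgn _ (add0r _) (cvgD A1 A2)) => n /=.
  rewrite -RintegralD//; last exact: iEf.
    by apply: eq_Rintegral => w _; ring.
  have [sEn _] := step_wexp W_brownian (ok (phi n)).
  have iD := RintegrableB (sqint_integrable sEn) iE.
  apply: (@integrable_le _ _ _ _ _ (fun w => M * `|wexp (step_fun (s (phi n))) (step_integral W (s (phi n))) w - wexp h J w|)).
  - apply: measurable_funM; last exact: (measurableT_comp mf).
    exact: Rintegrable_measurable iD.
  - by move=> w; rewrite normrM mulrC ler_wpM2r.
  - by apply: RintegrableZ; exact: Rintegrable_norm.
have A' : \int[P]_w f [tuple step_integral W (S i (phi n)) w + cn (phi n) i | i < m] @[n --> \oo]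
    --> \int[P]_w (wexp h J w * f [tuple Is i w | i < m]).
  by apply: (eq_cvgn _ erefl A) => n; exact: step.
exact: (cvg_unique _ A' B).
Qed.

End cameron_martin.

(** * Measurability by discretization *)

Section discretization.
Context (R : realType).

Lemma measurable_countable_choice d1 d2 (T1 : measurableType d1) (T2 : measurableType d2)
    (C : countType) (z : T1 -> C) (F : C -> T1 -> T2) :
  (forall c, measurable [set x | z x = c]) -> (forall c, measurable_fun setT (F c)) ->
  measurable_fun setT (fun x => F (z x) x).
Proof.
move=> mz mF _ Y mY; rewrite setTI.
rewrite (_ : _ @^-1` _ = \bigcup_(c in [set: C]) ([set x | z x = c] `&` F c @^-1` Y)).
  apply: countable_bigcupT_measurable => // c; apply: measurableI => //.
  by rewrite -[X in measurable X]setTI; exact: mF.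
apply/seteqP; split => [x Yx|x [c _ [/= <-]]] //.
by exists (z x).
Qed.

Definition mesh (k : nat) (x : R) : R := (Num.floor (x * k.+1%:R))%:~R / k.+1%:R.

Lemma mesh_dist k x : `|mesh k x - x| <= k.+1%:R^-1.
Proof.
have k0 : 0 < k.+1%:R :> R by rewrite ltr0n.
rewrite -(ler_pM2r k0) mulVf ?gt_eqF// -[X in _ * X <= _](ger0_norm (ltW k0)).
rewrite -normrM mulrBl /mesh divfK ?gt_eqF// ler_norml.
have := floor_itv (x * k.+1%:R); rewrite intrD => /andP[h1 h2].
by apply/andP; split; lra.
Qed.

Lemma cvg_mesh x : mesh k x @[k --> \oo] --> x.
Proof.
apply/subr_cvg0/norm_cvg0P.
apply: (@squeeze_cvgr _ _ _ _ (cst 0) (fun k => k.+1%:R^-1)).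
- by apply: nearW => k; rewrite normr_ge0 mesh_dist.
- exact: cvg_cst.
- exact: cvg_harmonic.
Qed.

Lemma measurable_floor_eq d (T : measurableType d) (f : T -> R) (c : int) :
  measurable_fun setT f -> measurable [set x | Num.floor (f x) = c].
Proof.
move=> mf; rewrite (_ : [set x | _] = setT `&` f @^-1` `[c%:~R, (c + 1)%:~R[%classic).
  exact: mf.
rewrite setTI; apply/seteqP; split => x /=; rewrite in_itv/=.
  by move=> <-; exact: floor_itv.
by move=> h; exact: floor_def.
Qed.

(** Rounding each coordinate to the mesh leaves countably many values, and the rounded functions
    converge to [f] by continuity. *)
Lemma measurable_tuple_continuous n (f : n.-tuple R -> R) :
  tuple_continuous f -> measurable_fun setT f.
Proof.
move=> cf.
have H1 k : measurable_fun setT (fun t => f [tuple mesh k (tnth t i) | i < n]).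
  pose z (t : n.-tuple R) : {ffun 'I_n -> int} := [ffun i => Num.floor (tnth t i * k.+1%:R)].
  pose F (c : {ffun 'I_n -> int}) (_ : n.-tuple R) := f [tuple (c i)%:~R / k.+1%:R | i < n].
  rewrite (_ : (fun t => _) = (fun t => F (z t) t)); last first.
    apply/funext => t; congr f; apply: eq_from_tnth => i.
    by rewrite !tnth_mktuple ffunE.
  apply: measurable_countable_choice => [c|c]; last exact: measurable_cst.
  rewrite (_ : [set t | _] = \bigcap_(i in [set: 'I_n]) [set t : n.-tuple R | Num.floor (tnth t i * k.+1%:R) = c i]).
    apply: fin_bigcap_measurable => // i _; apply: measurable_floor_eq.
    by apply: measurable_funM => //; exact: measurable_tnth.
  apply/seteqP; split => [t /= <- i _|t h]; first by rewrite /= ffunE.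
  by apply/ffunP => i; rewrite ffunE; exact: h.
have H2 t : setT t -> f [tuple mesh k (tnth t i) | i < n] @[k --> \oo] --> f t.
  move=> _; apply: cf => i; under eq_fun do rewrite tnth_mktuple.
  exact: cvg_mesh.
exact: (measurable_fun_cvg H1 H2).
Qed.

(** With time rounded to the mesh only countably many coordinates of the process occur, and path
    continuity gives the limit. *)
Lemma measurable_continuous_pair d (T : measurableType d) (B : R -> T -> R) :
  (forall s, measurable_fun setT (B s)) -> (forall v, continuous (B ^~ v)) ->
  measurable_fun setT (fun z : R * T => B z.1 z.2).
Proof.
move=> mB cB.
have H1 k : measurable_fun setT (fun z : R * T => B (mesh k z.1) z.2).
  apply: (@measurable_countable_choice _ _ _ _ _ (fun z : R * T => Num.floor (z.1 * k.+1%:R))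
    (fun c z => B (c%:~R / k.+1%:R) z.2)).
    by move=> c; apply: measurable_floor_eq; apply: measurable_funM => //; exact: measurable_fst.
  by move=> c; exact: (measurableT_comp (mB _) measurable_snd).
have H2 (z : R * T) : setT z -> B (mesh k z.1) z.2 @[k --> \oo] --> B z.1 z.2.
  move=> _; apply: (cvg_comp (mesh^~ z.1) (B^~ z.2)); first exact: cvg_mesh.
  exact: cB.
exact: (measurable_fun_cvg H1 H2).
Qed.

End discretization.

(** * Growth of functions of row vectors *)

Section row_vectors.
Context (R : realType) (n : nat).
Implicit Types (v : 'rV[R]_n.+1) (f : 'rV[R]_n.+1 -> R).

Lemma coord_le_norm v i : `|v ord0 i| <= `|v|.
Proof.
rewrite [leRHS]/Num.Def.normr/= mx_normrE.
exact: (le_bigmax _ (fun ij => `|v ij.1 ij.2|) (ord0, i)).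
Qed.

Lemma norm_le_coord v (e : R) : 0 <= e -> (forall i, `|v ord0 i| <= e) -> `|v| <= e.
Proof.
move=> e0 ve; rewrite /Num.Def.normr/= mx_normrE (bigmax_le _ e0)//= => -[i j] _ /=.
by rewrite ord1.
Qed.

Lemma cvg_row (U : Type) (F : set_system U) (FF : Filter F) (u : U -> 'rV[R]_n.+1) v :
  (forall i, u x ord0 i @[x --> F] --> v ord0 i) -> u x @[x --> F] --> v.
Proof.
move=> uv; apply/cvgrPdist_le => e e0.
have : \forall x \near F, forall i, `|v ord0 i - u x ord0 i| <= e.
  by apply: filter_forall => i; have /cvgrPdist_le := uv i; exact.
by apply: filterS => x h; apply: norm_le_coord => [|i]; [exact: ltW|rewrite !mxE; exact: h].
Qed.

Definition row_of_tuple (t : n.+1.-tuple R) : 'rV[R]_n.+1 := \row_i tnth t i.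

Lemma continuous_tuple_continuous f : continuous f -> tuple_continuous (f \o row_of_tuple).
Proof.
move=> cf u t ut; apply: (cvg_comp (row_of_tuple \o u) f); last exact: cf.
by apply: cvg_row => i; apply: (eq_cvgn _ _ (ut i)) => [k|]; rewrite /= mxE.
Qed.

Lemma measurable_continuous_row d (T : measurableType d) f (g : 'I_n.+1 -> T -> R) :
  continuous f -> (forall i, measurable_fun setT (g i)) ->
  measurable_fun setT (fun w => f (\row_i g i w)).
Proof.
move=> cf mg.
have -> : (fun w => f (\row_i g i w)) = (f \o row_of_tuple) \o (fun w => [tuple g i w | i < n.+1]).
  by apply/funext => w /=; congr f; apply/rowP => i; rewrite !mxE tnth_mktuple.
apply: measurableT_comp; last exact: measurable_mktuple.
exact: measurable_tuple_continuous (continuous_tuple_continuous cf).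
Qed.

Definition poly_growth f := exists (C : R) (m : nat), forall v, `|f v| <= C * (1 + `|v|) ^+ m.

(** A dominating function adapted to Gaussian vectors: it bounds [expR] of the norm, a bounded shift
    costs only a constant factor ([exp_row_shift]), and on Wiener integrals it is a finite sum of
    square-integrable exponentials. *)
Definition exp_row v := \sum_i (expR (v ord0 i) + expR (- v ord0 i)).

Lemma expR_norm_le v : expR `|v| <= exp_row v.
Proof.
have e0 i : 0 <= expR (v ord0 i) + expR (- v ord0 i) by rewrite addr_ge0 ?expR_ge0.
have [i ->] : exists i, `|v| = `|v ord0 i|.
  have [->|v0] := eqVneq v 0; first by exists ord0; rewrite mxE !normr0.
  have v0' : mx_norm v != 0 by move: v0; rewrite -normr_eq0.
  have [[i j] /= E] := mx_norm_neq0 v0'; exists j; move: E; rewrite (ord1 i); exact.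
rewrite /exp_row (bigD1 i)//= -[leLHS]addr0 lerD//; last by apply: sumr_ge0 => j _.
by case: (ler0P (v ord0 i)) => _; rewrite ?lerDl ?lerDr expR_ge0.
Qed.

Lemma exp_row_ge0 v : 0 <= exp_row v.
Proof. by apply: sumr_ge0 => i _; rewrite addr_ge0 ?expR_ge0. Qed.

(** The constant is that of [x ^+ m <= m! * expR x] at [x = 1 + |v|], which also contributes the
    factor [expR 1]. *)
Lemma poly_growth_exp f : poly_growth f -> exists2 C, 0 <= C & forall v, `|f v| <= C * exp_row v.
Proof.
move=> [C [m fC]]; exists (`|C| * (m`!%:R * expR 1)).
  by rewrite !mulr_ge0 ?expR_ge0.
move=> v; apply: (le_trans (fC v)); apply: (@le_trans _ _ (`|C| * (1 + `|v|) ^+ m)).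
  by rewrite ler_wpM2r ?ler_norm// exprn_ge0// addr_ge0.
rewrite -!mulrA ler_wpM2l//; apply: (@le_trans _ _ (m`!%:R * expR (1 + `|v|))); last first.
  by rewrite ler_wpM2l// expRD ler_wpM2l ?expR_ge0 ?expR_norm_le.
have v0 : 0 <= 1 + `|v| by rewrite addr_ge0.
case: m {fC} => [|m]; first by rewrite expr0 fact0 mul1r -[leLHS](expR0 R) ler_expR.
have := expR_ge1Dxn m v0; rewrite -ler_pdivrMl ?ltr0n ?fact_gt0// mulrC.
by apply: le_trans; rewrite lerDr.
Qed.

Lemma exp_row_shift v c : exp_row (v + c) <= expR `|c| * exp_row v.
Proof.
rewrite /exp_row mulr_sumr; apply: ler_sum => i _; rewrite mulrDr !mxE opprD !expRD.
have := coord_le_norm c i; rewrite ler_norml => /andP[h1 h2].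
rewrite [X in X + _ <= _]mulrC [X in _ + X <= _]mulrC lerD// ler_wpM2r ?expR_ge0//.
  by rewrite ler_expR.
by rewrite ler_expR; lra.
Qed.

End row_vectors.

(** * The Cameron-Martin formula for functions of polynomial growth *)

Section wiener_exp.
Context (R : realType) d (T : measurableType d) (P : probability T R).
Variable W : R -> T -> R.
Hypothesis W_brownian : brownian_line P W.
Local Notation leb := (@lebesgue_measure R).

Lemma L2_cvg_l2n d' (T' : measurableType d') (mu : {measure set T' -> \bar R})
    (fn : nat -> T' -> R) f : (forall n, sqint mu (fn n)) -> sqint mu f ->
  l2n mu (fun x => fn n x - f x) @[n --> \oo] --> 0 -> L2_cvg mu fn f.
Proof.
move=> sn sf c; rewrite /L2_cvg.
rewrite (_ : (fun n => _) = (fun n => (l2n mu (fun x => fn n x - f x))%:E)).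
  by apply: cvg_EFin => //; exact: nearW.
by apply/funext => n; rewrite -(Lnorm2_l2n (sqintB (sn n) sf)).
Qed.

Lemma l2nZ d' (T' : measurableType d') (mu : {measure set T' -> \bar R}) a (f : T' -> R) :
  sqint mu f -> l2n mu (fun x => a * f x) = `|a| * l2n mu f.
Proof.
move=> [_ fi]; rewrite /l2n; under eq_Rintegral do rewrite exprMn.
by rewrite RintegralZl// sqrtrM ?sqr_ge0// sqrtr_sqr.
Qed.

Lemma wiener_scale a h J : wiener_integral P W h J ->
  wiener_integral P W (fun y => a * h y) (fun w => a * J w).
Proof.
move=> wJ; have [sh sJ [s [ok c1 c2]]] := wiener_seq W_brownian wJ.
split; [exact/Lfun2P/sqintZ|exact/Lfun2P/sqintZ|].
exists (fun n => scale_step a (s n)); split; first by move=> n; exact: scale_step_ok.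
- apply: L2_cvg_l2n => [n||]; [exact: sqint_step_fun|exact: sqintZ|].
  apply: (eq_cvgn _ erefl (cvg0_Mr `|a| c1)) => n; rewrite mulrC -l2nZ; last first.
    by apply: sqintB => //; exact: sqint_step_fun.
  congr l2n; apply/funext => y; rewrite step_fun_scale; ring.
- apply: L2_cvg_l2n => [n||]; [|exact: sqintZ|].
    by apply: (sqint_step_integral W_brownian); exact: scale_step_ok.
  apply: (eq_cvgn _ erefl (cvg0_Mr `|a| c2)) => n; rewrite mulrC -l2nZ; last first.
    by apply: sqintB => //; exact: sqint_step_integral.
  congr l2n; apply/funext => y; rewrite step_integral_scale; ring.
Qed.

Lemma sqint_exp_wiener h J : wiener_integral P W h J -> sqint P (fun w => expR (J w)).
Proof.
move=> wJ; have := sqintZ (expR (\int[leb]_y (h y ^+ 2) / 2)) (sqint_wexp W_brownian wJ).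
by rewrite (_ : (fun w => _) = (fun w => expR (J w)))//; apply/funext => w; rewrite -expRD subrKC.
Qed.

Lemma sqint_exp_row n (hs : 'I_n.+1 -> R -> R) (Is : 'I_n.+1 -> T -> R) :
  (forall i, wiener_integral P W (hs i) (Is i)) ->
  sqint P (fun w => exp_row (\row_i Is i w)).
Proof.
move=> wI; apply: sqint_sum => i _; under eq_fun do rewrite mxE.
apply: sqintD; first exact: sqint_exp_wiener (wI i).
by have := sqint_exp_wiener (wiener_scale (-1) (wI i)); under eq_fun do rewrite mulN1r.
Qed.

Lemma measurable_wiener h J : wiener_integral P W h J -> measurable_fun setT J.
Proof. by move=> /(wiener_seq W_brownian)[_ [? _] _]. Qed.

Lemma sqint_wiener_row n (hs : 'I_n.+1 -> R -> R) (Is : 'I_n.+1 -> T -> R) f :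
  (forall i, wiener_integral P W (hs i) (Is i)) -> continuous f -> poly_growth f ->
  sqint P (fun w => f (\row_i Is i w)).
Proof.
move=> wI cf /poly_growth_exp[C C0 fC].
have [_ iC] := sqintZ C (sqint_exp_row wI).
have mf : measurable_fun setT (fun w => f (\row_i Is i w)).
  by apply: measurable_continuous_row => // i; exact: measurable_wiener (wI i).
split => //; apply: integrable_le iC; first exact: measurable_funX.
move=> w; rewrite normrX ler_pXn2r// ?nnegrE//.
by rewrite mulr_ge0// exp_row_ge0.
Qed.

Lemma ge0_mct (gk : nat -> T -> R) (g : T -> R) :
  (forall k, measurable_fun setT (gk k)) -> (forall k w, 0 <= gk k w) ->
  (forall w k l, (k <= l)%N -> gk k w <= gk l w) ->
  (forall w, gk k w @[k --> \oo] --> g w) ->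
  (\int[P]_w (gk k w)%:E)%E @[k --> \oo] --> (\int[P]_w (g w)%:E)%E.
Proof.
move=> mg g0 nd gkg.
have -> : (\int[P]_w (g w)%:E = \int[P]_w limn (fun k => (gk k w)%:E))%E.
  apply: eq_integral => w _; apply/esym/cvg_lim => //.
  by apply: cvg_EFin; [exact: nearW|exact: gkg].
apply: (cvg_monotone_convergence measurableT (g' := fun k w => (gk k w)%:E)).
- by move=> k; exact/measurable_EFinP.
- by move=> k w _; rewrite lee_fin.
- by move=> w _ k l kl; rewrite lee_fin nd.
Qed.

Section cameron_martin_row.
Variables (n : nat) (h : R -> R) (J : T -> R) (hs : 'I_n.+1 -> R -> R) (Is : 'I_n.+1 -> T -> R).
Hypotheses (wJ : wiener_integral P W h J) (wI : forall i, wiener_integral P W (hs i) (Is i)).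
Local Notation c i := (\int[leb]_y (h y * hs i y)).

(** The truncations of [f] at height [k] are bounded, continuous and increase to [f]. Monotone
    convergence on both sides takes place in the extended reals, so integrability can wait. *)
Lemma cameron_martin_ge0 (f : n.+1.-tuple R -> R) :
  tuple_continuous f -> (forall t, 0 <= f t) ->
  (\int[P]_w (wexp h J w * f [tuple Is i w | i < n.+1])%:E =
   \int[P]_w (f [tuple Is i w + c i | i < n.+1])%:E)%E.
Proof.
move=> cf f0; have mf := measurable_tuple_continuous cf.
have mI := measurable_mktuple (fun i => measurable_wiener (wI i)).
have mIc : measurable_fun setT (fun w => [tuple Is i w + c i | i < n.+1]).
  apply: measurable_mktuple => i; apply: measurable_funD => //.
  exact: measurable_wiener (wI i).
have mE : measurable_fun setT (wexp h J) := measurable_wexp h (measurable_wiener wJ).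
pose fk (k : nat) t := Num.min (f t) k%:R.
have fk0 k t : 0 <= fk k t by rewrite /fk le_min f0 ler0n.
have cfk k : tuple_continuous (fk k).
  move=> u t ut; rewrite /fk minr_absE; under eq_fun do rewrite minr_absE.
  apply: cvgM; last exact: cvg_cst.
  have cfu := cf _ _ ut.
  apply: cvgB; first by apply: cvgD => //; exact: cvg_cst.
  by apply: cvg_norm; apply: cvgB => //; exact: cvg_cst.
have mfk k := measurable_tuple_continuous (cfk k).
have fkl t : fk k t @[k --> \oo] --> f t.
  have [N Nf] : exists N : nat, f t <= N%:R.
    by exists (Num.truncn (f t)).+1; rewrite ltW// truncnS_gt.
  apply: cvg_near_cst; exists N => // k /= Nk; rewrite /fk min_l//.
  by rewrite (le_trans Nf)// ler_nat.
have ndfk t k l : (k <= l)%N -> fk k t <= fk l t.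
  by move=> kl; rewrite /fk le_min ge_min lexx/= ge_min ler_nat kl orbT.
have E k : (\int[P]_w (wexp h J w * fk k [tuple Is i w | i < n.+1])%:E =
   \int[P]_w (fk k [tuple Is i w + c i | i < n.+1])%:E)%E.
  have fkM t : 0 <= fk k t <= k%:R by rewrite fk0/= /fk ge_min lexx orbT.
  have fkN t : `|fk k t| <= k%:R by rewrite ger0_norm//; have /andP[] := fkM t.
  have sE := sqint_wexp W_brownian wJ.
  rewrite -!EFin_Rintegral.
  - by congr EFin; exact: (cameron_martin_bounded W_brownian wJ wI (mfk k) (cfk k) fkM).
  - apply: (@integrable_le _ _ _ _ _ (cst k%:R)) => //; last exact: integrable_cst.
    exact: (measurableT_comp (mfk k)).
  - apply: (@integrable_le _ _ _ _ _ (fun w => k%:R * wexp h J w)).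
    + by apply: measurable_funM => //; exact: (measurableT_comp (mfk k)).
    + by move=> w; rewrite normrM mulrC ler_pM// ger0_norm// expR_ge0.
    + by apply: RintegrableZ; exact: sqint_integrable.
have L1 := ge0_mct (gk := fun k w => wexp h J w * fk k [tuple Is i w | i < n.+1])
  (g := fun w => wexp h J w * f [tuple Is i w | i < n.+1]).
have L2 := ge0_mct (gk := fun k w => fk k [tuple Is i w + c i | i < n.+1])
  (g := fun w => f [tuple Is i w + c i | i < n.+1]).
have {}L1 : (\int[P]_w (wexp h J w * fk k [tuple Is i w | i < n.+1])%:E)%E @[k --> \oo] -->
    (\int[P]_w (wexp h J w * f [tuple Is i w | i < n.+1])%:E)%E.
  apply: L1.
  - by move=> k; apply: measurable_funM => //; exact: (measurableT_comp (mfk k)).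
  - by move=> k w; rewrite mulr_ge0// expR_ge0.
  - by move=> w k l kl; rewrite ler_wpM2l ?expR_ge0// ndfk.
  - by move=> w; apply: cvgM => //; exact: cvg_cst.
have {}L2 : (\int[P]_w (fk k [tuple Is i w + c i | i < n.+1])%:E)%E @[k --> \oo] -->
    (\int[P]_w (f [tuple Is i w + c i | i < n.+1])%:E)%E.
  by apply: L2 => // [k|w k l kl]; [exact: (measurableT_comp (mfk k))|exact: ndfk].
by move: L1; rewrite (funext E) => L1; exact: (cvg_unique _ L1 L2).
Qed.

(** Domination by [exp_row] makes both sides integrable, after which the positive and negative parts
    of [f] can be treated separately. *)
Lemma cameron_martin_row (f : 'rV[R]_n.+1 -> R) : continuous f -> poly_growth f ->
  [/\ P.-integrable setT (EFin \o (fun w => wexp h J w * f (\row_i Is i w))),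
     P.-integrable setT (EFin \o (fun w => f (\row_i (Is i w + c i)))) &
     \int[P]_w (wexp h J w * f (\row_i Is i w)) = \int[P]_w f (\row_i (Is i w + c i))].
Proof.
move=> cf pf; have [C C0 fC] := poly_growth_exp pf.
have mI i := measurable_wiener (wI i).
have i1 : P.-integrable setT (EFin \o (fun w => wexp h J w * f (\row_i Is i w))).
  by apply: sqintM; [exact: (sqint_wexp W_brownian wJ)|exact: (sqint_wiener_row wI cf pf)].
have i2 : P.-integrable setT (EFin \o (fun w => f (\row_i (Is i w + c i)))).
  have iC := RintegrableZ (C * expR `|\row_i c i|) (sqint_integrable (sqint_exp_row wI)).
  apply: integrable_le iC.
    by apply: measurable_continuous_row => // i; apply: measurable_funD => //; exact: mI.
  move=> w; apply: (le_trans (fC _)); rewrite -mulrA ler_wpM2l//.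
  by apply: le_trans (exp_row_shift _ _); rewrite le_eqVlt; apply/orP; left; apply/eqP;
     congr exp_row; apply/rowP => i; rewrite !mxE.
split => //.
have H g : tuple_continuous g -> (forall t, 0 <= g t) -> \int[P]_w (wexp h J w * g [tuple Is i w | i < n.+1]) =
   \int[P]_w g [tuple Is i w + c i | i < n.+1].
  by move=> cg g0; rewrite /Rintegral cameron_martin_ge0.
have cft := continuous_tuple_continuous cf.
(* The positive and negative parts, written with the absolute value so that their continuity is
   immediate. *)
pose g1 (t : n.+1.-tuple R) := (`|f (row_of_tuple t)| + f (row_of_tuple t)) / 2.
pose g2 (t : n.+1.-tuple R) := (`|f (row_of_tuple t)| - f (row_of_tuple t)) / 2.
have cg1 : tuple_continuous g1.
  move=> u t ut; apply: cvgM; last exact: cvg_cst.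
  by apply: cvgD; [apply: cvg_norm|]; exact: cft.
have cg2 : tuple_continuous g2.
  move=> u t ut; apply: cvgM; last exact: cvg_cst.
  by apply: cvgB; [apply: cvg_norm|]; exact: cft.
have g10 t : 0 <= g1 t by rewrite divr_ge0// -lerBlDr sub0r -normrN ler_norm.
have g20 t : 0 <= g2 t by rewrite divr_ge0// subr_ge0 ler_norm.
have rowE (g : 'I_n.+1 -> R) : row_of_tuple [tuple g i | i < n.+1] = \row_i g i.
  by apply/rowP => i; rewrite !mxE tnth_mktuple.
have D1 w : wexp h J w * f (\row_i Is i w) =
    wexp h J w * g1 [tuple Is i w | i < n.+1] - wexp h J w * g2 [tuple Is i w | i < n.+1].
  by rewrite /g1 /g2 rowE; field.
have D2 w : f (\row_i (Is i w + c i)) =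
    g1 [tuple Is i w + c i | i < n.+1] - g2 [tuple Is i w + c i | i < n.+1].
  by rewrite /g1 /g2 rowE; field.
have me w : 0 <= wexp h J w := expR_ge0 _.
have mE : measurable_fun setT (wexp h J) := measurable_wexp h (measurable_wiener wJ).
have mIt : measurable_fun setT (fun w => [tuple Is i w | i < n.+1]) by exact: measurable_mktuple.
have mIc : measurable_fun setT (fun w => [tuple Is i w + c i | i < n.+1]).
  by apply: measurable_mktuple => i; apply: measurable_funD => //; exact: mI.
have b1 g : tuple_continuous g -> (forall t, `|g t| <= `|f (row_of_tuple t)|) ->
    P.-integrable setT (EFin \o (fun w => wexp h J w * g [tuple Is i w | i < n.+1])).
  move=> cg gf; apply: integrable_le (Rintegrable_norm i1).
    apply: measurable_funM => //.
    exact: (measurableT_comp (measurable_tuple_continuous cg)).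
  by move=> w; rewrite !normrM ler_wpM2l// -rowE.
have b2 g : tuple_continuous g -> (forall t, `|g t| <= `|f (row_of_tuple t)|) ->
    P.-integrable setT (EFin \o (fun w => g [tuple Is i w + c i | i < n.+1])).
  move=> cg gf; apply: integrable_le (Rintegrable_norm i2).
    exact: (measurableT_comp (measurable_tuple_continuous cg)).
  by move=> w; rewrite -rowE.
have gf1 t : `|g1 t| <= `|f (row_of_tuple t)|.
  by rewrite ger0_norm// /g1; have := ler_norm (f (row_of_tuple t)); lra.
have gf2 t : `|g2 t| <= `|f (row_of_tuple t)|.
  by rewrite ger0_norm// /g2; have := ler_norm (- f (row_of_tuple t)); rewrite normrN; lra.
under eq_Rintegral do rewrite D1; under [RHS]eq_Rintegral do rewrite D2.
rewrite RintegralB//; [|exact: b1|exact: b1].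
by rewrite (RintegralB measurableT (b2 _ cg1 gf1) (b2 _ cg2 gf2)) !H.
Qed.
End cameron_martin_row.

End wiener_exp.

(** * Hermite functions *)

Section hermite.
Context (R : realType).
Local Notation leb := (@lebesgue_measure R).
Implicit Types (p q : {poly R}) (x : R).

(** The physicists' Hermite polynomials: the recursion is what differentiating a polynomial times
    the Gaussian produces, once the sign [(-1) ^+ n] is taken out. *)
Fixpoint hermite_poly (n : nat) : {poly R} :=
  if n is m.+1 then 'X * hermite_poly m *+ 2 - (hermite_poly m)^`() else 1.

(** Products of two Hermite functions have this form, hence the full Gaussian weight instead of its
    square root. *)
Definition poly_gauss p x := p.[x] * expR (- x ^+ 2).

Lemma is_derive_poly_gauss p x :
  is_derive x 1 (poly_gauss p) (poly_gauss (p^`() - 'X * p *+ 2) x).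
Proof.
rewrite /poly_gauss; apply: is_derive_eq.
rewrite !hornerE /GRing.scale/=. ring.
Qed.

Lemma derivn_gauss n :
  derive1n n (fun y : R => expR (- y ^+ 2)) = fun x => (-1) ^+ n * poly_gauss (hermite_poly n) x.
Proof.
elim: n => [|n ih].
  by apply/funext => x; rewrite derive1n0 /poly_gauss /= expr0 -polyC1 hornerC !mul1r.
rewrite derive1nS ih; apply/funext => x; rewrite derive1E.
have h := is_derive_poly_gauss (hermite_poly n) x.
have h2 : is_derive x 1 (fun x => (-1) ^+ n * poly_gauss (hermite_poly n) x)
   ((-1) ^+ n * poly_gauss ((hermite_poly n)^`() - 'X * hermite_poly n *+ 2) x).
  exact: is_derive_eq.
have [_ ->] := h2; rewrite exprS /poly_gauss /=.
by rewrite !(hornerD, hornerN, hornerMn, hornerM, hornerX); ring.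
Qed.

Lemma poly_exp_bound p : exists C, exists2 k : nat, 0 <= C &
  forall x, `|p.[x]| <= C * expR (k%:R * `|x|).
Proof.
elim/poly_ind: p => [|p c [C [k C0 pC]]].
  by exists 0, 0%N => // x; rewrite horner0 normr0 mul0r.
exists (C + `|c|), k.+1; first by rewrite addr_ge0.
move=> x; rewrite !hornerE (le_trans (ler_normD _ _))// mulrDl lerD//.
  rewrite normrM -natr1 mulrDl mul1r expRD mulrA ler_pM//.
  by rewrite (le_trans _ (expR_ge1Dx _))// lerDr.
rewrite ler_peMr// -[leLHS](expR0 R) ler_expR mulr_ge0//.
Qed.

(** The inequality [k * |x| - x ^+ 2 / 2 <= k ^+ 2 / 2] absorbs the exponential bound on the
    polynomial into the Gaussian. *)
Lemma poly_half_gauss_bound p : exists2 C, 0 <= C &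
  forall x, `|p.[x] * expR (- (x ^+ 2 / 2))| <= C.
Proof.
have [C [k C0 pC]] := poly_exp_bound p; exists (C * expR (k%:R ^+ 2 / 2)).
  by rewrite mulr_ge0 ?expR_ge0.
move=> x; rewrite normrM [X in _ * X]ger0_norm ?expR_ge0//.
apply: (@le_trans _ _ (C * expR (k%:R * `|x|) * expR (- (x ^+ 2 / 2)))).
  by rewrite ler_wpM2r ?expR_ge0.
rewrite -mulrA -expRD ler_wpM2l// ler_expR -(real_normK (num_real x)).
by have := sqr_ge0 (k%:R - `|x|); lra.
Qed.

Lemma integrable_half_gauss : leb.-integrable setT (EFin \o (fun x : R => expR (- (x ^+ 2 / 2)))).
Proof.
have := integrable_normal_pdf (0 : R) 1 => /(RintegrableZ (normal_peak 1)^-1).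
rewrite normal_pdfE ?oner_neq0//.
rewrite (_ : (fun x => _) = (fun x : R => expR (- (x ^+ 2 / 2))))//; apply/funext => x.
rewrite mulrA mulVf ?mul1r ?gt_eqF ?normal_peak_gt0// ?oner_neq0//.
by rewrite /normal_fun subr0 expr1n mulNr.
Qed.

Lemma continuous_poly_gauss p : continuous (poly_gauss p).
Proof.
move=> x; apply/differentiable_continuous/derivable1_diffP.
by have [] := is_derive_poly_gauss p x.
Qed.

Lemma measurable_poly_gauss p : measurable_fun setT (poly_gauss p).
Proof. by apply: continuous_measurable_fun; exact: continuous_poly_gauss. Qed.

Lemma poly_gauss_bound p : exists2 C, 0 <= C &
  forall x, `|poly_gauss p x| <= C * expR (- (x ^+ 2 / 2)).
Proof.
have [C C0 pC] := poly_half_gauss_bound p; exists C => // x.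
rewrite /poly_gauss (_ : - x ^+ 2 = - (x ^+ 2 / 2) + - (x ^+ 2 / 2)); last by field.
by rewrite expRD mulrA normrM [X in _ * X <= _]ger0_norm ?expR_ge0// ler_wpM2r ?expR_ge0.
Qed.

Lemma integrable_poly_gauss p : leb.-integrable setT (EFin \o poly_gauss p).
Proof.
have [C C0 pC] := poly_gauss_bound p.
apply: (@integrable_le _ _ _ leb _ (fun x : R => C * expR (- (x ^+ 2 / 2)))) => //.
  exact: measurable_poly_gauss.
by apply: RintegrableZ; exact: integrable_half_gauss.
Qed.

(** The integrand is the derivative of [poly_gauss p], which vanishes at both infinities; the
    integral over the line is the limit of those over symmetric intervals. *)
Lemma Rintegral_poly_gauss_deriv p : \int[leb]_x poly_gauss (p^`() - 'X * p *+ 2) x = 0.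
Proof.
set q := p^`() - 'X * p *+ 2.
have E (n : nat) : \int[leb]_(x in `[- n.+1%:R, n.+1%:R]) poly_gauss q x =
    poly_gauss p n.+1%:R - poly_gauss p (- n.+1%:R).
  have n0 : 0 < n.+1%:R :> R by rewrite ltr0n.
  rewrite /Rintegral (@continuous_FTC2 _ _ (poly_gauss p))//; first by lra.
  - exact/continuous_subspaceT/continuous_poly_gauss.
  - split.
    + by move=> x _; have [] := is_derive_poly_gauss p x.
    + exact/cvg_at_right_filter/continuous_poly_gauss.
    + exact/cvg_at_left_filter/continuous_poly_gauss.
  - by move=> x _; rewrite derive1E; have [_ ->] := is_derive_poly_gauss p x.
have L1 : \int[leb]_(x in `[- n.+1%:R, n.+1%:R]) poly_gauss q x @[n --> \oo] --> \int[leb]_x poly_gauss q x.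
  under eq_fun do rewrite Rintegral_mkcond.
  have [C C0 qC] := poly_gauss_bound q.
  apply: (@Rdct _ _ _ leb _ _ (fun x => C * expR (- (x ^+ 2 / 2)))).
  - move=> n; apply/(measurable_restrictT _ (measurable_itv _)).
    by apply: measurable_funTS; exact: measurable_poly_gauss.
  - exact: measurable_poly_gauss.
  - apply: nearW => x; apply: cvg_near_cst; exists (Num.truncn `|x|) => // n /= xn.
    rewrite patchE mem_set//= in_itv/= -ler_norml.
    have := truncnS_gt `|x| => /ltW/le_trans; apply; by rewrite ler_nat.
  - move=> n x; rewrite patchE; case: ifP => // _.
    by rewrite normr0 mulr_ge0 ?expR_ge0.
  - by apply: RintegrableZ; exact: integrable_half_gauss.
have L2 : poly_gauss p n.+1%:R - poly_gauss p (- n.+1%:R) @[n --> \oo] --> 0.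
  have [C C0 pC] := poly_gauss_bound p.
  (* The bound [x - 1 <= x ^+ 2 / 2] trades the Gaussian for an exponential, hence the factor
     [expR 1]. *)
  have b x : 0 <= x -> forall y, `|y| = x -> `|poly_gauss p y| <= C * expR 1 * expR (- x).
    move=> x0 y yx; apply: (le_trans (pC y)); rewrite -mulrA ler_wpM2l// -expRD ler_expR.
    by rewrite -(real_normK (num_real y)) yx; have := sqr_ge0 (x - 1); lra.
  apply/norm_cvg0P.
  have h : expR (- n.+1%:R) * (C * expR 1 *+ 2) @[n --> \oo] --> (0 : R).
    apply: cvg0_Mr; have := @cvgn_expR R; rewrite -(cvg_shiftn 1).
    by under eq_fun do rewrite addn1.
  apply: (squeeze_cvgr _ (cvg_cst 0) h); apply: nearW => n; rewrite normr_ge0/=.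
  rewrite (le_trans (ler_normB _ _))// mulrC mulrnAl mulr2n lerD//.
    by apply: b => //; rewrite ger0_norm.
  by apply: b => //; rewrite normrN ger0_norm.
have L3 : \int[leb]_(x in `[- n.+1%:R, n.+1%:R]) poly_gauss q x @[n --> \oo] --> 0.
  by apply: (eq_cvgn _ erefl L2) => n; rewrite E.
exact: (cvg_unique _ L1 L3).
Qed.

Lemma poly_gaussD p q x : poly_gauss (p + q) x = poly_gauss p x + poly_gauss q x.
Proof. by rewrite /poly_gauss hornerD mulrDl. Qed.

Lemma Rintegral_poly_gaussD p q :
  \int[leb]_x poly_gauss (p + q) x = \int[leb]_x poly_gauss p x + \int[leb]_x poly_gauss q x.
Proof.
under eq_Rintegral do rewrite poly_gaussD.
by rewrite RintegralD//; exact: integrable_poly_gauss.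
Qed.

(** The two integrands differ by the derivative of [poly_gauss (hermite_poly n * q)], whose integral
    is 0. *)
Lemma Rintegral_hermite_ibp n q :
  \int[leb]_x poly_gauss (hermite_poly n.+1 * q) x = \int[leb]_x poly_gauss (hermite_poly n * q^`()) x.
Proof.
rewrite (_ : hermite_poly n * q^`() = hermite_poly n.+1 * q +
  ((hermite_poly n * q)^`() - 'X * (hermite_poly n * q) *+ 2)).
  by rewrite Rintegral_poly_gaussD Rintegral_poly_gauss_deriv addr0.
by rewrite derivM /=; ring.
Qed.

Lemma deriv_hermite n : (hermite_poly n.+1)^`() = hermite_poly n *+ 2 *+ n.+1.
Proof.
elim: n => [|n ih].
  by rewrite /= !mulr1 derivB -polyC1 derivC deriv0 subr0 derivMn derivX mulr1n.
rewrite [hermite_poly n.+2]/= derivB derivMn derivM derivX mul1r.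
rewrite -/(hermite_poly n.+1) ih !derivMn.
have E : 'X * hermite_poly n *+ 2 - (hermite_poly n)^`() = hermite_poly n.+1 by [].
rewrite -E.
ring.
Qed.

(** Integration by parts lowers the index of one factor and [deriv_hermite] that of the other, at
    the price of [2 * m.+1]. The descent ends at the Gaussian integral or at the derivative of a
    constant. *)
Lemma hermite_orthogonal n m : \int[leb]_x poly_gauss (hermite_poly n * hermite_poly m) x =
  (n == m)%:R * (Num.sqrt pi * 2 ^+ n * n`!%:R).
Proof.
have H0 k : \int[leb]_x poly_gauss (hermite_poly k.+1 * hermite_poly 0) x = 0.
  rewrite Rintegral_hermite_ibp/= -polyC1 derivC mulr0 /poly_gauss.
  under eq_Rintegral do rewrite horner0 mul0r.
  by rewrite /Rintegral integral0.
elim: n m => [|n ih] [|m].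
- rewrite eqxx mul1r fact0 expr0 !mulr1 /poly_gauss.
  rewrite /= ?mulr1 -polyC1; under eq_Rintegral do rewrite hornerC mul1r.
  rewrite mul1r; exact: (congr1 fine (@integralT_gauss R)).
- by rewrite mulrC H0 mul0r.
- by rewrite H0 mul0r.
- rewrite Rintegral_hermite_ibp deriv_hermite.
  transitivity (\int[leb]_x ((2 * m.+1%:R) * poly_gauss (hermite_poly n * hermite_poly m) x)).
    by apply: eq_Rintegral => x _; rewrite /poly_gauss !(hornerM, hornerMn); ring.
  rewrite RintegralZl//; last exact: integrable_poly_gauss.
  rewrite ih eqSS; have [->|] := eqVneq n m; last by rewrite !mul0r mulr0.
  by rewrite !mul1r exprS factS natrM; ring.
Qed.

Definition hermite_norm n : R := (Num.sqrt (Num.sqrt pi * 2 ^+ n * n`!%:R))^-1.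

(** The sign in the definition cancels that of Rodrigues' formula. The index is [n.+1] because
    Hermite functions are numbered from 1 and polynomials from 0. *)
Lemma hermite_funE n x :
  hermite_fun n.+1 x = hermite_norm n * ((hermite_poly n).[x] * expR (- (x ^+ 2 / 2))).
Proof.
rewrite /hermite_fun /= derivn_gauss /poly_gauss /hermite_norm.
rewrite (_ : expR (- x ^+ 2) = expR (- (x ^+ 2 / 2)) * expR (- (x ^+ 2 / 2))); last first.
  by rewrite -expRD; congr expR; field.
have h1 : expR (x ^+ 2 / 2) * expR (- (x ^+ 2 / 2)) = 1 by rewrite expRxMexpNx_1.
have h2 : (-1) ^+ n * (-1) ^+ n = 1 :> R by rewrite -exprMn mulrNN mulr1 expr1n.
transitivity (((-1) ^+ n * (-1) ^+ n) * (expR (x ^+ 2 / 2) * expR (- (x ^+ 2 / 2)))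
  * (Num.sqrt (Num.sqrt pi * 2 ^+ n * n`!%:R))^-1 * ((hermite_poly n).[x] * expR (- (x ^+ 2 / 2)))).
  by ring.
by rewrite h1 h2 !mul1r.
Qed.

Lemma hermite_fun_bounded n : exists2 C, 0 <= C & forall x, `|hermite_fun n.+1 x| <= C.
Proof.
have [C C0 pC] := poly_half_gauss_bound (hermite_poly n).
exists (`|hermite_norm n| * C); first by rewrite mulr_ge0.
by move=> x; rewrite hermite_funE normrM ler_wpM2l.
Qed.

Lemma continuous_hermite_fun n : continuous (@hermite_fun R n.+1).
Proof.
rewrite (_ : @hermite_fun R n.+1 = fun x => hermite_norm n * ((hermite_poly n).[x] * expR (- (x ^+ 2 / 2)))).
  move=> x; apply: cvgM; first exact: cvg_cst.
  apply: cvgM; first exact: continuous_horner.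
  have c : - (y ^+ 2 / 2) @[y --> x] --> - (x ^+ 2 / 2).
    apply: cvgN; apply: cvgM; last exact: cvg_cst.
    exact: exprn_continuous.
  exact: (cvg_comp _ _ c (@continuous_expR R _)).
by apply/funext => x; exact: hermite_funE.
Qed.

Lemma hermite_funM n m x : hermite_fun n.+1 x * hermite_fun m.+1 x =
  hermite_norm n * hermite_norm m * poly_gauss (hermite_poly n * hermite_poly m) x.
Proof.
rewrite !hermite_funE /poly_gauss hornerM.
rewrite (_ : expR (- x ^+ 2) = expR (- (x ^+ 2 / 2)) * expR (- (x ^+ 2 / 2))); last first.
  by rewrite -expRD; congr expR; field.
by ring.
Qed.

Lemma sqint_hermite_fun n : sqint leb (@hermite_fun R n.+1).
Proof.
split; first by apply: continuous_measurable_fun; exact: continuous_hermite_fun.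
rewrite (_ : (fun x => _) = (fun x => hermite_norm n * hermite_norm n * poly_gauss (hermite_poly n * hermite_poly n) x)).
  by apply: RintegrableZ; exact: integrable_poly_gauss.
by apply/funext => x; rewrite expr2 hermite_funM.
Qed.

Lemma hermite_orthonormal n m :
  \int[leb]_x (hermite_fun n.+1 x * hermite_fun m.+1 x) = (n == m)%:R.
Proof.
under eq_Rintegral do rewrite hermite_funM.
rewrite RintegralZl//; last exact: integrable_poly_gauss.
rewrite hermite_orthogonal; have [<-|] := eqVneq n m; last by rewrite mul0r mulr0.
have h0 : 0 < Num.sqrt pi * 2 ^+ n * n`!%:R :> R.
  by rewrite !mulr_gt0 ?sqrtr_gt0 ?pi_gt0 ?exprn_gt0 ?ltr0n ?fact_gt0.
rewrite mul1r /hermite_norm -invfM -expr2 sqr_sqrtr ?ltW// mulVf// gt_eqF//.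
Qed.

End hermite.

(** * Means of smooth functionals along a path *)

Lemma continuous_sum (R : realType) (U : topologicalType) (I : Type) (r : seq I)
    (g : I -> U -> R) : (forall i, continuous (g i)) ->
  continuous (fun x => \sum_(i <- r) g i x).
Proof.
move=> cg; elim: r => [|i r ih].
  rewrite (_ : (fun x => _) = cst 0); first exact: cst_continuous.
  by apply/funext => x; rewrite big_nil.
rewrite (_ : (fun x => _) = (fun x => g i x + \sum_(j <- r) g j x)).
  by move=> x; apply: cvgD; [exact: cg|exact: ih].
by apply/funext => x; rewrite big_cons.
Qed.

(** * Primitives of bounded continuous functions *)

Section primitive.
Context (R : realType).
Local Notation leb := (@lebesgue_measure R).
Variables (th : R -> R) (C : R).
Hypotheses (cth : continuous th) (thC : forall s, `|th s| <= C).

(** For [s < 0] the interval is empty and the value is 0: the function is Lipschitz on the whole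
    line but may have a kink at 0, hence the restriction [0 < s] in [is_derive_primitive]. *)
Definition primitive (s : R) : R := \int[leb]_(r in `[0, s]) th r.

Lemma bound_ge0 : 0 <= C.
Proof. exact: le_trans (normr_ge0 _) (thC 0). Qed.

Lemma integrable_bounded_itv (a b : R) (g : R -> R) (M : R) : measurable_fun setT g ->
  (forall s, `|g s| <= M) -> leb.-integrable `[a, b] (EFin \o g).
Proof.
move=> mg gM.
have gM' : [bounded g x | x in `[a, b]%classic].
  exists M; split; first exact: num_real.
  by move=> M' MM' x _ /=; rewrite (le_trans (gM x))// ltW.
apply: measurable_bounded_integrable => //.
  rewrite /= lebesgue_measure_itv/=; case: ifP => _; last exact: ltry.
  by rewrite -EFinB ltry.
exact: measurable_funTS.
Qed.

Lemma measurable_th : measurable_fun setT th.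
Proof. by apply: continuous_measurable_fun. Qed.

Lemma integrable_th (a b : R) : leb.-integrable `[a, b] (EFin \o th).
Proof. exact: integrable_bounded_itv measurable_th thC. Qed.

Lemma primitive_neg s : s < 0 -> primitive s = 0.
Proof. by move=> s0; rewrite /primitive set_itv_ge ?Rintegral_set0// bnd_simp -ltNge. Qed.

Lemma primitive0 : primitive 0 = 0.
Proof. by rewrite /primitive set_itv1 Rintegral_set1. Qed.

Lemma primitive_lip_ge0 s s' : 0 <= s -> s <= s' -> `|primitive s' - primitive s| <= C * (s' - s).
Proof.
move=> s0 ss'; rewrite /primitive Rintegral_itvB ?bnd_simp//; last exact: integrable_th.
have sub : `]s, s']%classic `<=` `[0, s']%classic.
  by move=> x /=; rewrite !in_itv/= => /andP[/ltW/(le_trans s0) -> ->].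
have ith : leb.-integrable `]s, s'] (EFin \o th).
  by apply: integrableS (integrable_th 0 s') => //; exact: measurable_itv.
apply: le_trans (le_normr_Rintegral _ ith) _ => //.
have fin : (leb `]s, s']%classic < +oo)%E.
  rewrite lebesgue_measure_itv/=; case: ifP => _; last exact: ltry.
  by rewrite -EFinB ltry.
apply: (@le_trans _ _ (\int[leb]_(x in `]s, s']) C)).
  apply: le_Rintegral => //; first exact: integrable_norm.
  have Cc : forall x : R, `|cst C x| <= C by move=> x; rewrite ger0_norm// bound_ge0.
  have := @integrable_bounded_itv 0 s' (cst C) C (measurable_cst _) Cc.
  by apply: integrableS => //; exact: measurable_itv.
rewrite Rintegral_cst//= lebesgue_measure_itv/= lte_fin.
have [lt|] := ltP s s'; first by rewrite -EFinB.
by move=> _; rewrite /= mulr0 mulr_ge0 ?bound_ge0// subr_ge0.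
Qed.

Lemma primitive_lip s s' : `|primitive s' - primitive s| <= C * `|s' - s|.
Proof.
wlog ss' : s s' / s <= s'.
  move=> H; have [/H//|/ltW/H] := leP s s'.
  by rewrite distrC (distrC s).
have C0 := bound_ge0.
rewrite [`|s' - s|]ger0_norm ?subr_ge0//.
have [s0|s0] := leP 0 s; first exact: primitive_lip_ge0.
rewrite (primitive_neg s0); have [s'0|s'0] := leP 0 s'; last first.
  by rewrite primitive_neg// subrr normr0 mulr_ge0// subr_ge0.
have := primitive_lip_ge0 (lexx 0) s'0; rewrite primitive0 => /le_trans; apply.
by rewrite ler_wpM2l//; lra.
Qed.

Lemma continuous_primitive : continuous primitive.
Proof.
have C0 := bound_ge0.
move=> s; apply/cvgrPdist_le => e e0.
have d0 : 0 < e / (C + 1) by rewrite divr_gt0// ltr_wpDl.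
have hd : \forall s' \near s, `|s - s'| <= e / (C + 1).
  have c : y @[y --> s] --> s by exact: cvg_id.
  by move/cvgrPdist_le : c; exact.
apply: filterS hd => s' hs; apply: le_trans (primitive_lip _ _) _.
apply: (@le_trans _ _ ((C + 1) * (e / (C + 1)))); last first.
  by rewrite mulrC divfK// gt_eqF// ltr_wpDl.
by apply: ler_pM => //; rewrite lerDl.
Qed.

Lemma is_derive_primitive (s : R) : 0 < s -> is_derive s 1 primitive (th s).
Proof.
move=> s0; have s1 : s < s + 1 by rewrite ltrDl.
have cs : {for s, continuous th} by exact: cth.
have [d e] := continuous_FTC1_closed s1 (integrable_th 0 (s + 1)) s0 cs.
by apply: DeriveDef => //; rewrite -derive1E.
Qed.

Lemma primitive_bound (s : R) : 0 <= s -> `|primitive s| <= C * s.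
Proof.
move=> s0; have := primitive_lip 0 s; rewrite primitive0 !subr0.
by rewrite [`|s|]ger0_norm.
Qed.

End primitive.

(** * Effect of the occupation shift on a smooth functional *)

Section path_derivative.
Context (R : realType) d (T : measurableType d) (P : probability T R) (n K : nat).
Local Notation leb := (@lebesgue_measure R).
Variables (f : 'rV[R]_n.+1 -> R) (Is : 'I_n.+1 -> T -> R) (gam : 'I_K -> 'I_n.+1 -> R).
Local Notation "'df' i" := (fun v => 'D_(delta_mx ord0 i) f v) (at level 10).
Hypotheses (f_diff : forall v, differentiable f v) (f_growth : poly_growth f).
Hypotheses (df_cont : forall i, continuous (df i)) (df_growth : forall i, poly_growth (df i)).
Hypotheses (mI : forall i, measurable_fun setT (Is i))
  (iI : P.-integrable setT (EFin \o (fun w => exp_row (\row_i Is i w)))).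

(** With [gam j i = <e_j, h_i>], this is the Cameron-Martin shift of the vector of Wiener integrals
    of the [h_i] in the direction [\sum_j a_j e_j]. *)
Definition row_shift (a : 'I_K -> R) : 'rV[R]_n.+1 := \row_i \sum_j a j * gam j i.

Definition smooth_mean (a : 'I_K -> R) : R := \int[P]_w f ((\row_i Is i w) + row_shift a).

(** The coefficient [<e_j, DF>] of the Malliavin derivative, as a function of the Gaussian
    vector. *)
Definition dir_deriv (j : 'I_K) (v : 'rV[R]_n.+1) : R := \sum_i df i v * gam j i.

Definition deriv_mean (j : 'I_K) (a : 'I_K -> R) : R :=
  \int[P]_w dir_deriv j ((\row_i Is i w) + row_shift a).

Lemma continuous_dir_deriv j : continuous (dir_deriv j).
Proof.
apply: continuous_sum => i v.
have FF : Filter (nbhs v) by exact: nbhs_filter.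
have c := @cvgM R _ (nbhs v) FF (df i) (cst (gam j i)) _ _ (@df_cont i v) (cvg_cst _).
exact: c.
Qed.

Lemma exp_growth_sum (I : Type) (r : seq I) (g : I -> 'rV[R]_n.+1 -> R) :
  (forall i, exists2 C, 0 <= C & forall v, `|g i v| <= C * exp_row v) ->
  exists2 C, 0 <= C & forall v, `|\sum_(i <- r) g i v| <= C * exp_row v.
Proof.
move=> gC; elim: r => [|i r [C C0 ih]].
  by exists 0 => // v; rewrite big_nil normr0 mul0r.
have [C' C'0 gC'] := gC i; exists (C' + C); first by rewrite addr_ge0.
by move=> v; rewrite big_cons mulrDl (le_trans (ler_normD _ _))// lerD.
Qed.

Lemma dir_deriv_growth j : exists2 C, 0 <= C & forall v, `|dir_deriv j v| <= C * exp_row v.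
Proof.
apply: exp_growth_sum => i; have [C C0 fC] := poly_growth_exp (df_growth i).
exists (C * `|gam j i|); first by rewrite mulr_ge0.
by move=> v; rewrite normrM mulrAC ler_wpM2r.
Qed.

Lemma row_shiftP a w : (\row_i Is i w) + row_shift a = \row_i (Is i w + \sum_j a j * gam j i).
Proof. by apply/rowP => i; rewrite !mxE. Qed.

Lemma measurable_row_comp (g : 'rV[R]_n.+1 -> R) (a : 'I_K -> R) : continuous g ->
  measurable_fun setT (fun w => g ((\row_i Is i w) + row_shift a)).
Proof.
move=> cg; under eq_fun do rewrite row_shiftP.
by apply: measurable_continuous_row => // i; exact: measurable_funD.
Qed.

Variables (th : 'I_K -> R -> R) (C : R) (t : R).
Hypotheses (cth : forall j, continuous (th j)) (thC : forall j s, `|th j s| <= C) (t0 : 0 <= t).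

(** The integrals over the part of the path between [s] and [t]: the full shift at [s = 0], none at
    [s = t]. *)
Definition remaining (s : R) (j : 'I_K) : R := primitive (th j) t - primitive (th j) s.

Lemma continuous_row_shift_remaining :
  continuous (fun s : R => row_shift (remaining s)).
Proof.
move=> s; apply: cvg_row => i.
have c : continuous (fun s => \sum_j remaining s j * gam j i); last first.
  by rewrite mxE; under eq_fun do rewrite mxE; exact: c.
apply: continuous_sum => j {}s; apply: cvgM; last exact: cvg_cst.
apply: cvgB; first exact: cvg_cst.
exact: (continuous_primitive (@cth j) (@thC j)).
Qed.

Lemma path_integrand_continuous v :
  continuous (fun s : R => \sum_j th j s * dir_deriv j (v + row_shift (remaining s))).
Proof.
apply: continuous_sum => j s; apply: cvgM; first exact: cth.
have c : v + row_shift (remaining y) @[y --> s] --> v + row_shift (remaining s).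
  by apply: cvgD; [exact: cvg_cst|exact: continuous_row_shift_remaining].
exact: (cvg_comp _ _ c (@continuous_dir_deriv j _)).
Qed.

(** The chain rule along a path; the minus sign appears because [s] is the lower limit of the
    remaining integrals. *)
Lemma path_is_derive v (s : R) : 0 < s ->
  is_derive s 1 (fun s => f (v + row_shift (remaining s)))
    (- \sum_j th j s * dir_deriv j (v + row_shift (remaining s))).
Proof.
move=> s0; pose u s := v + row_shift (remaining s).
have du i : is_derive s 1 (fun s => u s ord0 i) (- \sum_j th j s * gam j i).
  have hj (j : 'I_K) : is_derive s 1 (fun s => remaining s j * gam j i) (- (th j s * gam j i)).
    have dp := is_derive_primitive (@cth j) (@thC j) s0.
    rewrite /remaining; apply: is_derive_eq; rewrite /GRing.scale/=; ring.
  have hs : is_derive s 1 (\sum_(j < K) (fun s => remaining s j * gam j i))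
      (\sum_(j < K) - (th j s * gam j i)) by exact: is_derive_sum.
  have -> : (fun s => u s ord0 i) = cst (v ord0 i) + \sum_(j < K) (fun s => remaining s j * gam j i).
    by apply/funext => r; rewrite /u !mxE /= fctE fct_sumE.
  by apply: is_derive_eq; rewrite sumrN add0r.
have dU : derivable u s 1.
  by apply/derivable_mxP => a i; rewrite ord1; have [] := du i.
have dfu : differentiable (f \o u) s.
  by apply: differentiable_comp => //; exact/derivable1_diffP.
have dUd : differentiable u s by apply/derivable1_diffP.
apply: DeriveDef; first by apply/derivable1_diffP; exact: dfu.
rewrite (_ : (fun s => _) = f \o u)// deriveE// diff_comp//=.
rewrite -(deriveE _ dUd).
rewrite derive_mx//.
rewrite [X in 'd f _ X](_ : _ = \sum_i (- \sum_j th j s * gam j i) *: delta_mx ord0 i); last first.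
  apply/rowP => i; rewrite !mxE summxE.
  have [_ ->] := du i.
  rewrite (bigD1 i)//= [X in _ + X]big1 => [|k ki]; last first.
    by rewrite !mxE eqxx eq_sym (negbTE ki) mulr0.
  by rewrite !mxE !eqxx mulr1 addr0.
rewrite linear_sum/=.
under eq_bigr => i _ do rewrite linearZ/= -deriveE//.
rewrite /dir_deriv -sumrN; under [RHS]eq_bigr do rewrite mulr_sumr -sumrN.
rewrite exchange_big/=; apply: eq_bigr => i _.
by rewrite -sumrN scaler_suml; apply: eq_bigr => j _; rewrite /GRing.scale/= -/(u s); ring.
Qed.

Definition gam_sum : R := \sum_(j < K) \sum_(i < n.+1) `|gam j i|.

Lemma gam_sum_ge0 : 0 <= gam_sum.
Proof. by apply: sumr_ge0 => j _; apply: sumr_ge0. Qed.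

Lemma row_shift_norm (a : 'I_K -> R) (A : R) : 0 <= A -> (forall j, `|a j| <= A) ->
  `|row_shift a| <= A * gam_sum.
Proof.
move=> A0 aA; apply: norm_le_coord => [|i]; first by rewrite mulr_ge0// gam_sum_ge0.
rewrite mxE (le_trans (ler_norm_sum _ _ _))// mulr_sumr; apply: ler_sum => j _.
rewrite normrM ler_pM// (bigD1 i)//= lerDl; exact: sumr_ge0.
Qed.

Lemma dir_deriv_shift_bound j (A : R) : 0 <= A -> exists2 M, 0 <= M &
  forall v a, (forall k, `|a k| <= A) -> `|dir_deriv j (v + row_shift a)| <= M * exp_row v.
Proof.
move=> A0; have [M M0 dM] := dir_deriv_growth j.
exists (M * expR (A * gam_sum)); first by rewrite mulr_ge0// expR_ge0.
move=> v a aA; apply: (le_trans (dM _)); rewrite -mulrA ler_wpM2l//.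
apply: (le_trans (exp_row_shift _ _)); rewrite ler_wpM2r ?exp_row_ge0// ler_expR.
exact: row_shift_norm.
Qed.

Lemma measurable_dir_deriv j a :
  measurable_fun setT (fun w => dir_deriv j ((\row_i Is i w) + row_shift a)).
Proof. by apply: measurable_row_comp; exact: continuous_dir_deriv. Qed.

Lemma integrable_dir_deriv j a :
  P.-integrable setT (EFin \o (fun w => dir_deriv j ((\row_i Is i w) + row_shift a))).
Proof.
pose A := \sum_k `|a k|; have A0 : 0 <= A by apply: sumr_ge0.
have [M M0 dM] := dir_deriv_shift_bound j A0.
apply: (@integrable_le _ _ _ P _ (fun w => M * exp_row (\row_i Is i w))).
- exact: measurable_dir_deriv.
- move=> w; apply: dM => k; rewrite /A (bigD1 k)//= lerDl; exact: sumr_ge0.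
- exact: RintegrableZ.
Qed.

Lemma remaining_bound (s : R) j : 0 <= s <= t -> `|remaining s j| <= C * t.
Proof.
move=> /andP[s0 st]; apply: le_trans (primitive_lip (@cth j) (@thC j) _ _) _.
rewrite ger0_norm ?subr_ge0// ler_wpM2l ?gerBl//.
exact: le_trans (normr_ge0 _) (thC j 0).
Qed.

Lemma C_ge0_if (j : 'I_K) : 0 <= C.
Proof. exact: le_trans (normr_ge0 _) (thC j 0). Qed.

Lemma measurable_row_shift_path (g : 'rV[R]_n.+1 -> R) : continuous g ->
  measurable_fun setT (fun z : R * T => g ((\row_i Is i z.2) + row_shift (remaining z.1))).
Proof.
move=> cg; apply: (@measurable_continuous_pair R _ T
  (fun s w => g ((\row_i Is i w) + row_shift (remaining s)))).
  by move=> s; exact: measurable_row_comp.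
move=> w s; have c : (\row_i Is i w) + row_shift (remaining y) @[y --> s] -->
    (\row_i Is i w) + row_shift (remaining s).
  by apply: cvgD; [exact: cvg_cst|exact: continuous_row_shift_remaining].
exact: (cvg_comp _ _ c (@cg _)).
Qed.

Lemma path_FTC v : f (v + row_shift (remaining 0)) - f v =
  \int[leb]_(s in `[0, t]) \sum_j th j s * dir_deriv j (v + row_shift (remaining s)).
Proof.
have rt : row_shift (remaining t) = 0.
  by apply/rowP => i; rewrite !mxE big1// => j _; rewrite /remaining subrr mul0r.
(* The fundamental theorem of calculus is used on a nondegenerate interval; for [t = 0] both sides
   vanish. *)
move: t0; rewrite le_eqVlt => /predU1P[t00|tgt0].
  rewrite -t00 set_itv1 Rintegral_set1 (_ : row_shift _ = 0) ?addr0 ?subrr//.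
  by rewrite t00.
(* The sign compensates that of [path_is_derive], so that [F] is a primitive of the integrand. *)
pose F s := - f (v + row_shift (remaining s)).
have cF : continuous F.
  move=> s; apply: cvgN.
  have c : v + row_shift (remaining y) @[y --> s] --> v + row_shift (remaining s).
    by apply: cvgD; [exact: cvg_cst|exact: continuous_row_shift_remaining].
  exact: (cvg_comp _ _ c (differentiable_continuous (f_diff _))).
have dF (s : R) : 0 < s -> is_derive s 1 F (\sum_j th j s * dir_deriv j (v + row_shift (remaining s))).
  move=> s0; have h := path_is_derive v s0.
  by rewrite /F; apply: is_derive_eq; rewrite opprK.
rewrite /Rintegral (@continuous_FTC2 _ _ F)//.
- by rewrite /F rt addr0 /= opprK addrC.
- exact/continuous_subspaceT/path_integrand_continuous.
- split.
  + by move=> s; rewrite in_itv/= => /andP[s0 _]; have [] := dF s s0.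
  + exact/cvg_at_right_filter/cF.
  + exact/cvg_at_left_filter/cF.
- move=> s; rewrite in_itv/= => /andP[s0 _]; rewrite derive1E.
  by have [_ ->] := dF s s0.
Qed.

Lemma integrable_f_shift a :
  P.-integrable setT (EFin \o (fun w => f ((\row_i Is i w) + row_shift a))).
Proof.
have [M M0 fM] := poly_growth_exp f_growth.
apply: (@integrable_le _ _ _ P _ (fun w => M * expR `|row_shift a| * exp_row (\row_i Is i w))).
- apply: measurable_row_comp => v; exact: differentiable_continuous.
- move=> w; apply: (le_trans (fM _)); rewrite -mulrA ler_wpM2l//.
  exact: exp_row_shift.
- exact: RintegrableZ.
Qed.

(** The mean over [w] of the pathwise identity [path_FTC]. Fubini applies because the shifts stay
    within [C * t] for all times in [[0, t]], so that one multiple of [exp_row] dominates. *)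
Lemma smooth_mean_diff : smooth_mean (remaining 0) - smooth_mean (fun=> 0) =
  \int[leb]_(s in `[0, t]) \sum_j th j s * deriv_mean j (remaining s).
Proof.
have E0 : row_shift (fun=> 0) = 0.
  by apply/rowP => i; rewrite !mxE big1// => j _; rewrite mul0r.
rewrite /smooth_mean -RintegralB//; [|exact: integrable_f_shift..].
under eq_Rintegral do rewrite E0 addr0 path_FTC Rintegral_mkcond.
pose H (z : R * T) := \sum_j (\1_(`[0, t]%classic : set R) z.1 * th j z.1) *
   dir_deriv j ((\row_i Is i z.2) + row_shift (remaining z.1)).
have m1 : measurable_fun setT (fun z : R * T => \1_(`[0, t]%classic : set R) z.1 : R).
  by apply: (measurableT_comp (measurable_indic _)) => //; exact: measurable_fst.
have iHj (j : 'I_K) : (leb \x P)%E.-integrable setT (EFin \o (fun z : R * T =>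
    (\1_(`[0, t]%classic : set R) z.1 * th j z.1) *
     dir_deriv j ((\row_i Is i z.2) + row_shift (remaining z.1)))).
  have Ct0 : 0 <= C * t by rewrite mulr_ge0// (C_ge0_if j).
  have [M M0 dM] := dir_deriv_shift_bound j Ct0.
  apply: (@integrable_prod _ _ _ _ _ leb P _ (fun s => C * \1_(`[0, t]%classic : set R) s)
    (fun w => M * exp_row (\row_i Is i w))).
  - apply: measurable_funM; last by apply: measurable_row_shift_path; exact: continuous_dir_deriv.
    apply: measurable_funM => //.
    exact: (measurableT_comp (measurable_th (@cth j)) measurable_fst).
  - move=> s w /=; rewrite indicE; have [sI|sI] := boolP (s \in _); last first.
      by rewrite !mul0r normr0 mulr0 mul0r.
    rewrite mul1r mulr1 normrM ler_pM//; apply: dM => k; apply: remaining_bound.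
    by move: sI; rewrite inE /= in_itv.
  - by apply: RintegrableZ; exact: integrable_indic_itv.
  - exact: RintegrableZ.
have iH : (leb \x P)%E.-integrable setT (EFin \o H) by apply: Rintegrable_sum => j _.
transitivity (\int[P]_w \int[leb]_s H (s, w)).
  apply: eq_Rintegral => w _; apply: eq_Rintegral => s _; rewrite /H patchE indicE /=.
  case: (s \in _); last by rewrite big1// => j _; rewrite !mul0r.
  by apply: eq_bigr => j _; rewrite mul1r.
rewrite -(Rfubini iH) [RHS]Rintegral_mkcond; apply: eq_Rintegral => s _.
rewrite patchE /H /=; under eq_Rintegral do rewrite indicE.
case: (s \in _); last first.
  rewrite /Rintegral (_ : (fun w => _) = cst 0%E) ?integral0//.
  by apply/funext => w; rewrite big1// => j _; rewrite !mul0r.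
rewrite Rintegral_sum => [|j _]; last by apply: RintegrableZ; exact: integrable_dir_deriv.
by apply: eq_bigr => j _; rewrite RintegralZl ?mul1r//; exact: integrable_dir_deriv.
Qed.

End path_derivative.

(** * The Markov property of Brownian motion *)

Section clamp.
Context (R : realType) (T : R) (T0 : 0 <= T).

Definition clamp (s : R) : R := Num.max 0 (Num.min s T).

Lemma clamp_itv s : 0 <= clamp s <= T.
Proof. by rewrite /clamp le_max lexx/= ge_max T0 ge_min lexx orbT. Qed.

Lemma clamp_id s : 0 <= s <= T -> clamp s = s.
Proof. by move=> /andP[s0 sT]; rewrite /clamp min_l// max_r. Qed.

Lemma clamp_lip s s' : `|clamp s - clamp s'| <= `|s - s'|.
Proof.
rewrite /clamp /Num.max /Num.min.
by case: ifPn; case: ifPn; case: ifPn; case: ifPn => *; rewrite ?ler_norml; apply/andP; split; have := ler_norm (s - s'); have := ler_norm (s' - s); rewrite distrC; lra.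
Qed.

Lemma continuous_clamp : continuous clamp.
Proof.
move=> s; apply/cvgrPdist_le => e e0.
have c : y @[y --> s] --> s by exact: cvg_id.
move/cvgrPdist_le : c => /(_ e e0); apply: filterS => s'.
exact: le_trans (clamp_lip _ _).
Qed.

End clamp.

Section brownian_clamp.
Context (R : realType) d (Om : measurableType d) (P : probability Om R) (T : R).
Variables (G : R -> set (set Om)) (B : R -> Om -> R).
Hypotheses (T0 : 0 <= T) (GF : filtration T G) (BB : brownian P T G B).

(** [B] is constrained on [[0, T]] only. Freezing it outside gives measurable coordinates and
    continuous paths at every real time, as joint measurability requires. *)
Definition Bc (s : R) (v : Om) := B (clamp T s) v.

Lemma measurable_Bc s : measurable_fun setT (Bc s).
Proof.
have [GB _ _ _ _] := BB; have [Gm _] := GF.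
move=> _ Y mY; rewrite setTI; apply: (Gm (clamp T s) (clamp_itv T0 s)).2.
by apply: GB => //; exact: (clamp_itv T0).
Qed.

Lemma continuous_Bc v : continuous (Bc ^~ v).
Proof.
have [_ _ cB _ _] := BB; move=> s.
have /subspace_continuousP cv := cB v.
have := cv (clamp T s) (clamp_itv T0 s) => c.
apply: (cvg_comp (clamp T) (B ^~ v) _ c).
move=> U /=; rewrite /within/= => hU.
have h : \forall y \near s, `[0, T]%classic (clamp T y) -> U (clamp T y).
  exact: (@continuous_clamp R T s _ hU).
suff : \forall y \near s, U (clamp T y) by [].
by apply: filterS h => s' /=; apply; rewrite in_itv/=; exact: (clamp_itv T0).
Qed.

Lemma measurable_Bc_pair : measurable_fun setT (fun z : R * Om => Bc z.1 z.2).
Proof. exact: measurable_continuous_pair measurable_Bc continuous_Bc. Qed.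

Lemma filtration_increment s t u (C : set R) : 0 <= s -> s <= t -> t <= u -> u <= T ->
  measurable C -> G u [set w | C (B t w - B s w)].
Proof.
move=> s0 st tu uT mC; have [GB _ _ _ _] := BB; have [Gm Gle] := GF.
have u0 : 0 <= u <= T by rewrite uT (le_trans s0)// (le_trans st).
have [sG _] := Gm u u0.
(* The difference is shown measurable on [Om] equipped with the sigma-algebra generated by [G u],
   which is [G u] itself. *)
have mB r : 0 <= r -> r <= u ->
    measurable_fun [set: g_sigma_algebraType (G u)] (B r : g_sigma_algebraType (G u) -> R).
  move=> r0 ru _ Y mY; rewrite setTI; apply: sub_sigma_algebra.
  by apply: (Gle r u r0 ru uT); apply: GB => //; rewrite r0 (le_trans ru).
have mD : measurable_fun [set: g_sigma_algebraType (G u)]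
    ((fun w => B t w - B s w) : g_sigma_algebraType (G u) -> R).
  apply: measurable_funB; apply: mB => //; first exact: le_trans st.
  exact: le_trans tu.
have := mD measurableT C mC; rewrite setTI.
by rewrite /measurable/= sigma_algebra_id.
Qed.

(** The last increment is independent of [G (tau m)], which contains the event on the earlier ones;
    hence membership in the filtration and the product formula must go through the induction
    together. *)
Lemma increments_law_aux (tau : nat -> R) (A : nat -> set R) m :
  0 <= tau 0%N -> (forall i, (i < m)%N -> tau i < tau i.+1) -> tau m <= T ->
  (forall i, measurable (A i)) ->
  G (tau m) [set w | forall i, (i < m)%N -> A i (B (tau i.+1) w - B (tau i) w)] /\
  P [set w | forall i, (i < m)%N -> A i (B (tau i.+1) w - B (tau i) w)] =
  (\prod_(i < m) normal_prob 0 (Num.sqrt (tau i.+1 - tau i)) (A i))%E.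
Proof.
move=> tau0 + + mA; have [_ _ _ gB iB] := BB; have [Gm Gle] := GF.
elim: m => [|m ih] lt_tau tauT.
  have E : [set w : Om | forall i, (i < 0)%N -> A i (B (tau i.+1) w - B (tau i) w)] = setT.
    by apply/seteqP; split.
  rewrite E big_ord0 probability_setT; split => //.
  have [[G0 GC GU] _] := Gm (tau 0%N) (introT andP (conj tau0 tauT)).
  by rewrite -setC0 -setTD; exact: GC.
have lt_m i : (i < m)%N -> tau i < tau i.+1 by move=> im; apply: lt_tau; rewrite ltnS ltnW.
have ltm : tau m < tau m.+1 by exact: lt_tau.
have tmT : tau m <= T by rewrite (le_trans _ tauT)// ltW.
have tm0 : 0 <= tau m.
  elim: (m) lt_m => [//|k ihk] lk; apply: (le_trans (ihk _)) => [i ik|].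
    by apply: lk; rewrite ltnS ltnW.
  by apply/ltW/lk.
have [GA PA] := ih lt_m tmT.
set Am := [set w | _] in GA PA.
have E : [set w : Om | forall i, (i < m.+1)%N -> A i (B (tau i.+1) w - B (tau i) w)] =
    Am `&` [set w | A m (B (tau m.+1) w - B (tau m) w)].
  apply/seteqP; split => [w h|w [h1 h2] i].
    by split; [move=> i im; apply: h; rewrite ltnS ltnW|exact: h].
  by rewrite ltnS leq_eqVlt => /predU1P[->|/h1].
rewrite E; split; last first.
  by rewrite iB// gB// big_ord_recr/= -PA.
have t0 : 0 <= tau m.+1 <= T by rewrite tauT (le_trans tm0)// ltW.
have [sG _] := Gm _ t0.
have Am' : G (tau m.+1) Am by apply: (Gle (tau m)) => //; exact: ltW.
have AA : G (tau m.+1) [set w | A m (B (tau m.+1) w - B (tau m) w)].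
  by apply: filtration_increment => //; exact: ltW.
have mI : measurable ((Am : set (g_sigma_algebraType (G (tau m.+1)))) `&` [set w | A m (B (tau m.+1) w - B (tau m) w)]).
  by apply: measurableI; exact: sub_sigma_algebra.
by move: mI; rewrite /measurable/= sigma_algebra_id.
Qed.

Definition bm_increments n (tau : nat -> R) (w : Om) : n.-tuple R :=
  [tuple Bc (tau i.+1) w - Bc (tau i) w | i < n].

Lemma measurable_bm_increments n tau : measurable_fun setT (bm_increments n tau).
Proof.
apply/measurable_fun_tnthP => i.
rewrite (_ : _ \o _ = fun w => Bc (tau i.+1) w - Bc (tau i) w).
  by apply: measurable_funB; exact: measurable_Bc.
by apply/funext => w /=; rewrite tnth_mktuple.
Qed.

Lemma bm_increments_law n (tau : nat -> R) (A : 'I_n -> set R) :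
  0 <= tau 0%N -> (forall i, (i < n)%N -> tau i < tau i.+1) -> tau n <= T ->
  (forall i, measurable (A i)) ->
  P [set w | forall i, A i (tnth (bm_increments n tau w) i)] =
  (\prod_(i < n) normal_prob 0 (Num.sqrt (tau i.+1 - tau i)) (A i))%E.
Proof.
move=> tau0 lt_tau tauT mA.
(* The finite family is extended by [setT], since the induction is stated for families indexed by
   [nat]. *)
pose A' k := if insub k is Some i then A i else setT.
have mA' k : measurable (A' k) by rewrite /A'; case: insub.
have [_ E] := increments_law_aux tau0 lt_tau tauT mA'.
have A'E (i : 'I_n) : A' i = A i by rewrite /A' valK.
have nd k l : (k <= l)%N -> (l <= n)%N -> tau k <= tau l.
  elim: l => [|l ih]; first by rewrite leqn0 => /eqP ->.
  rewrite leq_eqVlt => /predU1P[->//|kl ln].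
  by apply: (le_trans (ih kl (ltnW ln))); exact/ltW/lt_tau.
have itv k : (k <= n)%N -> 0 <= tau k <= T.
  by move=> kn; rewrite (le_trans tau0 (nd _ _ _ kn))// (le_trans (nd _ _ kn _)).
have BcE k w : (k <= n)%N -> Bc (tau k) w = B (tau k) w.
  by move=> kn; rewrite /Bc clamp_id// itv.
rewrite (eq_bigr (fun i : 'I_n => normal_prob 0 (Num.sqrt (tau i.+1 - tau i)) (A' i))); last first.
  by move=> i _; rewrite A'E.
rewrite -E; congr (P _); apply/seteqP; split => w h i.
- move=> im; have := h (Ordinal im); rewrite tnth_mktuple /= !BcE// 1?ltnW//.
  by rewrite -(A'E (Ordinal im)).
- have := h i (ltn_ord i); rewrite A'E tnth_mktuple !BcE//.
  exact: ltnW.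
Qed.

Lemma Bc0 : {ae P, forall w, Bc 0 w = 0}.
Proof.
have [_ B0 _ _ _] := BB; apply: filterS B0 => w.
by rewrite /Bc clamp_id// lexx.
Qed.

End brownian_clamp.

Lemma tuple_law_bounded (R : realType) n d1 d2 (T1 : measurableType d1) (T2 : measurableType d2)
    (P1 : probability T1 R) (P2 : probability T2 R) (X1 : T1 -> n.-tuple R) (X2 : T2 -> n.-tuple R)
    (g : n.-tuple R -> R) (M : R) :
  measurable_fun setT X1 -> measurable_fun setT X2 ->
  (forall A : 'I_n -> set R, (forall i, measurable (A i)) ->
    P1 [set w | forall i, A i (tnth (X1 w) i)] = P2 [set w | forall i, A i (tnth (X2 w) i)]) ->
  measurable_fun setT g -> (forall t, `|g t| <= M) ->
  \int[P1]_w g (X1 w) = \int[P2]_w g (X2 w).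
Proof.
move=> mX1 mX2 law mg gM.
have i1 : P1.-integrable setT (EFin \o (fun w => g (X1 w))).
  apply: (@integrable_le _ _ _ P1 _ (cst M)) => //; last exact: integrable_cst.
  exact: (measurableT_comp mg).
have i2 : P2.-integrable setT (EFin \o (fun w => g (X2 w))).
  apply: (@integrable_le _ _ _ P2 _ (cst M)) => //; last exact: integrable_cst.
  exact: (measurableT_comp mg).
have gM0 t : 0 <= g t + M by have := gM t; rewrite ler_norml => /andP[]; lra.
have mgM : measurable_fun setT (fun t => (g t + M)%:E).
  by apply/measurable_EFinP; exact: measurable_funD.
have := tuple_law mX1 mX2 law mgM gM0 => /(congr1 fine) E.
have {}E : \int[P1]_w (g (X1 w) + M) = \int[P2]_w (g (X2 w) + M) := E.
move: E; rewrite !RintegralD//; try exact: integrable_cst.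
by rewrite !Rintegral_cst_prob => /addIr.
Qed.

(** * Path functionals sampled at finitely many times *)

Section sampled_functional.
Context (R : realType) (K : nat).
Local Notation leb := (@lebesgue_measure R).
Variables (ee : 'I_K -> R -> R) (C : R) (g1 u0 : R -> R) (Psi : ('I_K -> R) -> R) (M1 M2 : R).
Hypotheses (cee : forall k, continuous (ee k)) (eeC : forall k z, `|ee k z| <= C) (C0 : 0 <= C).
Hypotheses (mg1 : measurable_fun setT g1) (g1M : forall z, `|g1 z| <= M1).
Hypotheses (mu0 : measurable_fun setT u0) (u0M : forall z, `|u0 z| <= M2).
Hypothesis Psi_bound : forall A, 0 <= A -> exists2 M, 0 <= M &
  forall a : 'I_K -> R, (forall k, `|a k| <= A) -> `|Psi a| <= M.
Hypothesis Psi_cvg : forall A (a_ : nat -> 'I_K -> R) a, 0 <= A ->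
  (forall k i, `|a_ k i| <= A) -> (forall i, a_ k i @[k --> \oo] --> a i) ->
  Psi (a_ k) @[k --> \oo] --> Psi a.
Variables (rho : R).
Hypothesis rho0 : 0 < rho.

(** The shape needed from the Markov property: a factor at the initial point, the datum [u0] at the
    final point, and a continuous function of the occupation integrals in between. *)
Definition path_functional (be : R -> R) : R :=
  g1 (be 0) * u0 (be rho) * Psi (fun k => \int[leb]_(q in `[0, rho]) ee k (be q)).

Definition step_index (N : nat) (q : R) : nat := Num.truncn (q / (rho / N.+1%:R)).

Definition step_time (N : nat) (i : nat) : R := i%:R * (rho / N.+1%:R).

Definition sampled (N : nat) (be : R -> R) : R := path_functional (fun q => be (step_time N (step_index N q))).

Lemma step_size_gt0 N : 0 < rho / N.+1%:R.
Proof. by rewrite divr_gt0. Qed.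

Lemma step_time_dist N q : 0 <= q -> `|step_time N (step_index N q) - q| <= rho * N.+1%:R^-1.
Proof.
move=> q0; have d0 := step_size_gt0 N.
rewrite -/(rho / N.+1%:R) /step_time /step_index; set dl := rho / N.+1%:R in d0 *.
have /truncn_itv/andP[h1 h2] : 0 <= q / dl by rewrite divr_ge0// ltW.
move: h1 h2; rewrite ler_pdivlMr// ltr_pdivrMr// -natr1 mulrDl mul1r => h1 h2.
by rewrite ler_norml; apply/andP; split; lra.
Qed.

Lemma cvg_step_time q : 0 <= q -> step_time N (step_index N q) @[N --> \oo] --> q.
Proof.
move=> q0; apply/subr_cvg0/norm_cvg0P.
apply: (@squeeze_cvgr _ _ _ _ (cst 0) (fun N => rho * N.+1%:R^-1)).
- by apply: nearW => N; rewrite normr_ge0 step_time_dist.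
- exact: cvg_cst.
- under eq_fun do rewrite mulrC; apply: cvg0_Mr; exact: cvg_harmonic.
Qed.

Lemma step_time0 N : step_time N (step_index N 0) = 0.
Proof. by rewrite /step_time /step_index mul0r truncn0 mul0r. Qed.

Lemma step_index_rho N : step_index N rho = N.+1.
Proof.
rewrite /step_index invf_div mulrCA divff ?gt_eqF// mulr1.
exact: natrK.
Qed.

Lemma step_time_rho N : step_time N (step_index N rho) = rho.
Proof. by rewrite step_index_rho /step_time mulrC divfK// gt_eqF. Qed.

Lemma step_index_le N q : 0 <= q <= rho -> (step_index N q <= N.+1)%N.
Proof.
move=> /andP[q0 qr]; rewrite -(step_index_rho N) /step_index.
by apply: le_truncn; rewrite ler_pM2r// invr_gt0 step_size_gt0.
Qed.

Lemma Rint_itv_bound (g : R -> R) : measurable_fun setT g -> (forall z, `|g z| <= C) ->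
  `|\int[leb]_(q in `[0, rho]) g q| <= C * rho.
Proof.
move=> mg gC; have ig := integrable_bounded_itv 0 rho mg gC.
apply: le_trans (le_normr_Rintegral _ ig) _ => //.
apply: (@le_trans _ _ (\int[leb]_(x in `[0, rho]) C)).
  apply: le_Rintegral => //; first exact: integrable_norm.
  by apply: (@integrable_bounded_itv _ 0 rho (cst C) C) => // z; rewrite ger0_norm.
by rewrite Rintegral_cst//= lebesgue_measure_itv/= lte_fin rho0 oppr0 adde0.
Qed.

Lemma path_functional_bound : exists2 M, 0 <= M & forall be,
  (forall k, measurable_fun setT (fun q => ee k (be q))) -> `|path_functional be| <= M.
Proof.
have Cr : 0 <= C * rho by rewrite mulr_ge0// ltW.
have [M M0 PM] := Psi_bound Cr; exists (M1 * M2 * M).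
  by rewrite !mulr_ge0// (le_trans _ (g1M 0), le_trans _ (u0M 0)).
move=> be mbe; rewrite /path_functional !normrM ler_pM ?mulr_ge0// ?ler_pM//.
by apply: PM => k; exact: Rint_itv_bound.
Qed.

(** Negative integers go to 0, as with [Num.truncn], so that [step_index] becomes a function of a
    floor, whose level sets are measurable. *)
Definition int_trunc (z : int) : nat := if z is Posz i then i else 0%N.

Lemma step_index_floor N q : step_index N q = int_trunc (Num.floor (q / (rho / N.+1%:R))).
Proof. by rewrite /step_index truncEfloor. Qed.

Lemma measurable_step N (be : nat -> R) : measurable_fun setT (fun q => be (step_index N q)).
Proof.
pose F (z : int) (_ : measurableTypeR R) : measurableTypeR R := be (int_trunc z).
rewrite (_ : (fun q => _) = fun q => F (Num.floor (q / (rho / N.+1%:R))) q); last first.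
  by apply/funext => q; rewrite /F -step_index_floor.
apply: (measurable_countable_choice (F := F)) => [z|z]; last exact: measurable_cst.
by apply: measurable_floor_eq; exact: measurable_funM.
Qed.

Lemma measurable_step_path N (be : R -> R) : measurable_fun setT (fun q => be (step_time N (step_index N q))).
Proof. exact: (measurable_step N (fun i => be (step_time N i))). Qed.

Lemma path_functional_eq (be be' : R -> R) :
  (forall q, 0 <= q <= rho -> be q = be' q) -> path_functional be = path_functional be'.
Proof.
move=> E; have r0 := ltW rho0; rewrite /path_functional !E ?lexx ?r0//.
congr (_ * Psi _); apply/funext => k; apply: eq_Rintegral => q.
by rewrite inE/= in_itv/= => qI; rewrite E.
Qed.

(** [g1] and [u0] are merely measurable, but 0 and [rho] are grid times, so these two factors do not
    depend on [N]. Only the occupation integrals have to converge, by continuity of [ee] and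
    dominated convergence. *)
Lemma sampled_cvg (be : R -> R) : continuous be -> sampled N be @[N --> \oo] --> path_functional be.
Proof.
move=> cbe; rewrite /sampled /path_functional.
under eq_fun do rewrite step_time0 step_time_rho.
apply: cvgM; first exact: cvg_cst.
have Cr : 0 <= C * rho by rewrite mulr_ge0// ltW.
apply: (Psi_cvg Cr) => [N k|k].
  apply: Rint_itv_bound => //.
  exact: (@measurable_step_path N (ee k \o be)).
under eq_fun do rewrite Rintegral_mkcond; rewrite Rintegral_mkcond.
apply: (@Rdct _ _ _ leb _ _ (fun q => C * \1_(`[0, rho]%classic : set R) q)).
- move=> N; apply/(measurable_restrictT _ (measurable_itv _)); apply: measurable_funTS.
  exact: (@measurable_step_path N (ee k \o be)).
- apply/(measurable_restrictT _ (measurable_itv _)); apply: measurable_funTS.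
  apply: continuous_measurable_fun => q; exact: (cvg_comp _ _ (@cbe q) (@cee k _)).
- apply: nearW => q; under eq_fun do rewrite patchE; rewrite patchE.
  case: ifPn => qI; last exact: cvg_cst.
  move: qI; rewrite inE/= in_itv/= => /andP[q0 _].
  have c := cvg_comp _ _ (cvg_step_time q0) (@cbe q).
  exact: (cvg_comp _ _ c (@cee k _)).
- move=> N q; rewrite patchE indicE; case: (q \in _); last by rewrite normr0 mulr0.
  by rewrite mulr1.
- by apply: RintegrableZ; exact: integrable_indic_itv.
Qed.

Section tuple_path.
Variables (N : nat) (x : R).
Local Notation tup := (N.+2.-tuple R).

(** Coordinate 0 is the displacement before the first grid time and coordinate [i] the i-th
    increment after it, hence the inclusive bound: index [m] gives the position at grid time [m]. *)
Definition psum (m : nat) (t : tup) : R := \sum_(i < N.+2 | (i <= m)%N) tnth t i.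

Definition tuple_functional (t : tup) : R := path_functional (fun q => x + psum (step_index N q) t).

Lemma measurable_psum m : measurable_fun setT (psum m).
Proof.
rewrite (_ : psum m = fun t => \sum_(i < N.+2) (if (i <= m)%N then tnth t i else 0)).
  apply: measurable_sum => i; case: (i <= m)%N => //; exact: measurable_tnth.
by apply/funext => t; rewrite /psum big_mkcond.
Qed.

(** A convergent sequence is bounded in each coordinate, which supplies the common bound that
    [Psi_cvg] asks for. *)
Lemma Psi_tuple_continuous : tuple_continuous (fun a : K.-tuple R => Psi (tnth a)).
Proof.
move=> u t ut.
have bnd i : exists2 A, 0 <= A & forall k, `|tnth (u k) i| <= A.
  have /cvg_seq_bounded[A [_ HA]] : cvgn (fun k => tnth (u k) i) by apply/cvg_ex; exists (tnth t i).
  exists (`|A| + 1); first by rewrite addr_ge0.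
  by move=> k; apply: (HA (`|A| + 1)) => //; rewrite (le_lt_trans (ler_norm A))// ltrDl.
have /choice[A HA] : forall i, exists A, 0 <= A /\ forall k, `|tnth (u k) i| <= A.
  by move=> i; have [A] := bnd i; exists A.
have A0 : 0 <= \sum_i A i by apply: sumr_ge0 => i _; have [] := HA i.
apply: (Psi_cvg A0) => [k i|]; last exact: ut.
have [Ai H] := HA i; rewrite (le_trans (H k))// (bigD1 i)//= lerDl.
by apply: sumr_ge0 => j _; have [] := HA j.
Qed.

Lemma measurable_Psi d (T : measurableType d) (a : T -> 'I_K -> R) :
  (forall k, measurable_fun setT (fun w => a w k)) -> measurable_fun setT (fun w => Psi (a w)).
Proof.
move=> ma.
rewrite (_ : (fun w => _) = (fun t : K.-tuple R => Psi (tnth t)) \o (fun w => [tuple a w k | k < K])).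
  apply: measurableT_comp; last exact: measurable_mktuple.
  exact: measurable_tuple_continuous Psi_tuple_continuous.
by apply/funext => w /=; congr Psi; apply/funext => k; rewrite tnth_mktuple.
Qed.

Lemma measurable_tuple_functional : measurable_fun setT tuple_functional.
Proof.
apply: measurable_funM; first apply: measurable_funM.
- apply: (measurableT_comp mg1); apply: measurable_funD => //; exact: measurable_psum.
- apply: (measurableT_comp mu0); apply: measurable_funD => //; exact: measurable_psum.
- apply: measurable_Psi => k; under eq_fun do rewrite Rintegral_mkcond.
  rewrite (_ : (fun t => _) = (fun t => \int[leb]_q (\1_(`[0, rho]%classic : set R) q *
     ee k (x + psum (step_index N q) t)))); last first.
    apply/funext => t; apply: eq_Rintegral => q _; rewrite patchE indicE.
    by case: (q \in _); rewrite ?mul1r ?mul0r.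
  apply: (@measurable_Rint1 _ _ _ _ _ leb (fun z : tup * R => \1_(`[0, rho]%classic : set R) z.2 *
     ee k (x + psum (step_index N z.2) z.1))).
  apply: measurable_funM.
    by apply: (measurableT_comp (measurable_indic _)) => //; exact: measurable_snd.
  pose F (i : int) (z : tup * measurableTypeR R) : measurableTypeR R := ee k (x + psum (int_trunc i) z.1).
  rewrite (_ : (fun z => _) = fun z => F (Num.floor (z.2 / (rho / N.+1%:R))) z); last first.
    by apply/funext => z; rewrite /F -step_index_floor.
  apply: (measurable_countable_choice (F := F)) => [i|i].
    by apply: measurable_floor_eq; apply: measurable_funM => //; exact: measurable_snd.
  have mk : measurable_fun setT (ee k) by apply: continuous_measurable_fun; exact: cee.
  apply: (measurableT_comp mk); apply: measurable_funD => //.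
  exact: (measurableT_comp (measurable_psum _) measurable_fst).
Qed.

End tuple_path.

Lemma measurable_path_functional d' (T' : measurableType d') (be : T' -> R -> R) :
  (forall q, measurable_fun setT (be ^~ q)) -> (forall w, continuous (be w)) ->
  measurable_fun setT (fun w => path_functional (be w)).
Proof.
move=> mbe cbe; apply: measurable_funM; first apply: measurable_funM.
- exact: (measurableT_comp mg1 (mbe 0)).
- exact: (measurableT_comp mu0 (mbe rho)).
- apply: measurable_Psi => k; under eq_fun do rewrite Rintegral_mkcond.
  rewrite (_ : (fun w => _) = (fun w => \int[leb]_q (\1_(`[0, rho]%classic : set R) q *
     ee k (be w q)))); last first.
    apply/funext => w; apply: eq_Rintegral => q _; rewrite patchE indicE.
    by case: (q \in _); rewrite ?mul1r ?mul0r.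
  apply: (@measurable_Rint1 _ _ _ _ _ leb (fun z : T' * R => \1_(`[0, rho]%classic : set R) z.2 *
     ee k (be z.1 z.2))).
  apply: measurable_funM.
    by apply: (measurableT_comp (measurable_indic _)) => //; exact: measurable_snd.
  have mk : measurable_fun setT (ee k) by apply: continuous_measurable_fun; exact: cee.
  apply: (measurableT_comp mk).
  have mp := measurable_continuous_pair (B := fun q w => be w q) mbe cbe.
  exact: (measurableT_comp mp (@measurable_swap _ _ T' (measurableTypeR R))).
Qed.

Section markov.
Context d (Om : measurableType d) (P : probability Om R) (T : R).
Variables (G : R -> set (set Om)) (B : R -> Om -> R).
Hypotheses (T0 : 0 <= T) (GF : filtration T G) (BB : brownian P T G B).
Variables (x s : R).
Hypotheses (s0 : 0 < s) (srT : s + rho <= T).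
Local Notation Bc := (Bc T B).

(** Time 0, followed by the grid translated by [s]; since the grid starts at 0, the second time is
    [s] itself. *)
Definition after_time N (i : nat) : R := if i is j.+1 then s + step_time N j else 0.

Definition after_increments N := bm_increments T B N.+2 (after_time N).

Definition fresh_increments N (z : R * Om) : N.+2.-tuple R :=
  [tuple if (i : nat) is j.+1 then Bc (step_time N j.+1) z.2 - Bc (step_time N j) z.2 else z.1 | i < N.+2].

(** The first component plays the position at time [s], the second is an independent path restarted
    at time 0. *)
Definition fresh_law : probability (measurableTypeR R * Om)%type R := (normal_prob 0 (Num.sqrt s) \x P)%E.

Lemma step_timeS N i : step_time N i < step_time N i.+1.
Proof. by rewrite /step_time ltr_pM2r ?step_size_gt0// ltr_nat. Qed.

Lemma step_time_last N : step_time N N.+1 = rho.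
Proof. by rewrite -(step_time_rho N) step_index_rho. Qed.

Lemma after_timeS N i : after_time N i < after_time N i.+1.
Proof.
case: i => [|i] /=; first by rewrite /step_time mul0r addr0.
by rewrite ltrD2l step_timeS.
Qed.

Lemma measurable_fresh N : measurable_fun setT (fresh_increments N).
Proof.
apply: (measurable_mktuple (g := fun (i : 'I_N.+2) (z : R * Om) =>
  if (i : nat) is j.+1 then Bc (step_time N j.+1) z.2 - Bc (step_time N j) z.2 else z.1)).
case=> -[|j] /= _; first exact: measurable_fst.
by apply: measurable_funB; apply: (measurableT_comp _ measurable_snd); exact: (measurable_Bc T0 GF BB).
Qed.

(** Both vectors have independent centred Gaussian coordinates with the same variances, [s] first
    and then the grid steps, because translating the grid by [s] does not change its steps. *)
Lemma increments_same_law N (A : 'I_N.+2 -> set R) : (forall i, measurable (A i)) ->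
  P [set w | forall i, A i (tnth (after_increments N w) i)] =
  fresh_law [set z | forall i, A i (tnth (fresh_increments N z) i)].
Proof.
move=> mA; rewrite (bm_increments_law GF BB)//; last 2 first.
- by move=> i _; exact: after_timeS.
- by rewrite /= step_time_last.
have st0 : step_time N 0 = 0 by rewrite /step_time mul0r.
rewrite big_ord_recl /= st0 addr0 subr0.
pose A' (i : 'I_N.+1) := A (lift ord0 i).
have mA' i : measurable (A' i) by exact: mA.
have E : [set z : R * Om | forall i, A i (tnth (fresh_increments N z) i)] =
   A ord0 `*` [set w | forall i, A' i (tnth (bm_increments T B N.+1 (step_time N) w) i)].
  apply/seteqP; split => [[y w] /= h|[y w] /= [h1 h2] i].
    split; first by have := h ord0; rewrite tnth_mktuple.
    by move=> i; have := h (lift ord0 i); rewrite !tnth_mktuple.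
  rewrite tnth_mktuple; have [->//|] := eqVneq i ord0.
  case: (unliftP ord0 i) => [j ->|->]; last by rewrite eqxx.
  by move=> _; have := h2 j; rewrite tnth_mktuple.
have mB : measurable [set w | forall i, A' i (tnth (bm_increments T B N.+1 (step_time N) w) i)].
  have := measurable_bm_increments T0 GF BB (n := N.+1) (step_time N) measurableT (measurable_rectangle mA').
  by rewrite setTI.
rewrite E [RHS]product_measure1E//; last exact: mA.
congr (_ * _)%E.
have srT' : step_time N N.+1 <= T by rewrite step_time_last (le_trans _ srT)// lerDr ltW.
have st00 : 0 <= step_time N 0 by rewrite st0.
have law := bm_increments_law GF BB st00 (fun i _ => step_timeS N i) srT' mA'.
apply: etrans (esym law); apply: eq_bigr => i _.
by rewrite /= /A' opprD addrACA subrr add0r.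
Qed.

Lemma psum_telescope N m (tau : nat -> R) : (m <= N.+1)%N ->
  \sum_(i < N.+2 | (i <= m)%N) (tau i.+1 - tau i) = tau m.+1 - tau 0%N.
Proof.
move=> mN; rewrite -(big_mkord (fun i => (i <= m)%N) (fun i => tau i.+1 - tau i)).
rewrite (big_cat_nat (n := m.+1))//= [X in _ + X]big_nat_cond [X in _ + X]big_pred0 => [|i]; last first.
  by case: (ltnP m i) => //= _; rewrite ?andbF.
rewrite addr0 big_nat_cond (eq_bigl (fun i => (0 <= i < m.+1)%N && true)) => [|i]; last first.
  by rewrite ltnS; case: (i <= m)%N.
by rewrite -big_nat_cond telescope_sumr.
Qed.

Lemma psum_after N m v : (m <= N.+1)%N ->
  psum m (after_increments N v) = Bc (s + step_time N m) v - Bc 0 v.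
Proof.
move=> mN; rewrite /psum.
rewrite (eq_bigr (fun i : 'I_N.+2 => Bc (after_time N i.+1) v - Bc (after_time N i) v)); last first.
  by move=> i _; rewrite tnth_mktuple.
exact: (psum_telescope (fun i => Bc (after_time N i) v) mN).
Qed.

Lemma psum_fresh N m z : (m <= N.+1)%N ->
  psum m (fresh_increments N z) = z.1 + Bc (step_time N m) z.2 - Bc 0 z.2.
Proof.
move=> mN; rewrite /psum.
pose tau (i : nat) := if i is j.+1 then z.1 + Bc (step_time N j) z.2 - Bc 0 z.2 else 0.
rewrite (eq_bigr (fun i : 'I_N.+2 => tau i.+1 - tau i)); last first.
  case=> -[|i] iN _; rewrite tnth_mktuple /tau /=; last by ring.
  by rewrite /step_time mul0r; ring.
by rewrite (psum_telescope tau mN) subr0.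
Qed.

Lemma tuple_functional_after N v :
  tuple_functional x (after_increments N v) = sampled N (fun q => x + (Bc (s + q) v - Bc 0 v)).
Proof.
by apply: path_functional_eq => q qI; rewrite psum_after// step_index_le.
Qed.

Lemma tuple_functional_fresh N z :
  tuple_functional x (fresh_increments N z) = sampled N (fun q => x + (z.1 + Bc q z.2 - Bc 0 z.2)).
Proof.
by apply: path_functional_eq => q qI; rewrite psum_fresh// step_index_le.
Qed.

Lemma markov_sampled N :
  \int[P]_v sampled N (fun q => x + (Bc (s + q) v - Bc 0 v)) =
  \int[fresh_law]_z sampled N (fun q => x + (z.1 + Bc q z.2 - Bc 0 z.2)).
Proof.
have [M M0 PM] := path_functional_bound.
under eq_Rintegral do rewrite -tuple_functional_after.
under [RHS]eq_Rintegral do rewrite -tuple_functional_fresh.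
apply: (@tuple_law_bounded _ _ _ _ _ _ P fresh_law (after_increments N) (fresh_increments N)
  (tuple_functional x) M).
- exact: (measurable_bm_increments T0 GF BB).
- exact: measurable_fresh.
- exact: increments_same_law.
- exact: measurable_tuple_functional.
- move=> t; apply: PM => k; exact: (measurable_step N (fun i => ee k (x + psum i t))).
Qed.

Lemma cvg_sampled_mean d' (T' : measurableType d') (Q : probability T' R) (be : T' -> R -> R) :
  (forall w, continuous (be w)) -> (forall N, measurable_fun setT (fun w => sampled N (be w))) ->
  \int[Q]_w sampled N (be w) @[N --> \oo] --> \int[Q]_w path_functional (be w).
Proof.
move=> cbe ms; have [M M0 PM] := path_functional_bound.
have c w : sampled N (be w) @[N --> \oo] --> path_functional (be w) by exact: sampled_cvg.
apply: (@Rdct _ _ _ Q _ _ (cst M)) => //.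
- by apply: (measurable_fun_cvg ms) => w _; exact: c.
- exact: nearW.
- move=> N w; apply: PM => k; exact: (@measurable_step_path N (ee k \o be w)).
- exact: integrable_cst.
Qed.

(** The sampled means agree for every [N], and both sides converge since paths are continuous and
    the functional is bounded. *)
Lemma markov_increments :
  \int[P]_v path_functional (fun q => x + (Bc (s + q) v - Bc 0 v)) =
  \int[fresh_law]_z path_functional (fun q => x + (z.1 + Bc q z.2 - Bc 0 z.2)).
Proof.
have cB v : continuous (Bc ^~ v) by exact: (continuous_Bc T0 BB).
have h1 : \int[P]_v sampled N (fun q => x + (Bc (s + q) v - Bc 0 v)) @[N --> \oo] -->
    \int[P]_v path_functional (fun q => x + (Bc (s + q) v - Bc 0 v)).
  apply: (cvg_sampled_mean (be := fun v q => x + (Bc (s + q) v - Bc 0 v))) => [v q|N].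
    apply: cvgD; first exact: cvg_cst.
    apply: cvgB; last exact: cvg_cst.
    have c : s + y @[y --> q] --> s + q by apply: cvgD; [exact: cvg_cst|exact: cvg_id].
    exact: (cvg_comp _ _ c (@cB v _)).
  under eq_fun do rewrite -tuple_functional_after.
  have m : measurable_fun setT (after_increments N) by exact: (measurable_bm_increments T0 GF BB).
  have mt := @measurable_tuple_functional N x.
  exact: (measurableT_comp mt m).
have h2 : \int[fresh_law]_z
    sampled N (fun q => x + (z.1 + Bc q z.2 - Bc 0 z.2)) @[N --> \oo] -->
  \int[fresh_law]_z path_functional (fun q => x + (z.1 + Bc q z.2 - Bc 0 z.2)).
  apply: (@cvg_sampled_mean _ _ fresh_law (fun z q => x + (z.1 + Bc q z.2 - Bc 0 z.2))) => [z q|N].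
    apply: cvgD; first exact: cvg_cst.
    apply: cvgB; last exact: cvg_cst.
    by apply: cvgD; [exact: cvg_cst|exact: cB].
  under eq_fun do rewrite -tuple_functional_fresh.
  have mt := @measurable_tuple_functional N x.
  exact: (measurableT_comp mt (@measurable_fresh N)).
have E : (fun N => \int[P]_v sampled N (fun q => x + (Bc (s + q) v - Bc 0 v))) =
  (fun N => \int[fresh_law]_z sampled N (fun q => x + (z.1 + Bc q z.2 - Bc 0 z.2))).
  by apply/funext => N; exact: markov_sampled.
rewrite E in h1.
by rewrite -(cvg_lim _ h1)// -(cvg_lim _ h2).
Qed.

End markov.

End sampled_functional.

Lemma Rint_shift (R : realType) (c : R) (f : R -> R) : measurable_fun setT f ->
  \int[lebesgue_measure]_x f (x + c) = \int[lebesgue_measure]_x f x.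
Proof.
move=> mf; have mf' : measurable_fun setT (EFin \o f) by exact/measurable_EFinP.
by congr fine; exact: (integral_shift c mf').
Qed.

Lemma Rint_reflect (R : realType) (c : R) (f : R -> R) : measurable_fun setT f ->
  \int[lebesgue_measure]_x f (c - x) = \int[lebesgue_measure]_x f x.
Proof.
move=> mf; have mf' : measurable_fun setT (EFin \o f) by exact/measurable_EFinP.
by congr fine; exact: (integral_reflect c mf').
Qed.

Lemma Rint_ae_eq d (T : measurableType d) (R : realType) (mu : {measure set T -> \bar R}) (f g : T -> R) :
  measurable_fun setT f -> measurable_fun setT g -> {ae mu, forall w, f w = g w} ->
  \int[mu]_w f w = \int[mu]_w g w.
Proof.
move=> mf mg fg; congr fine; apply: ae_eq_integral => //; [exact/measurable_EFinP..|].
by apply: filterS fg => w -> _.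
Qed.

(** * The heat kernel as a Gaussian density *)

Section normal_heat.
Context (R : realType).
Local Notation leb := (@lebesgue_measure R).

Lemma heat_kernelE (s z : R) : 0 < s -> heat_kernel s z = normal_pdf 0 (Num.sqrt s) z.
Proof.
move=> s0; have sn : Num.sqrt s != 0 by rewrite gt_eqF// sqrtr_gt0.
rewrite normal_pdfE// /heat_kernel /normal_peak /normal_fun subr0 sqr_sqrtr ?ltW//.
have -> : 2 * pi * s = s * pi *+ 2 by rewrite -mulr_natr; ring.
by have -> : 2 * s = s *+ 2 by rewrite -mulr_natr; ring.
Qed.

Lemma heat_kernel_ge0 (s z : R) : 0 <= heat_kernel s z.
Proof. by rewrite /heat_kernel mulr_ge0 ?expR_ge0// invr_ge0 sqrtr_ge0. Qed.

Lemma heat_kernelN (s z : R) : heat_kernel s (- z) = heat_kernel s z.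
Proof. by rewrite /heat_kernel sqrrN. Qed.

Lemma measurable_heat (s x : R) : measurable_fun setT (fun y : R => heat_kernel s (x - y)).
Proof.
apply: measurable_funM => //; apply: measurableT_comp => //; apply: measurable_funM => //.
by apply: measurable_funN; apply: measurable_funX; exact: measurable_funB.
Qed.

Lemma integrable_heat (s x : R) : 0 < s -> leb.-integrable setT (EFin \o (fun y : R => heat_kernel s (x - y))).
Proof.
move=> s0; have sn : Num.sqrt s != 0 by rewrite gt_eqF// sqrtr_gt0.
have /integrableP[_ fin] := @integrable_normal_pdf R 0 (Num.sqrt s).
apply/integrableP; split; first by apply/measurable_EFinP; exact: measurable_heat.
under eq_integral do rewrite /= heat_kernelE//.
have mp : measurable_fun setT (fun y => `|(normal_pdf 0 (Num.sqrt s) y)%:E|%E).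
  by apply: measurableT_comp => //; apply/measurable_EFinP; exact: measurable_normal_pdf.
by rewrite (integral_reflect x mp).
Qed.

Lemma normal_heat_ge0 (s x : R) (h : R -> R) : 0 < s -> measurable_fun setT h ->
  (forall z, 0 <= h z) ->
  \int[normal_prob 0 (Num.sqrt s)]_z h (x + z) = \int[leb]_y (heat_kernel s (x - y) * h y).
Proof.
move=> s0 mh h0.
have mh' : measurable_fun setT (EFin \o (fun z => h (x + z))).
  by apply/measurable_EFinP; apply: (measurableT_comp mh); exact: measurable_funD.
have -> : \int[normal_prob 0 (Num.sqrt s)]_z h (x + z) =
    \int[leb]_z (h (x + z) * normal_pdf 0 (Num.sqrt s) z).
  congr fine; rewrite ge0_integral_normal//.
  by move=> z; rewrite lee_fin.
rewrite -(@Rint_shift R x (fun y => heat_kernel s (x - y) * h y)); last by apply: measurable_funM => //; exact: measurable_heat.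
apply: eq_Rintegral => z _.
by rewrite opprD addrCA subrr addr0 heat_kernelN heat_kernelE// mulrC addrC.
Qed.

Lemma normal_heat (s x : R) (h : R -> R) (M : R) : 0 < s -> measurable_fun setT h ->
  (forall z, `|h z| <= M) ->
  \int[normal_prob 0 (Num.sqrt s)]_z h (x + z) = \int[leb]_y (heat_kernel s (x - y) * h y).
Proof.
move=> s0 mh hM; have M0 : 0 <= M by exact: le_trans (normr_ge0 _) (hM 0).
have ih : leb.-integrable setT (EFin \o (fun y => heat_kernel s (x - y) * h y)).
  apply: (@integrable_le _ _ _ leb _ (fun y => M * heat_kernel s (x - y))).
  - by apply: measurable_funM => //; exact: measurable_heat.
  - by move=> y; rewrite normrM mulrC (ger0_norm (heat_kernel_ge0 _ _)) ler_wpM2r// heat_kernel_ge0.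
  - by apply: RintegrableZ; exact: integrable_heat.
have in_ : (normal_prob 0 (Num.sqrt s)).-integrable setT (EFin \o (fun z => h (x + z))).
  apply: (@integrable_le _ _ _ (normal_prob 0 (Num.sqrt s)) _ (cst M)) => //; last exact: integrable_cst.
  by apply: (measurableT_comp mh); exact: measurable_funD.
have hM0 y : 0 <= h y + M by have := hM y; rewrite ler_norml => /andP[]; lra.
have := normal_heat_ge0 x s0 (measurable_funD mh (measurable_cst M)) hM0.
have := normal_heat_ge0 x s0 (measurable_cst M) (fun=> M0).
rewrite !Rintegral_cst_prob => EM.
rewrite RintegralD//; last exact: integrable_cst.
under [in X in _ = X -> _]eq_Rintegral do rewrite mulrDr.
rewrite RintegralD//; first by rewrite Rintegral_cst_prob -EM => /addIr.
by under eq_fun do rewrite mulrC; apply: RintegrableZ; exact: integrable_heat.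
Qed.

End normal_heat.

Section primitive_shift.
Context (R : realType).
Local Notation leb := (@lebesgue_measure R).

Lemma primitive_shift (th : R -> R) (C s rho : R) : continuous th ->
  (forall q, `|th q| <= C) -> 0 <= s -> 0 <= rho ->
  primitive th (s + rho) - primitive th s =
  \int[leb]_(q in `[0, rho]) th (s + q).
Proof.
move=> cth thC s0 r0; rewrite /primitive Rintegral_itvB ?bnd_simp//; last 2 first.
- exact: integrable_th cth thC _ _.
- by rewrite lerDl.
have mth := measurable_th cth.
rewrite -Rintegral_itv_obnd_cbnd; last first.
  apply: (@integrableS _ _ _ leb `[0, rho]) => //; first exact: subset_itv_oc_cc.
  apply: (@integrable_bounded_itv _ _ _ (fun q => th (s + q)) C) => //.
  by apply: (measurableT_comp mth); exact: measurable_funD.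
rewrite [LHS]Rintegral_mkcond [RHS]Rintegral_mkcond.
rewrite -(@Rint_shift R s (th \_ `]s, s + rho])); last first.
  by apply/(measurable_restrictT _ (measurable_itv _)); apply: measurable_funTS.
apply: eq_Rintegral => q _; rewrite !patchE !mem_setE !in_itv/= addrC.
by rewrite -(ltrD2l s 0) addr0 lerD2l.
Qed.

End primitive_shift.

(** * The Markov property for occupation functionals *)

Section markov.
Context (R : realType) (K : nat).
Local Notation leb := (@lebesgue_measure R).
Variables (ee : 'I_K -> R -> R) (C : R) (g1 u0 : R -> R) (Psi : ('I_K -> R) -> R) (M1 M2 : R).
Hypotheses (cee : forall k, continuous (ee k)) (eeC : forall k z, `|ee k z| <= C) (C0 : 0 <= C).
Hypotheses (mg1 : measurable_fun setT g1) (g1M : forall z, `|g1 z| <= M1).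
Hypotheses (mu0 : measurable_fun setT u0) (u0M : forall z, `|u0 z| <= M2).
Hypothesis Psi_bound : forall A, 0 <= A -> exists2 M, 0 <= M &
  forall a : 'I_K -> R, (forall k, `|a k| <= A) -> `|Psi a| <= M.
Hypothesis Psi_cvg : forall A (a_ : nat -> 'I_K -> R) a, 0 <= A ->
  (forall k i, `|a_ k i| <= A) -> (forall i, a_ k i @[k --> \oo] --> a i) ->
  Psi (a_ k) @[k --> \oo] --> Psi a.
Context d (Om : measurableType d) (P : probability Om R) (T : R).
Variables (G : R -> set (set Om)) (B : R -> Om -> R).
Hypotheses (T0 : 0 <= T) (GF : filtration T G) (BB : brownian P T G B).
Local Notation Bc := (Bc T B).

Definition along (y : R) (v : Om) (k : 'I_K) (q : R) : R := ee k (y + Bc q v).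

Lemma continuous_along y v k : continuous (along y v k).
Proof.
move=> q; have cB := @continuous_Bc _ _ _ _ _ _ _ T0 BB v.
have c : y + Bc r v @[r --> q] --> y + Bc q v by apply: cvgD; [exact: cvg_cst|exact: cB].
exact: (cvg_comp _ _ c (@cee k _)).
Qed.

(** When [g] is the shifted mean of a functional of [W], this is the [W]-expectation of the field at
    [(r, y)] times that functional; see [field_smooth]. *)
Definition path_mean (g : ('I_K -> R) -> R) (r y : R) : R :=
  \int[P]_v (u0 (y + Bc r v) * g (fun k => primitive (along y v k) r)).

(** The moving upper limit is encoded in the indicator of a fixed measurable set of pairs, so that
    the integral becomes a parametrised one over the whole line. *)
Lemma measurable_along_primitive k :
  measurable_fun setT (fun z : (R * R) * Om => primitive (along z.1.2 z.2 k) z.1.1).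
Proof.
rewrite (_ : (fun z => _) = (fun z : (R * R) * Om => \int[leb]_q
   (\1_[set u : R * R | 0 <= u.2 <= u.1] (z.1.1, q) * ee k (z.1.2 + Bc q z.2)))); last first.
  apply/funext => z; rewrite /primitive Rintegral_mkcond; apply: eq_Rintegral => q _.
  rewrite patchE indicE mem_setE in_itv/=.
  have -> : ((z.1.1, q) \in [set u : R * R | 0 <= u.2 <= u.1]) = (0 <= q <= z.1.1).
    by apply/idP/idP; rewrite inE.
  by case: (0 <= q <= _); rewrite ?mul1r ?mul0r.
apply: (@measurable_Rint1 _ _ _ _ _ leb (fun z : ((R * R) * Om) * R =>
  (\1_[set u : R * R | 0 <= u.2 <= u.1] (z.1.1.1, z.2) * ee k (z.1.1.2 + Bc z.2 z.1.2)))).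
have m1 : measurable_fun setT (fun z : ((R * R) * Om) * R => z.1.1.1).
  exact: (measurableT_comp measurable_fst (measurableT_comp measurable_fst measurable_fst)).
have m2 : measurable_fun setT (fun z : ((R * R) * Om) * R => z.1.1.2).
  exact: (measurableT_comp measurable_snd (measurableT_comp measurable_fst measurable_fst)).
have m3 : measurable_fun setT (fun z : ((R * R) * Om) * R => z.1.2).
  exact: (measurableT_comp measurable_snd measurable_fst).
apply: measurable_funM.
  have mS : measurable [set u : R * R | 0 <= u.2 <= u.1].
    rewrite (_ : [set u | _] = [set u : R * R | 0 <= u.2] `&` [set u : R * R | u.2 <= u.1]).
      apply: measurableI; rewrite -[X in measurable X]setTI.
      - apply: (measurable_fun_le (f := cst 0) (g := fun u : R * R => u.2)) => //; exact: measurable_snd.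
      - apply: (measurable_fun_le (f := fun u : R * R => u.2) (g := fun u : R * R => u.1)) => //; [exact: measurable_snd|exact: measurable_fst].
    by apply/seteqP; split => u /=; [move/andP|move=> [-> ->]].
  apply: (measurableT_comp (measurable_indic mS)).
  by apply/measurable_fun_pairP; split => //; exact: measurable_snd.
have mk : measurable_fun setT (ee k) by apply: continuous_measurable_fun; exact: cee.
apply: (measurableT_comp mk); apply: measurable_funD => //.
have mz : measurable_fun setT (fun z : ((R * R) * Om) * R => (z.2, z.1.2)).
  by apply/measurable_fun_pairP; split => //; exact: measurable_snd.
exact: (measurableT_comp (measurable_Bc_pair T0 GF BB) mz).
Qed.

Lemma measurable_path_mean_integrand : measurable_fun setT (fun z : (R * R) * Om =>
  u0 (z.1.2 + Bc z.1.1 z.2) * Psi (fun k => primitive (along z.1.2 z.2 k) z.1.1)).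
Proof.
apply: measurable_funM.
  apply: (measurableT_comp mu0); apply: measurable_funD.
    exact: (measurableT_comp measurable_snd measurable_fst).
  have mz : measurable_fun setT (fun z : (R * R) * Om => (z.1.1, z.2)).
    apply/measurable_fun_pairP; split; last exact: measurable_snd.
    exact: (measurableT_comp measurable_fst measurable_fst).
  exact: (measurableT_comp (measurable_Bc_pair T0 GF BB) mz).
apply: (measurable_Psi Psi_cvg) => k; exact: measurable_along_primitive.
Qed.

Lemma measurable_path_mean : measurable_fun setT (fun z : R * R => path_mean Psi z.1 z.2).
Proof. exact: (measurable_Rint1 P measurable_path_mean_integrand). Qed.

Lemma measurable_path_mean_space r : measurable_fun setT (path_mean Psi r).
Proof.
have m : measurable_fun setT (fun y : R => (r, y)) by exact: measurable_pair1.
exact: (measurableT_comp measurable_path_mean m).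
Qed.

Lemma path_integrand_bound A : 0 <= A -> exists2 M, 0 <= M & forall r y v, 0 <= r <= A ->
  `|u0 (y + Bc r v) * Psi (fun k => primitive (along y v k) r)| <= M.
Proof.
move=> A0; have CA : 0 <= C * A by rewrite mulr_ge0.
have [M M0 PM] := Psi_bound CA; have M20 : 0 <= M2 by exact: le_trans (normr_ge0 _) (u0M 0).
exists (M2 * M) => [|r y v /andP[r0 rA]]; first by rewrite mulr_ge0.
rewrite normrM ler_pM//; apply: PM => k.
apply: (@le_trans _ _ (C * r)); last by rewrite ler_wpM2l.
by apply: primitive_bound => //; [exact: continuous_along|move=> q; exact: eeC].
Qed.

Lemma integrable_path_integrand r y : 0 <= r -> P.-integrable setT
  (EFin \o (fun v => u0 (y + Bc r v) * Psi (fun k => primitive (along y v k) r))).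
Proof.
move=> r0; have [M M0 PM] := path_integrand_bound r0.
apply: (@integrable_le _ _ _ P _ (cst M)) => //; last exact: integrable_cst.
  have m : measurable_fun setT (fun v : Om => ((r, y), v)) by exact: measurable_pair1.
  exact: (measurableT_comp measurable_path_mean_integrand m).
by move=> v; apply: PM; rewrite lexx r0.
Qed.

Lemma path_mean_bound A : 0 <= A -> exists2 M, 0 <= M & forall r y, 0 <= r <= A ->
  `|path_mean Psi r y| <= M.
Proof.
move=> A0; have [M M0 PM] := path_integrand_bound A0.
exists M => // r y rA; have /andP[r0 _] := rA.
apply: le_trans (ler_norm_Rint (integrable_path_integrand y r0)) _.
rewrite -(Rintegral_cst_prob P M); apply: Rintegral_le => [v|//|]; [exact: PM| |exact: integrable_cst].
exact/Rintegrable_norm/integrable_path_integrand.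
Qed.

(** The comparison of increments concerns [B - B_0], and [B] starts at 0 only almost surely, hence
    the two passages by almost everywhere equality. On [fresh_law], integrating the fresh path first
    produces [path_mean], and the Gaussian position at time [s] then produces the heat kernel. *)
Lemma markov_property (x s rho : R) : 0 < s -> 0 < rho -> s + rho <= T ->
  \int[P]_v (g1 (x + Bc s v) * u0 (x + Bc (s + rho) v) *
    Psi (fun k => primitive (along x v k) (s + rho) - primitive (along x v k) s)) =
  \int[leb]_y (heat_kernel s (x - y) * (g1 y * path_mean Psi rho y)).
Proof.
move=> s0 r0 srT.
have cB v : continuous (Bc ^~ v) by exact: (continuous_Bc T0 BB).
have mB q : measurable_fun setT (Bc q) by exact: (measurable_Bc T0 GF BB).
pose F := path_functional ee g1 u0 Psi rho.
have mF d' (T' : measurableType d') (be : T' -> R -> R) := @measurable_path_functional R K ee g1 u0 Psi cee mg1 mu0 Psi_cvg rho d' T' be.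
transitivity (\int[P]_v F (fun q => x + (Bc (s + q) v - Bc 0 v))).
  transitivity (\int[P]_v F (fun q => x + Bc (s + q) v)).
    apply: eq_Rintegral => v _; rewrite /F /path_functional addr0; congr (_ * Psi _).
    apply/funext => k; rewrite (@primitive_shift R _ C)// ?ltW//; first exact: continuous_along.
    by move=> q; exact: eeC.
  apply: Rint_ae_eq.
  - apply: mF => [q|v q]; first exact: measurable_funD.
    apply: cvgD; first exact: cvg_cst.
    have c : s + y @[y --> q] --> s + q by apply: cvgD; [exact: cvg_cst|exact: cvg_id].
    exact: (cvg_comp _ _ c (@cB v _)).
  - apply: mF => [q|v q]; first by apply: measurable_funD => //; exact: measurable_funB.
    apply: cvgD; first exact: cvg_cst.
    apply: cvgB; last exact: cvg_cst.
    have c : s + y @[y --> q] --> s + q by apply: cvgD; [exact: cvg_cst|exact: cvg_id].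
    exact: (cvg_comp _ _ c (@cB v _)).
  - by apply: filterS (Bc0 T0 BB) => v ->; congr F; apply/funext => q; rewrite subr0.
rewrite (markov_increments cee eeC C0 mg1 g1M mu0 u0M Psi_bound Psi_cvg r0 T0 GF BB _ s0 srT).
have [M M0 PM] := path_functional_bound eeC C0 g1M u0M Psi_bound r0.
have mF' : measurable_fun setT (fun z : measurableTypeR R * Om => F (fun q => x + (z.1 + Bc q z.2 - Bc 0 z.2))).
  apply: mF => [q|z q].
    apply: measurable_funD => //; apply: measurable_funB; last exact: (measurableT_comp (mB 0) measurable_snd).
    by apply: measurable_funD; [exact: measurable_fst|exact: (measurableT_comp (mB q) measurable_snd)].
  apply: cvgD; first exact: cvg_cst.
  apply: cvgB; last exact: cvg_cst.
  by apply: cvgD; [exact: cvg_cst|exact: cB].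
have iF : (fresh_law P s).-integrable setT
    (EFin \o (fun z : measurableTypeR R * Om => F (fun q => x + (z.1 + Bc q z.2 - Bc 0 z.2)))).
  apply: (@integrable_le _ _ _ (fresh_law P s) _ (cst M)) => //; last exact: integrable_cst.
  move=> z; apply: PM => k; apply: continuous_measurable_fun => q.
  have c : x + (z.1 + Bc r z.2 - Bc 0 z.2) @[r --> q] --> x + (z.1 + Bc q z.2 - Bc 0 z.2).
    apply: cvgD; first exact: cvg_cst.
    apply: cvgB; last exact: cvg_cst.
    by apply: cvgD; [exact: cvg_cst|exact: cB].
  exact: (cvg_comp _ _ c (@cee k _)).
have [_ E] := @Rfubini1 _ _ _ _ _ (normal_prob 0 (Num.sqrt s)) P _ iF.
rewrite -/F; apply: etrans (esym E) _.
have mpm := measurable_path_mean_space rho.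
have [Ap Ap0 pmA] := path_mean_bound (ltW r0).
rewrite -(@normal_heat R s x (fun y => g1 y * path_mean Psi rho y) (M1 * Ap))//; last 2 first.
- exact: measurable_funM.
- by move=> z; rewrite normrM ler_pM// pmA// lexx ltW.
apply: eq_Rintegral => z _ /=.
rewrite /path_mean -RintegralZl//; last exact/integrable_path_integrand/ltW.
have mbe (q : R) : measurable_fun setT (fun v : Om => x + (z + Bc q v - Bc 0 v)).
  by apply: measurable_funD => //; apply: measurable_funB => //; exact: measurable_funD.
apply: Rint_ae_eq.
- apply: mF => // v q; apply: cvgD; first exact: cvg_cst.
  apply: cvgB; last exact: cvg_cst.
  by apply: cvgD; [exact: cvg_cst|exact: cB].
- apply: measurable_funM => //.
  have m : measurable_fun setT (fun v : Om => ((rho, x + z), v)) by exact: measurable_pair1.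
  exact: (measurableT_comp measurable_path_mean_integrand m).
- apply: filterS (Bc0 T0 BB) => v B0; rewrite /F /path_functional B0 !subr0 !addr0 !addrA mulrA.
  congr (_ * Psi _); apply/funext => k; apply: eq_Rintegral => q _.
  by rewrite /along subr0 addrA.
Qed.

End markov.

Lemma ae_neq2 (R : realType) (a b : R) : {ae @lebesgue_measure R, forall s, s != a /\ s != b}.
Proof.
exists ([set a] `|` [set b]); split.
- exact: measurableU.
- by rewrite measureU0//; exact: lebesgue_measure_set1.
- move=> s /= h; have [->|sa] := eqVneq s a; first by left.
  by right; apply/eqP/negPn/negP => sb; exact: h.
Qed.

Lemma aeS_leb (R : realType) (P Q : R -> Prop) : (forall s, P s -> Q s) ->
  {ae @lebesgue_measure R, forall s, P s} -> {ae @lebesgue_measure R, forall s, Q s}.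
Proof. by move=> PQ; apply: negligibleS => s /= Qs /PQ. Qed.

(** Writing [y^-1 = y * (y ^+ 2)^-1] leaves a real power of a nonnegative number; at [y = 0] both
    sides are 0. *)
Lemma measurable_inv (R : realType) : measurable_fun setT (@GRing.inv R).
Proof.
rewrite (_ : @GRing.inv R = fun y => y * (y ^+ 2) `^ (-1)).
  apply: measurable_funM => //; apply: (measurableT_comp (measurable_powR (-1))).
  exact: measurable_funX.
apply/funext => y; rewrite powR_inv1 ?sqr_ge0//.
have [->|y0] := eqVneq y 0; first by rewrite invr0 mul0r.
by field.
Qed.

Section heat_law.
Context (R : realType).
Local Notation leb := (@lebesgue_measure R).
Context d (Om : measurableType d) (P : probability Om R) (T : R).
Variables (G : R -> set (set Om)) (B : R -> Om -> R).
Hypotheses (T0 : 0 <= T) (GF : filtration T G) (BB : brownian P T G B).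
Variables (u0 : R -> R) (M : R).
Hypotheses (mu0 : measurable_fun setT u0) (u0M : forall z, `|u0 z| <= M).
Local Notation Bc := (Bc T B).

Lemma heat_law (t x : R) : 0 <= t <= T ->
  \int[P]_v u0 (x + Bc t v) = heat_semigroup t u0 x.
Proof.
move=> /andP[t0 tT]; have mB q : measurable_fun setT (Bc q) by exact: (measurable_Bc T0 GF BB).
have m1 q : measurable_fun setT (fun v => u0 (x + Bc q v)).
  by apply: (measurableT_comp mu0); exact: measurable_funD.
rewrite /heat_semigroup; have [->|tn] := eqVneq t 0.
  rewrite -(Rintegral_cst_prob P (u0 x)); apply: Rint_ae_eq => //.
  by apply: filterS (Bc0 T0 BB) => v ->; rewrite addr0.
have {}t0 : 0 < t by rewrite lt0r tn.
rewrite -(@normal_heat R t x u0 M)//.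
pose tau (i : nat) : R := if i is 0%N then 0 else t.
pose X2 (z : measurableTypeR R) : 1.-tuple R := [tuple z | i < 1].
transitivity (\int[P]_v u0 (x + (Bc t v - Bc 0 v))).
  apply: Rint_ae_eq => //.
    by apply: (measurableT_comp mu0); apply: measurable_funD => //; exact: measurable_funB.
  by apply: filterS (Bc0 T0 BB) => v ->; rewrite subr0.
have mX1 := measurable_bm_increments T0 GF BB (n := 1) tau.
have mX2 : measurable_fun setT X2 by apply: measurable_mktuple.
have mt : measurable_fun setT (fun s : 1.-tuple R => u0 (x + tnth s ord0)).
  by apply: (measurableT_comp mu0); apply: measurable_funD => //; exact: measurable_tnth.
have := @tuple_law_bounded _ _ _ _ _ _ P (normal_prob 0 (Num.sqrt t)) _ X2
  (fun s => u0 (x + tnth s ord0)) M mX1 mX2 _ mt (fun=> u0M _).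
under eq_Rintegral do rewrite tnth_mktuple.
under [X in (_ -> _ = X) -> _]eq_Rintegral do rewrite tnth_mktuple.
apply => A mA; rewrite (bm_increments_law GF BB)//=; last by move=> [].
rewrite big_ord1 subr0; congr (normal_prob _ _ _); apply/seteqP; split => z /=.
  by move=> Az i; rewrite tnth_mktuple ord1.
by move/(_ ord0); rewrite tnth_mktuple.
Qed.

End heat_law.

(** * Duhamel's formula for path means *)

Section duhamel_smooth.
Context (R : realType) (K : nat).
Local Notation leb := (@lebesgue_measure R).
Variables (ee : 'I_K -> R -> R) (C : R) (u0 : R -> R) (M2 : R).
Hypotheses (cee : forall k, continuous (ee k)) (eeC : forall k z, `|ee k z| <= C) (C0 : 0 <= C).
Hypotheses (mu0 : measurable_fun setT u0) (u0M : forall z, `|u0 z| <= M2).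
Variables (Psi0 : ('I_K -> R) -> R) (Psi : 'I_K -> ('I_K -> R) -> R).
Hypothesis Psi0_bound : forall A, 0 <= A -> exists2 M, 0 <= M &
  forall a : 'I_K -> R, (forall k, `|a k| <= A) -> `|Psi0 a| <= M.
Hypothesis Psi0_cvg : forall A (a_ : nat -> 'I_K -> R) a, 0 <= A ->
  (forall k i, `|a_ k i| <= A) -> (forall i, a_ k i @[k --> \oo] --> a i) ->
  Psi0 (a_ k) @[k --> \oo] --> Psi0 a.
Hypothesis Psi_bound : forall j A, 0 <= A -> exists2 M, 0 <= M &
  forall a : 'I_K -> R, (forall k, `|a k| <= A) -> `|Psi j a| <= M.
Hypothesis Psi_cvg : forall j A (a_ : nat -> 'I_K -> R) a, 0 <= A ->
  (forall k i, `|a_ k i| <= A) -> (forall i, a_ k i @[k --> \oo] --> a i) ->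
  Psi j (a_ k) @[k --> \oo] --> Psi j a.
(** The only link between [Psi0] and its directional derivatives [Psi j]. It is all that the formula
    retains of [W], and [smooth_mean_diff] provides it. *)
Hypothesis Psi_diff : forall (th : 'I_K -> R -> R) (t : R), (forall j, continuous (th j)) ->
  (forall j s, `|th j s| <= C) -> 0 <= t ->
  Psi0 (remaining th t 0) - Psi0 (fun=> 0) =
  \int[leb]_(s in `[0, t]) \sum_j th j s * Psi j (remaining th t s).
Context d (Om : measurableType d) (P : probability Om R) (T : R).
Variables (G : R -> set (set Om)) (B : R -> Om -> R).
Hypotheses (T0 : 0 <= T) (GF : filtration T G) (BB : brownian P T G B).
Local Notation Bc := (Bc T B).
Local Notation along := (along ee T B).
Local Notation path_mean := (path_mean ee u0 P T B).
Variables (t x : R).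
Hypothesis tT : 0 <= t <= T.

(** [r] is the time run by the heat kernel and [s] that of the mean. They are kept apart because the
    path gives [(s, t - s)] and the Duhamel term [(t - s, s)]. *)
Definition heat_source (j : 'I_K) (r s : R) : R :=
  \int[leb]_y (heat_kernel r (x - y) * (ee j y * path_mean (Psi j) s y)).

Lemma measurable_heat_pair : measurable_fun setT (fun z : R * R => heat_kernel z.1 (x - z.2)).
Proof.
have mi := @measurable_inv R.
have m1 (c : R) : measurable_fun setT (fun z : R * R => c * z.1).
  by apply: measurable_funM => //; exact: measurable_fst.
apply: measurable_funM.
  apply: (measurableT_comp mi).
  have ms : measurable_fun setT (@Num.sqrt R) by apply: continuous_measurable_fun; exact: sqrt_continuous.
  exact: (measurableT_comp ms).
apply: measurableT_comp => //; apply: measurable_funM; last exact: (measurableT_comp mi).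
by apply: measurable_funN; apply: measurable_funX; apply: measurable_funB => //; exact: measurable_snd.
Qed.

Lemma measurable_heat_source j (r s : R -> R) : measurable_fun setT r -> measurable_fun setT s ->
  measurable_fun setT (fun q => heat_source j (r q) (s q)).
Proof.
move=> mr ms.
apply: (@measurable_Rint1 _ _ _ _ _ leb (fun z : R * R => heat_kernel (r z.1) (x - z.2) *
  (ee j z.2 * path_mean (Psi j) (s z.1) z.2))).
have mk : measurable_fun setT (ee j) by apply: continuous_measurable_fun; exact: cee.
have m1 (g : R -> R) : measurable_fun setT g -> measurable_fun setT (fun z : R * R => (g z.1, z.2)).
  by move=> mg; apply/measurable_fun_pairP; split => /=; [exact: (measurableT_comp mg measurable_fst)|exact: measurable_snd].
apply: measurable_funM; first exact: (measurableT_comp measurable_heat_pair (m1 _ mr)).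
apply: measurable_funM; first exact: (measurableT_comp mk measurable_snd).
have mp := measurable_path_mean cee mu0 (@Psi_cvg j) T0 GF BB.
exact: (measurableT_comp mp (m1 _ ms)).
Qed.

Lemma mean_source j (s : R) : 0 < s -> s < t ->
  \int[P]_v (along x v j s * u0 (x + Bc t v) * Psi j (remaining (along x v) t s)) =
  heat_source j s (t - s).
Proof.
move=> s0 st; have /andP[t0 tleT] := tT.
have ts : s + (t - s) = t by lra.
have ts0 : 0 < t - s by lra.
have tsT : s + (t - s) <= T by rewrite ts.
have mk : measurable_fun setT (ee j) by apply: continuous_measurable_fun; exact: cee.
have := @markov_property R K ee C (ee j) u0 (Psi j) C M2 cee eeC C0 mk (eeC j) mu0 u0M
  (@Psi_bound j) (@Psi_cvg j) _ _ P T G B T0 GF BB x s (t - s) s0 ts0 tsT.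
by rewrite ts.
Qed.

Lemma duhamel_smooth :
  path_mean Psi0 t x - heat_semigroup t u0 x * Psi0 (fun=> 0) =
  \sum_j \int[leb]_(s in `[0, t]) heat_source j (t - s) s.
Proof.
have /andP[t0 tleT] := tT.
have cth v j : continuous (along x v j) by exact: (continuous_along cee T0 BB).
have thC v j s : `|along x v j s| <= C by exact: eeC.
have mB q : measurable_fun setT (Bc q) by exact: (measurable_Bc T0 GF BB).
have mu : measurable_fun setT (fun v => u0 (x + Bc t v)).
  by apply: (measurableT_comp mu0); exact: measurable_funD.
have iu : P.-integrable setT (EFin \o (fun v => u0 (x + Bc t v))).
  by apply: (@integrable_le _ _ _ P _ (cst M2)) => //; exact: integrable_cst.
(* The indicator extends the time integral to the line, and [u0] is split off in [H] because it does
   not depend on the time variable. *)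
pose H0 j (z : R * Om) := \1_(`[0, t]%classic : set R) z.1 *
  (along x z.2 j z.1 * Psi j (remaining (along x z.2) t z.1)).
pose H j (z : R * Om) := u0 (x + Bc t z.2) * H0 j z.
have mH0 j : measurable_fun setT (H0 j).
  have mk : measurable_fun setT (ee j) by apply: continuous_measurable_fun; exact: cee.
  have m1 : measurable_fun setT (fun z : R * Om => \1_(`[0, t]%classic : set R) z.1 : R).
    have mI : measurable_fun setT (\1_(`[0, t]%classic : set R) : R -> R).
      by apply: measurable_indic; exact: measurable_itv.
    exact: (measurableT_comp mI measurable_fst).
  apply: (measurable_funM m1).
  apply: measurable_funM.
    apply: (measurableT_comp mk); apply: measurable_funD => //.
    exact: (measurable_Bc_pair T0 GF BB).
  apply: (measurable_Psi (@Psi_cvg j)) => k; apply: measurable_funB.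
    have mz : measurable_fun setT (fun z : R * Om => ((t, x), z.2)).
      by apply/measurable_fun_pairP; split; [exact: measurable_cst|exact: measurable_snd].
    exact: (measurableT_comp (measurable_along_primitive cee T0 GF BB k) mz).
  have mz : measurable_fun setT (fun z : R * Om => ((z.1, x), z.2)).
    apply/measurable_fun_pairP; split; last exact: measurable_snd.
    by apply/measurable_fun_pairP; split; [exact: measurable_fst|exact: measurable_cst].
  exact: (measurableT_comp (measurable_along_primitive cee T0 GF BB k) mz).
have H0M j : exists2 M, 0 <= M & forall s v, `|H0 j (s, v)| <= M * \1_(`[0, t]%classic : set R) s.
  have Ct0 : 0 <= C * t by rewrite mulr_ge0.
  have [M M0 PM] := @Psi_bound j _ Ct0; exists (C * M); first by rewrite mulr_ge0.
  move=> s v; rewrite /H0 indicE; have [sI|sI] := boolP (s \in _); last by rewrite mul0r mulr0 normr0.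
  rewrite mul1r mulr1 normrM; apply: ler_pM => //.
  apply: PM => k; apply: (remaining_bound (C := C)) => //.
  by move: sI; rewrite inE/= in_itv.
have iH0 j v : leb.-integrable setT (EFin \o (fun s => H0 j (s, v))).
  have [M M0 HM] := H0M j.
  apply: (@integrable_le _ _ _ leb _ (fun s => M * \1_(`[0, t]%classic : set R) s)) => //.
    have mz : measurable_fun setT (fun s : R => (s, v)) by exact: measurable_pair2.
    exact: (measurableT_comp (mH0 j) mz).
  by apply: RintegrableZ; exact: integrable_indic_itv.
have iH j : (leb \x P)%E.-integrable setT (EFin \o H j).
  have [M M0 HM] := H0M j.
  apply: (@integrable_prod _ _ _ _ _ leb P _ (fun s => M * \1_(`[0, t]%classic : set R) s) (cst M2)).
  - by apply: measurable_funM; [exact: (measurableT_comp mu measurable_snd)|exact: mH0].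
  - by move=> s v; rewrite normrM mulrC ler_pM.
  - by apply: RintegrableZ; exact: integrable_indic_itv.
  - exact: integrable_cst.
have -> : path_mean Psi0 t x - heat_semigroup t u0 x * Psi0 (fun=> 0) =
    \int[P]_v \sum_j \int[leb]_s H j (s, v).
  rewrite -(heat_law T0 GF BB mu0 u0M x tT) -RintegralZr//.
  rewrite -RintegralB//; last 2 first.
  - exact: (integrable_path_integrand cee eeC C0 mu0 u0M Psi0_bound Psi0_cvg T0 GF BB).
  - by under eq_fun do rewrite mulrC; exact: RintegrableZ.
  apply: eq_Rintegral => v _; rewrite -mulrBr.
  have -> : (fun k => primitive (along x v k) t) = remaining (along x v) t 0.
    by apply/funext => k; rewrite /remaining primitive0 subr0.
  rewrite (Psi_diff (cth v) (thC v) t0) Rintegral_mkcond.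
  under [RHS]eq_bigr => j _ do rewrite /H /= RintegralZl//.
  rewrite -mulr_sumr; congr (_ * _); rewrite -Rintegral_sum//.
  apply: eq_Rintegral => s _; rewrite patchE; case: ifPn => sI; last first.
    by rewrite big1// => j _; rewrite /H0 /= indicE (negbTE sI) mul0r.
  by apply: eq_bigr => j _; rewrite /H0 /= indicE sI mul1r.
rewrite Rintegral_sum; last by move=> j _; exact: (Rfubini2 (iH j)).1.
apply: eq_bigr => j _.
rewrite -(Rfubini (iH j)) [RHS]Rintegral_mkcond.
have mq : measurable_fun setT ((fun s => heat_source j (t - s) s) \_ `[0, t]).
  apply/(measurable_restrictT _ (measurable_itv _)); apply: measurable_funTS.
  apply: measurable_heat_source => //; exact: measurable_funB.
rewrite -(Rint_reflect t mq).
apply: Rint_ae_eq.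
- exact: (Rintegrable_measurable (Rfubini1 (iH j)).1).
- by apply: (measurableT_comp mq); exact: measurable_funB.
(* [markov_property] needs positive durations before and after [s], so the null set of the two end
   times is discarded. *)
apply: (aeS_leb _ (ae_neq2 0 t)) => s [sn0 snt].
rewrite patchE mem_setE in_itv/= subKr subr_ge0 gerBl.
have -> : ((s <= t) && (0 <= s)) = (0 <= s <= t) by rewrite andbC.
rewrite /H /H0 /= indicE mem_setE in_itv/=; case: ifPn => [|_].
  move=> /andP[s0 st]; rewrite -mean_source; last 2 first.
  - by rewrite lt_neqAle s0 eq_sym sn0.
  - by rewrite lt_neqAle st snt.
  by apply: eq_Rintegral => v _; rewrite mul1r; ring.
under eq_Rintegral do rewrite mul0r mulr0.
by rewrite Rintegral_cst_prob.
Qed.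

End duhamel_smooth.

(** * Iterated integrals of square-integrable functions *)

Section ae_le.
Context d (T : measurableType d) (R : realType) (mu : {measure set T -> \bar R}).

Lemma ge0_integrable_le_ae (f g : T -> R) : measurable_fun setT f -> (forall x, 0 <= f x) ->
  (forall x, 0 <= g x) -> {ae mu, forall x, f x <= g x} -> mu.-integrable setT (EFin \o g) ->
  mu.-integrable setT (EFin \o f) /\ \int[mu]_x f x <= \int[mu]_x g x.
Proof.
move=> mf f0 g0 fg ig; have mg := Rintegrable_measurable ig.
have le : (\int[mu]_x (f x)%:E <= \int[mu]_x (g x)%:E)%E.
  apply: ae_ge0_le_integral => //.
  - by move=> x _; rewrite lee_fin.
  - exact/measurable_EFinP.
  - by move=> x _; rewrite lee_fin.
  - exact/measurable_EFinP.
  - by apply: filterS fg => x fgx _; rewrite lee_fin.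
have fi : mu.-integrable setT (EFin \o f).
  apply: integrable_ge0 => //; apply: le_lt_trans le _.
  by rewrite -EFin_Rintegral// ltry.
by split => //; rewrite -lee_fin !EFin_Rintegral.
Qed.

End ae_le.

Section product_L2.
Context d1 d2 (T1 : measurableType d1) (T2 : measurableType d2) (R : realType).
Context (m1 : {sigma_finite_measure set T1 -> \bar R})
        (m2 : {sigma_finite_measure set T2 -> \bar R}).

Lemma integrable_tonelli1 (f : T1 * T2 -> R) (g : T1 -> R) : measurable_fun setT f ->
  {ae m1, forall x, (\int[m2]_y `|f (x, y)|%:E <= (g x)%:E)%E} ->
  m1.-integrable setT (EFin \o g) -> (m1 \x m2)%E.-integrable setT (EFin \o f).
Proof.
move=> mf fg ig; have /integrableP[mg fin] := ig.
have mf' : measurable_fun setT (fun z => `|f z|%:E).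
  by apply/measurable_EFinP; exact: measurableT_comp.
have f0 z : (0 <= `|f z|%:E)%E by rewrite lee_fin.
apply/integrableP; split; first exact/measurable_EFinP.
rewrite (_ : integral _ _ _ = \int[(m1 \x m2)%E]_z `|f z|%:E)%E// fubini_tonelli1//.
apply: le_lt_trans fin; apply: ae_ge0_le_integral => //.
- by move=> x _; apply: integral_ge0.
- exact: measurable_fun_fubini_tonelli_F.
- exact: measurableT_comp.
- by apply: filterS fg => x h _; apply: le_trans h _; rewrite lee_fin ler_norm.
Qed.

(** Suited to the Feynman-Kac density, whose second moment in [w] is controlled for almost every
    path. *)
Lemma sqint_tonelli2 (f : T1 * T2 -> R) (g : T2 -> R) : measurable_fun setT f ->
  {ae m2, forall y, (\int[m1]_x (f (x, y) ^+ 2)%:E <= (g y)%:E)%E} ->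
  (forall y, 0 <= g y) -> m2.-integrable setT (EFin \o g) ->
  sqint (m1 \x m2)%E f /\ \int[(m1 \x m2)%E]_z (f z ^+ 2) <= \int[m2]_y g y.
Proof.
move=> mf fg g0 ig; have mg := Rintegrable_measurable ig.
have mf2 : measurable_fun setT (fun z => (f z ^+ 2)%:E).
  by apply/measurable_EFinP; exact: measurable_funX.
have f0 z : (0 <= (f z ^+ 2)%:E)%E by rewrite lee_fin sqr_ge0.
have le : (\int[(m1 \x m2)%E]_z (f z ^+ 2)%:E <= \int[m2]_y (g y)%:E)%E.
  rewrite fubini_tonelli2//; apply: ae_ge0_le_integral => //.
  - by move=> x _; apply: integral_ge0.
  - exact: measurable_fun_fubini_tonelli_G.
  - by move=> y _; rewrite lee_fin.
  - exact/measurable_EFinP.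
  - by apply: filterS fg => y h _.
have fi : (m1 \x m2)%E.-integrable setT (EFin \o (fun z => f z ^+ 2)).
  apply: integrable_ge0; [exact: measurable_funX|by move=> z; exact: sqr_ge0|].
  by apply: le_lt_trans le _; rewrite -EFin_Rintegral// ltry.
by split; [split|rewrite -lee_fin !EFin_Rintegral].
Qed.

Lemma sqint_section1 (f : T1 * T2 -> R) : sqint (m1 \x m2)%E f ->
  {ae m1, forall x, sqint m2 (fun y => f (x, y))}.
Proof.
move=> [mf fi]; apply: filterS (ae_integrable1 fi) => x xi; split => //.
exact: (measurableT_comp mf (measurable_pair1 x)).
Qed.

(** Cauchy-Schwarz on almost every section. With [e = 1] it bounds the expectation over Brownian
    paths, with [e = e_j] the coefficients of a Malliavin derivative. *)
Lemma sqint_contract (e : T2 -> R) (f : T1 * T2 -> R) : sqint m2 e -> sqint (m1 \x m2)%E f ->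
  sqint m1 (fun x => \int[m2]_y (e y * f (x, y))) /\
  l2n m1 (fun x => \int[m2]_y (e y * f (x, y))) <= l2n m2 e * l2n (m1 \x m2)%E f.
Proof.
move=> se sf; have [mf fi] := sf; have [me ie] := se.
have md : measurable_fun setT (fun x => \int[m2]_y (e y * f (x, y))).
  apply: (@measurable_Rint1 _ _ _ _ _ m2 (fun z => e z.2 * f z)).
  by apply: measurable_funM => //; exact: (measurableT_comp me measurable_snd).
have [iF EF] := Rfubini1 fi.
have [id led] : m1.-integrable setT (EFin \o (fun x => (\int[m2]_y (e y * f (x, y))) ^+ 2)) /\
    \int[m1]_x ((\int[m2]_y (e y * f (x, y))) ^+ 2) <=
    \int[m1]_x (l2n m2 e ^+ 2 * \int[m2]_y (f (x, y) ^+ 2)).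
  apply: ge0_integrable_le_ae.
  - exact: measurable_funX.
  - by move=> x; exact: sqr_ge0.
  - by move=> x; rewrite mulr_ge0 ?sqr_ge0// Rint_sqr_ge0.
  - apply: filterS (sqint_section1 sf) => x sx.
    rewrite -(l2n_sqr m2 (fun y => f (x, y))) -exprMn -real_normK ?num_real//.
    by rewrite lerXn2r ?nnegrE ?mulr_ge0 ?l2n_ge0//; exact: Rint_cauchy_schwarz.
  - exact: RintegrableZ.
split; first by split.
rewrite -(@ler_pXn2r _ 2) ?nnegrE ?mulr_ge0 ?l2n_ge0//.
by rewrite l2n_sqr (le_trans led)// RintegralZl// EF exprMn (l2n_sqr _ f).
Qed.

End product_L2.

(** * The Feynman-Kac field *)

Section shift_mean.
Context (R : realType) d (T : measurableType d) (P : probability T R) (n K : nat).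
Variables (f : 'rV[R]_n.+1 -> R) (Is : 'I_n.+1 -> T -> R) (gam : 'I_K -> 'I_n.+1 -> R).
Hypotheses (cf : continuous f) (f_exp : exists2 C, 0 <= C & forall v, `|f v| <= C * exp_row v).
Hypotheses (mI : forall i, measurable_fun setT (Is i))
  (iI : P.-integrable setT (EFin \o (fun w => exp_row (\row_i Is i w)))).

Lemma shift_bound (A : R) : 0 <= A -> exists2 M, 0 <= M &
  forall v (a : 'I_K -> R), (forall k, `|a k| <= A) -> `|f (v + row_shift gam a)| <= M * exp_row v.
Proof.
move=> A0; have [M M0 fM] := f_exp.
exists (M * expR (A * gam_sum gam)); first by rewrite mulr_ge0// expR_ge0.
move=> v a aA; apply: (le_trans (fM _)); rewrite -mulrA ler_wpM2l//.
apply: (le_trans (exp_row_shift _ _)); rewrite ler_wpM2r ?exp_row_ge0// ler_expR.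
exact: row_shift_norm.
Qed.

Lemma integrable_shift a :
  P.-integrable setT (EFin \o (fun w => f ((\row_i Is i w) + row_shift gam a))).
Proof.
pose A := \sum_k `|a k|; have A0 : 0 <= A by apply: sumr_ge0.
have [M M0 fM] := shift_bound A0.
apply: (@integrable_le _ _ _ P _ (fun w => M * exp_row (\row_i Is i w))).
- exact: measurable_row_comp.
- move=> w; apply: fM => k; rewrite /A (bigD1 k)//= lerDl; exact: sumr_ge0.
- exact: RintegrableZ.
Qed.

(** Together with [cvg_smooth_mean] this provides [Psi_bound] and [Psi_cvg]; uniformity over bounded
    shifts comes from domination by [exp_row]. *)
Lemma smooth_mean_bound (A : R) : 0 <= A -> exists2 M, 0 <= M &
  forall a : 'I_K -> R, (forall k, `|a k| <= A) -> `|smooth_mean P f Is gam a| <= M.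
Proof.
move=> A0; have [M M0 fM] := shift_bound A0.
exists (\int[P]_w (M * exp_row (\row_i Is i w))).
  by apply: Rintegral_ge0 => w _; rewrite mulr_ge0// exp_row_ge0.
move=> a aA; apply: le_trans (ler_norm_Rint (integrable_shift a)) _.
apply: Rintegral_le; [by move=> w; exact: fM| |exact: RintegrableZ].
exact/Rintegrable_norm/integrable_shift.
Qed.

Lemma cvg_smooth_mean (A : R) (a_ : nat -> 'I_K -> R) (a : 'I_K -> R) : 0 <= A ->
  (forall k i, `|a_ k i| <= A) -> (forall i, a_ k i @[k --> \oo] --> a i) ->
  smooth_mean P f Is gam (a_ k) @[k --> \oo] --> smooth_mean P f Is gam a.
Proof.
move=> A0 aA ca; have [M M0 fM] := shift_bound A0.
apply: (@Rdct _ _ _ P _ _ (fun w => M * exp_row (\row_i Is i w))).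
- by move=> k; exact: measurable_row_comp.
- exact: measurable_row_comp.
- apply: nearW => w; set v := \row_i _.
  have c : v + row_shift gam (a_ k) @[k --> \oo] --> v + row_shift gam a.
    apply: cvgD; first exact: cvg_cst.
    apply: cvg_row => i; rewrite mxE; under eq_fun do rewrite mxE.
    by apply: cvg_sumr => m; apply: cvgM => //; exact: cvg_cst.
  exact: (cvg_comp _ _ c (@cf _)).
- by move=> k w; exact: fM.
- exact: RintegrableZ.
Qed.

End shift_mean.

Section field.
Context (R : realType) dW dB (OmW : measurableType dW) (OmB : measurableType dB).
Variables (PW : probability OmW R) (PB : probability OmB R) (W : R -> OmW -> R).
Hypothesis W_brownian : brownian_line PW W.
Local Notation leb := (@lebesgue_measure R).
Variables (T : R) (G : R -> set (set OmB)) (B : R -> OmB -> R).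
Hypotheses (T0 : 0 <= T) (GF : filtration T G) (BB : brownian PB T G B).
Variables (K : nat) (ee : 'I_K -> R -> R) (C : R).
Hypotheses (cee : forall k, continuous (ee k)) (eeC : forall k z, `|ee k z| <= C) (C0 : 0 <= C).
Hypotheses (see : forall k, sqint leb (ee k))
  (ortho : forall k l, \int[leb]_y (ee k y * ee l y) = (k == l)%:R).
Variables (u0 : R -> R) (M : R).
Hypotheses (mu0 : measurable_fun setT u0) (u0M : forall z, `|u0 z| <= M).
Local Notation Bc := (Bc T B).
Local Notation along := (along ee T B).

Definition occ_fun (t x : R) (v : OmB) (y : R) : R :=
  \sum_k primitive (along x v k) t * ee k y.

Lemma sqint_occ_fun t x v : sqint leb (occ_fun t x v).
Proof. by apply: sqint_sum => k _; exact: sqintZ. Qed.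

Lemma occ_inner t x v h : sqint leb h -> \int[leb]_y (occ_fun t x v y * h y) =
  \sum_k primitive (along x v k) t * \int[leb]_y (ee k y * h y).
Proof.
move=> sh; under eq_Rintegral do rewrite mulr_suml.
rewrite Rintegral_sum => [|k _]; last by apply: sqintM => //; exact: sqintZ.
apply: eq_bigr => k _; under eq_Rintegral do rewrite -mulrA.
by rewrite RintegralZl//; exact: sqintM.
Qed.

(** Orthonormality turns the correction term of the Feynman-Kac weight into half a squared L^2 norm,
    so that the weight is exactly a [wexp]. *)
Lemma occ_sq t x v :
  \int[leb]_y (occ_fun t x v y ^+ 2) = \sum_k primitive (along x v k) t ^+ 2.
Proof.
under eq_Rintegral do rewrite expr2.
rewrite occ_inner; last exact: sqint_occ_fun.
apply: eq_bigr => k _; under eq_Rintegral do rewrite mulrC.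
rewrite occ_inner// (bigD1 k)//= ortho eqxx mulr1 big1 ?addr0// => l lk.
by rewrite ortho (negbTE lk) mulr0.
Qed.

Variable Phi : (R * R) * (OmW * OmB) -> R.
Hypothesis mPhi : measurable_fun setT Phi.
Hypothesis wPhi : forall t x, 0 <= t <= T ->
  {ae PB, forall v, wiener_integral PW W (occ_fun t x v) (fun w => Phi ((t, x), (w, v)))}.

Definition dens (z : (R * R) * (OmW * OmB)) : R :=
  expR (Phi z - 2^-1 * \sum_k primitive (along z.1.2 z.2.2 k) z.1.1 ^+ 2).

Definition field_integrand (z : (R * R) * (OmW * OmB)) : R :=
  u0 (z.1.2 + Bc z.1.1 z.2.2) * dens z.

Definition field (t x : R) (w : OmW) : R := \int[PB]_v field_integrand ((t, x), (w, v)).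

Lemma densE t x w v :
  dens ((t, x), (w, v)) = wexp (occ_fun t x v) (fun w => Phi ((t, x), (w, v))) w.
Proof. by rewrite /dens /wexp occ_sq [_ / 2]mulrC. Qed.

Lemma measurable_dens : measurable_fun setT dens.
Proof.
apply: measurableT_comp => //; apply: measurable_funB => //; apply: measurable_funM => //.
apply: measurable_sum => k; apply: measurable_funX.
have mz : measurable_fun setT (fun z : (R * R) * (OmW * OmB) => (z.1, z.2.2)).
  apply/measurable_fun_pairP; split; first exact: measurable_fst.
  exact: (measurableT_comp measurable_snd measurable_snd).
exact: (measurableT_comp (measurable_along_primitive cee T0 GF BB k) mz).
Qed.

Lemma measurable_field_integrand : measurable_fun setT field_integrand.
Proof.
apply: measurable_funM; last exact: measurable_dens.
apply: (measurableT_comp mu0); apply: measurable_funD.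
  exact: (measurableT_comp measurable_snd measurable_fst).
have mz : measurable_fun setT (fun z : (R * R) * (OmW * OmB) => (z.1.1, z.2.2)).
  apply/measurable_fun_pairP; split; first exact: (measurableT_comp measurable_fst measurable_fst).
  exact: (measurableT_comp measurable_snd measurable_snd).
exact: (measurableT_comp (measurable_Bc_pair T0 GF BB) mz).
Qed.

Lemma measurable_field : measurable_fun setT (fun z : (R * R) * OmW => field z.1.1 z.1.2 z.2).
Proof.
apply: (@measurable_Rint1 _ _ _ _ _ PB (fun z : ((R * R) * OmW) * OmB =>
  field_integrand ((z.1.1.1, z.1.1.2), (z.1.2, z.2)))).
apply: (measurableT_comp measurable_field_integrand).
apply/measurable_fun_pairP; split.
  rewrite (_ : _ \o _ = fun z : ((R * R) * OmW) * OmB => z.1.1); last by apply/funext => -[[[]]].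
  exact: (measurableT_comp measurable_fst measurable_fst).
apply/measurable_fun_pairP; split; last exact: measurable_snd.
exact: (measurableT_comp measurable_snd measurable_fst).
Qed.

Lemma M_ge0 : 0 <= M. Proof. exact: le_trans (normr_ge0 _) (u0M 0). Qed.

(** Each of the [K] occupation integrals is at most [C * T] in absolute value, and the second moment
    of [wexp] is at most the exponential of the sum of their squares. *)
Definition dens_bound : R := expR (K%:R * (C * T) ^+ 2).

Definition field_bound : R := M * Num.sqrt dens_bound.

Lemma field_bound_ge0 : 0 <= field_bound.
Proof. by rewrite mulr_ge0 ?M_ge0// sqrtr_ge0. Qed.

Section fixed_time.
Variables (t x : R).
Hypothesis tT : 0 <= t <= T.

Lemma sq_occ_bound v : \sum_k primitive (along x v k) t ^+ 2 <= K%:R * (C * T) ^+ 2.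
Proof.
have /andP[t0 tleT] := tT.
apply: (@le_trans _ _ (\sum_(k < K) (C * T) ^+ 2)); last first.
  by rewrite sumr_const card_ord mulr_natl.
apply: ler_sum => k _; rewrite -real_normK ?num_real// lerXn2r ?nnegrE ?mulr_ge0//.
apply: (@le_trans _ _ (C * t)); last by rewrite ler_wpM2l.
by apply: primitive_bound => //; [exact: (continuous_along cee T0 BB)|move=> q; exact: eeC].
Qed.

Lemma measurable_section_dens : measurable_fun setT (fun z => dens ((t, x), z)).
Proof. exact: (measurableT_comp measurable_dens (measurable_pair1 (t, x))). Qed.

Lemma sqint_dens : sqint (PW \x PB)%E (fun z => dens ((t, x), z)) /\
  l2n (PW \x PB)%E (fun z => dens ((t, x), z)) <= Num.sqrt dens_bound.
Proof.
have h : {ae PB, forall v, (\int[PW]_w (dens ((t, x), (w, v)) ^+ 2)%:E <= dens_bound%:E)%E}.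
  apply: filterS (wPhi x tT) => v wv.
  under eq_integral do rewrite densE.
  apply: le_trans (wexp_second_moment W_brownian wv) _.
  by rewrite lee_fin ler_expR occ_sq sq_occ_bound.
have [s e] := sqint_tonelli2 measurable_section_dens h (fun=> expR_ge0 _) (integrable_cst PB dens_bound).
by split => //; rewrite ler_wsqrtr// (le_trans e)// Rintegral_cst_prob.
Qed.

Lemma sqint_field_integrand : sqint (PW \x PB)%E (fun z => field_integrand ((t, x), z)) /\
  l2n (PW \x PB)%E (fun z => field_integrand ((t, x), z)) <= field_bound.
Proof.
have [[md id] ed] := sqint_dens.
have mN : measurable_fun setT (fun z => field_integrand ((t, x), z)).
  exact: (measurableT_comp measurable_field_integrand (measurable_pair1 (t, x))).
have le z : field_integrand ((t, x), z) ^+ 2 <= M ^+ 2 * dens ((t, x), z) ^+ 2.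
  rewrite exprMn ler_wpM2r ?sqr_ge0// -real_normK ?num_real//.
  by rewrite lerXn2r ?nnegrE ?M_ge0.
have iN : (PW \x PB)%E.-integrable setT (EFin \o (fun z => field_integrand ((t, x), z) ^+ 2)).
  apply: (@integrable_le _ _ _ (PW \x PB)%E _ (fun z => M ^+ 2 * dens ((t, x), z) ^+ 2)).
  - exact: measurable_funX.
  - by move=> z; rewrite ger0_norm ?sqr_ge0.
  - exact: RintegrableZ.
split; first by split.
apply: (@le_trans _ _ (M * l2n (PW \x PB)%E (fun z => dens ((t, x), z)))); last first.
  by rewrite ler_wpM2l ?M_ge0.
rewrite -(@ler_pXn2r _ 2) ?nnegrE ?mulr_ge0 ?l2n_ge0 ?M_ge0//.
rewrite exprMn !l2n_sqr -RintegralZl//; apply: Rintegral_le => //.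
exact: RintegrableZ.
Qed.

Lemma sqint_field : sqint PW (field t x) /\ l2n PW (field t x) <= field_bound.
Proof.
have [sN eN] := sqint_field_integrand.
have [s e] := sqint_contract (sqint_cst PB 1) sN.
have E : (fun w => \int[PB]_v (cst 1 v * field_integrand ((t, x), (w, v)))) = field t x.
  by apply/funext => w; apply: eq_Rintegral => v _; rewrite mul1r.
rewrite E in s e; split => //; apply: (le_trans e).
rewrite /l2n /= expr1n Rintegral_cst_prob sqrtr1 mul1r; exact: eN.
Qed.

Lemma sqint_fst (g : OmW -> R) : sqint PW g -> sqint (PW \x PB)%E (fun z => g z.1).
Proof.
move=> [mg ig]; split; first exact: (measurableT_comp mg measurable_fst).
apply: (@integrable_prod _ _ _ _ _ PW PB _ (fun w => g w ^+ 2) (cst 1)) => //.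
- apply: measurable_funX; exact: (measurableT_comp mg measurable_fst).
- by move=> w v; rewrite mulr1 ger0_norm ?sqr_ge0.
- exact: integrable_cst.
Qed.

Lemma field_inner (g : OmW -> R) : sqint PW g -> \int[PW]_w (field t x w * g w) =
  \int[PB]_v (u0 (x + Bc t v) * \int[PW]_w (dens ((t, x), (w, v)) * g w)).
Proof.
move=> sg; have [sN _] := sqint_field_integrand; have [sD _] := sqint_dens.
have iN := sqintM sN (sqint_fst sg); have iD := sqintM sD (sqint_fst sg).
have mB : measurable_fun setT (Bc t) by exact: (measurable_Bc T0 GF BB).
transitivity (\int[PW]_w \int[PB]_v (field_integrand ((t, x), (w, v)) * g w)).
  apply: Rint_ae_eq.
  - by apply: measurable_funM; [have [[]] := sqint_field|case: sg].
  - exact: (Rintegrable_measurable (Rfubini1 iN).1).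
  - apply: filterS (sqint_section1 sN) => w sw; rewrite RintegralZr//.
    exact: sqint_integrable.
rewrite (Rfubini iN); apply: Rint_ae_eq.
- exact: (Rintegrable_measurable (Rfubini2 iN).1).
- apply: measurable_funM; last exact: (Rintegrable_measurable (Rfubini2 iD).1).
  by apply: (measurableT_comp mu0); exact: measurable_funD.
- apply: filterS (ae_integrable2 iD) => v iv.
  by rewrite -RintegralZl//; apply: eq_Rintegral => w _; rewrite mulrA.
Qed.

(** Paired with [h_i], the function [occ_fun] gives [\sum_k a_k <e_k, h_i>] with [a] the occupation
    integrals, so the Cameron-Martin shift is the [row_shift] of [a]. *)
Lemma field_smooth n (hs : 'I_n.+1 -> R -> R) (Is : 'I_n.+1 -> OmW -> R) f :
  (forall i, wiener_integral PW W (hs i) (Is i)) -> continuous f -> poly_growth f ->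
  \int[PW]_w (field t x w * f (\row_i Is i w)) =
  path_mean ee u0 PB T B
    (smooth_mean PW f Is (fun k i => \int[leb]_y (ee k y * hs i y))) t x.
Proof.
move=> wI cf fg; have sf := sqint_wiener_row W_brownian wI cf fg.
pose gam (k : 'I_K) (i : 'I_n.+1) := \int[leb]_y (ee k y * hs i y); rewrite -/gam.
have mI i : measurable_fun setT (Is i) by exact: (measurable_wiener W_brownian (wI i)).
have iI : PW.-integrable setT (EFin \o (fun w => exp_row (\row_i Is i w))).
  by apply: sqint_integrable; exact: (sqint_exp_row W_brownian wI).
have [sD _] := sqint_dens; have iD := sqintM sD (sqint_fst sf).
have mB : measurable_fun setT (Bc t) by exact: (measurable_Bc T0 GF BB).
have mu : measurable_fun setT (fun v => u0 (x + Bc t v)).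
  by apply: (measurableT_comp mu0); exact: measurable_funD.
rewrite field_inner//; apply: Rint_ae_eq.
- apply: measurable_funM => //; exact: (Rintegrable_measurable (Rfubini2 iD).1).
- have Psi_cvg := cvg_smooth_mean (gam := gam) cf (poly_growth_exp fg) mI iI.
  have m := measurable_path_mean_integrand cee mu0 Psi_cvg T0 GF BB.
  exact: (measurableT_comp m (measurable_pair1 (t, x))).
- apply: filterS (wPhi x tT) => v wv; congr (_ * _).
  under eq_Rintegral do rewrite densE.
  have [_ _ ->] := cameron_martin_row W_brownian wv wI cf fg.
  apply: eq_Rintegral => w _; rewrite row_shiftP; congr f; apply/rowP => i; rewrite !mxE.
  congr (_ + _); rewrite occ_inner//.
  by have [] := wiener_seq W_brownian (wI i).
Qed.

End fixed_time.

End field.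

(** * The Duhamel term *)

Lemma integrable_ae_eq d (T : measurableType d) (R : realType) (mu : {measure set T -> \bar R}) (f g : T -> R) :
  measurable_fun setT f -> {ae mu, forall w, f w = g w} -> mu.-integrable setT (EFin \o g) ->
  mu.-integrable setT (EFin \o f) /\ \int[mu]_w f w = \int[mu]_w g w.
Proof.
move=> mf fg ig; have mg := Rintegrable_measurable ig.
split; last exact: Rint_ae_eq.
have [inf _] : mu.-integrable setT (EFin \o (fun w => `|f w|)) /\
    \int[mu]_w `|f w| <= \int[mu]_w `|g w|.
  apply: ge0_integrable_le_ae => //; first exact: measurableT_comp.
  - by apply: filterS fg => w ->.
  - exact: Rintegrable_norm.
exact: integrable_le mf _ inf.
Qed.

Lemma ae_forall d (T : measurableType d) (R : realType) (mu : {measure set T -> \bar R}) (I : finType)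
    (Q : I -> T -> Prop) : (forall i, {ae mu, forall w, Q i w}) -> {ae mu, forall w, forall i, Q i w}.
Proof.
move=> H.
have h (s : seq I) : {ae mu, forall w, forall i, i \in s -> Q i w}.
  elim: s => [|i s ih]; first by apply: aeW => w i; rewrite in_nil.
  apply: filterS2 (H i) ih => w Qi Qs k.
  by rewrite inE => /predU1P[->|/Qs].
by apply: filterS (h (enum I)) => w Qw i; apply: Qw; rewrite mem_enum.
Qed.

Section sigma_finite_prod.
Context d1 d2 (T1 : measurableType d1) (T2 : measurableType d2) (R : realType).
Variables (m1 : {sigma_finite_measure set T1 -> \bar R}) (m2 : {sigma_finite_measure set T2 -> \bar R}).

(* The sigma-finite instance of [m1 \x m2] is shadowed by the one for
   probability measures, hence this alias. *)
Definition sfprod : set (T1 * T2) -> \bar R := (m1 \x m2)%E.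

HB.instance Definition _ := Measure.on sfprod.

Let sfprod_sigma_finite : sigma_finite setT sfprod.
Proof.
have /sigma_finiteP[F [TF ndF Foo]] := sigma_finiteT m1.
have /sigma_finiteP[G [TG ndG Goo]] := sigma_finiteT m2.
exists (fun n => F n `*` G n).
  rewrite -setXTT TF TG; apply/seteqP; split => [[x y]|[x y] [n _ []]] /=; last first.
    by move=> ? ?; split; exists n.
  move=> [[n _ Fnx] [k _ Gky]]; exists (maxn n k) => //; split.
  - by move: x Fnx; exact/subsetPset/ndF/leq_maxl.
  - by move: y Gky; exact/subsetPset/ndG/leq_maxr.
move=> k; have [? ?] := Foo k; have [? ?] := Goo k.
split; first exact: measurableX.
by rewrite /sfprod product_measure1E// lte_mul_pinfty// ge0_fin_numE.
Qed.

HB.instance Definition _ := Measure_isSigmaFinite.Build _ _ _ sfprod sfprod_sigma_finite.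

End sigma_finite_prod.

Definition leb2 (R : realType) : {sigma_finite_measure set (measurableTypeR R * measurableTypeR R)%type -> \bar R} :=
  sfprod (@lebesgue_measure R) (@lebesgue_measure R).

(** * Source terms of a field bounded in L^2 *)

Section source.
Context (R : realType) d (Om : measurableType d) (P : probability Om R).
Local Notation leb := (@lebesgue_measure R).
Local Notation LL := (leb2 R).
Variables (K : nat) (ee : 'I_K -> R -> R) (C : R).
Hypotheses (cee : forall k, continuous (ee k)) (eeC : forall k z, `|ee k z| <= C) (C0 : 0 <= C).
Hypothesis see : forall k, sqint leb (ee k).
Variables (T A : R) (V : R -> R -> Om -> R).
Hypotheses (mV : measurable_fun setT (fun z : (R * R) * Om => V z.1.1 z.1.2 z.2)) (A0 : 0 <= A).
Hypothesis sV : forall s y, 0 <= s <= T -> sqint P (V s y) /\ l2n P (V s y) <= A.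
Variables (t x : R).
Hypothesis tT : 0 <= t <= T.

Definition kern (j : 'I_K) (z : R * R) : R :=
  \1_(`[0, t]%classic : set R) z.1 * (heat_kernel (t - z.1) (x - z.2) * ee j z.2).

(** The coefficient of [e_j] in the Duhamel term. *)
Definition source (j : 'I_K) (w : Om) : R :=
  \int[leb]_(s in `[0, t]) \int[leb]_y (heat_kernel (t - s) (x - y) * (ee j y * V s y w)).

Lemma measurable_ee j : measurable_fun setT (ee j).
Proof. by apply: continuous_measurable_fun; exact: cee. Qed.

Lemma measurable_indic_time : measurable_fun setT (\1_(`[0, t]%classic : set R) : R -> R).
Proof. by apply: measurable_indic; exact: measurable_itv. Qed.

Lemma measurable_shifted_heat : measurable_fun setT (fun z : R * R => heat_kernel (t - z.1) (x - z.2)).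
Proof.
have mz : measurable_fun setT (fun z : R * R => (t - z.1, z.2)).
  apply/measurable_fun_pairP; split; last exact: measurable_snd.
  by apply: measurable_funB => //; exact: measurable_fst.
exact: (measurableT_comp (measurable_heat_pair x) mz).
Qed.

Lemma measurable_kern j : measurable_fun setT (kern j).
Proof.
apply: measurable_funM; first exact: (measurableT_comp measurable_indic_time measurable_fst).
apply: measurable_funM; first exact: measurable_shifted_heat.
exact: (measurableT_comp (measurable_ee j) measurable_snd).
Qed.

(** For [s < t] the heat kernel has total mass 1, so the integral over [y] is at most [C]; the
    degenerate time [s = t] is null. *)
Lemma integrable_kern j : LL.-integrable setT (EFin \o kern j).
Proof.
apply: (@integrable_tonelli1 _ _ _ _ _ leb leb _ (fun s => C * \1_(`[0, t]%classic : set R) s)).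
- exact: measurable_kern.
- apply: (aeS_leb _ (ae_neq2 t t)) => s [snt _]; rewrite /kern /=.
  rewrite indicE mem_setE in_itv/=; have [/andP[s0 st]|_] := boolP (0 <= s <= t); last first.
    by rewrite integral0_eq ?mulr0// => y _; rewrite mul0r normr0.
  have r0 : 0 < t - s by rewrite subr_gt0 lt_neqAle snt.
  have ih := integrable_heat x r0.
  have le1 : \int[leb]_y heat_kernel (t - s) (x - y) = 1.
    have := @normal_heat R (t - s) x (cst 1) 1 r0 (measurable_cst _) _.
    rewrite Rintegral_cst_prob => -> //; last by move=> z; rewrite normr1.
    by apply: eq_Rintegral => y _; rewrite mulr1.
  apply: (@le_trans _ _ (\int[leb]_y (C * heat_kernel (t - s) (x - y))%:E)%E).
    apply: ge0_le_integral => //.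
    + apply/measurable_EFinP; apply: measurableT_comp => //.
      apply: measurable_funM => //; apply: measurable_funM; last exact: measurable_ee.
      exact: measurable_heat.
    + by apply/measurable_EFinP; apply: measurable_funM => //; exact: measurable_heat.
    + move=> y _; rewrite lee_fin mul1r normrM (ger0_norm (heat_kernel_ge0 _ _)) mulrC.
      by rewrite ler_wpM2r// heat_kernel_ge0.
  rewrite -EFin_Rintegral; last exact: RintegrableZ.
  by rewrite RintegralZl// le1 mulr1.
- by apply: RintegrableZ; exact: integrable_indic_itv.
Qed.

Lemma inner_bound (s y : R) (g : Om -> R) : 0 <= s <= t -> sqint P g ->
  \int[P]_w `|V s y w * g w| <= A * l2n P g.
Proof.
move=> /andP[s0 st] sg; have /andP[t0 tleT] := tT.
have sT : 0 <= s <= T by rewrite s0 (le_trans st).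
have [sVs le] := sV y sT.
by apply: le_trans (cauchy_schwarz sVs sg) _; rewrite ler_wpM2r ?l2n_ge0.
Qed.

Lemma integrable_source (g : Om -> R) j : sqint P g -> (LL \x P)%E.-integrable setT
  (EFin \o (fun z : (R * R) * Om => kern j z.1 * (V z.1.1 z.1.2 z.2 * g z.2))).
Proof.
move=> sg; have [mg _] := sg.
apply: (@integrable_tonelli1 _ _ _ _ _ LL P _ (fun z => A * l2n P g * `|kern j z|)).
- apply: measurable_funM; first exact: (measurableT_comp (measurable_kern j) measurable_fst).
  by apply: measurable_funM => //; exact: (measurableT_comp mg measurable_snd).
- apply: aeW => -[s y] /=; rewrite {1}/kern /= indicE mem_setE in_itv/=.
  have [sI|_] := boolP (0 <= s <= t); last first.
    rewrite integral0_eq => [|w _]; last by rewrite !mul0r normr0.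
    by rewrite lee_fin mulr_ge0// mulr_ge0// l2n_ge0.
  rewrite mul1r; have /andP[s0 st] := sI; have /andP[t0 tleT] := tT.
  have sT : 0 <= s <= T by rewrite s0 (le_trans st).
  have iVg := Rintegrable_norm (sqintM (sV y sT).1 sg).
  have -> : kern j (s, y) = heat_kernel (t - s) (x - y) * ee j y.
    by rewrite /kern /= indicE mem_setE in_itv/= sI mul1r.
  under eq_integral do rewrite normrM.
  rewrite -EFin_Rintegral; last exact: RintegrableZ.
  by rewrite lee_fin RintegralZl// mulrC ler_wpM2r//; exact: inner_bound.
- by apply: RintegrableZ; apply: Rintegrable_norm; exact: integrable_kern.
Qed.

Lemma integrable_source1 j : (LL \x P)%E.-integrable setT
  (EFin \o (fun z : (R * R) * Om => kern j z.1 * V z.1.1 z.1.2 z.2)).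
Proof.
have := integrable_source j (sqint_cst P 1).
by congr (integrable _ _ (EFin \o _)); apply/funext => z; rewrite mulr1.
Qed.

Lemma Rint_itv_time (h : R -> R -> R) :
  \int[leb]_(s in `[0, t]) \int[leb]_y h s y =
  \int[leb]_s \int[leb]_y (\1_(`[0, t]%classic : set R) s * h s y).
Proof.
rewrite Rintegral_mkcond; apply: eq_Rintegral => s _; rewrite patchE indicE.
case: (s \in _); first by apply: eq_Rintegral => y _; rewrite mul1r.
under eq_Rintegral do rewrite mul0r.
by rewrite /Rintegral integral0.
Qed.

Lemma kernE j (h : R -> R -> R) :
  \int[leb]_(s in `[0, t]) \int[leb]_y (heat_kernel (t - s) (x - y) * (ee j y * h s y)) =
  \int[leb]_s \int[leb]_y (kern j (s, y) * h s y).
Proof.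
rewrite Rint_itv_time; apply: eq_Rintegral => s _; apply: eq_Rintegral => y _.
by rewrite /kern /= !mulrA.
Qed.

Lemma measurable_source j : measurable_fun setT (source j).
Proof.
rewrite (_ : source j = fun w => \int[leb]_s \int[leb]_y (kern j (s, y) * V s y w)); last first.
  by apply/funext => w; rewrite -kernE.
apply: (@measurable_Rint1 _ _ _ _ _ leb (fun z : Om * R => \int[leb]_y (kern j (z.2, y) * V z.2 y z.1))).
apply: (@measurable_Rint1 _ _ _ _ _ leb (fun z : (Om * R) * R => kern j (z.1.2, z.2) * V z.1.2 z.2 z.1.1)).
have m1 : measurable_fun setT (fun z : (Om * R) * R => (z.1.2, z.2)).
  apply/measurable_fun_pairP; split; last exact: measurable_snd.
  exact: (measurableT_comp measurable_snd measurable_fst).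
apply: measurable_funM; first exact: (measurableT_comp (measurable_kern j) m1).
have m2 : measurable_fun setT (fun z : (Om * R) * R => ((z.1.2, z.2), z.1.1)).
  apply/measurable_fun_pairP; split => //.
  exact: (measurableT_comp measurable_fst measurable_fst).
exact: (measurableT_comp mV m2).
Qed.

(** Identifies, outside one null set common to all [j], the iterated integral of the definition with
    an integral over the time-space product, where linearity and Fubini are available. *)
Lemma sourceE : {ae P, forall w j, LL.-integrable setT
    (EFin \o (fun z => kern j z * V z.1 z.2 w)) /\
  source j w = \int[LL]_z (kern j z * V z.1 z.2 w)}.
Proof.
apply: ae_forall => j; apply: filterS (ae_integrable2 (integrable_source1 j)) => w iw.
split; first exact: iw.
rewrite /source kernE.
by have [_] := @Rfubini1 _ _ _ _ _ leb leb (fun z => kern j z * V z.1 z.2 w) iw.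
Qed.

Lemma source_inner j (g : Om -> R) : sqint P g ->
  P.-integrable setT (EFin \o (fun w => source j w * g w)) /\
  \int[P]_w (source j w * g w) = \int[LL]_z (kern j z * \int[P]_w (V z.1 z.2 w * g w)).
Proof.
move=> sg; have [mg _] := sg; have iG := integrable_source j sg.
have [i2 _] := Rfubini2 iG.
have [i E] : P.-integrable setT (EFin \o (fun w => source j w * g w)) /\
    \int[P]_w (source j w * g w) = \int[P]_w \int[LL]_z (kern j z * (V z.1 z.2 w * g w)).
  apply: integrable_ae_eq => //; first by apply: measurable_funM => //; exact: measurable_source.
  apply: filterS sourceE => w /(_ j)[iw ->]; rewrite -RintegralZr//.
  by apply: eq_Rintegral => z _; rewrite mulrA.
split => //; rewrite E -(Rfubini iG); apply: eq_Rintegral => -[s y] _ /=.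
have [sI|sI] := boolP (s \in `[0, t]%classic).
  rewrite mem_setE in_itv/= in sI; have /andP[s0 st] := sI; have /andP[t0 tleT] := tT.
  have sT : 0 <= s <= T by rewrite s0 (le_trans st).
  by rewrite RintegralZl//; exact: (sqintM (sV y sT).1 sg).
rewrite /kern /= indicE (negbTE sI) !mul0r; under eq_Rintegral do rewrite !mul0r.
by rewrite Rintegral_cst_prob.
Qed.

Lemma integrable_source_inner j (g : Om -> R) : sqint P g ->
  LL.-integrable setT (EFin \o (fun z => kern j z * \int[P]_w (V z.1 z.2 w * g w))).
Proof.
move=> sg; have [i1 _] := Rfubini1 (integrable_source j sg).
move: i1; congr (integrable _ _ (EFin \o _)); apply/funext => -[s y] /=.
have [sI|sI] := boolP (s \in `[0, t]%classic).
  rewrite mem_setE in_itv/= in sI; have /andP[s0 st] := sI; have /andP[t0 tleT] := tT.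
  have sT : 0 <= s <= T by rewrite s0 (le_trans st).
  by rewrite RintegralZl//; exact: (sqintM (sV y sT).1 sg).
rewrite /kern /= indicE (negbTE sI) !mul0r; under eq_Rintegral do rewrite !mul0r.
by rewrite Rintegral_cst_prob.
Qed.

Lemma source_inner_itv j (g : Om -> R) : sqint P g ->
  \int[P]_w (source j w * g w) = \int[leb]_(s in `[0, t]) \int[leb]_y
    (heat_kernel (t - s) (x - y) * (ee j y * \int[P]_w (V s y w * g w))).
Proof.
move=> sg; rewrite (source_inner j sg).2 kernE.
by have [_] := Rfubini1 (integrable_source_inner j sg).
Qed.

(** Continuity in [g] is stated by duality: the pairing is controlled through the norms of [V] under
    the kernel integral, without an L^2 norm of [source j]. *)
Lemma source_bound j : exists2 M, 0 <= M & forall g, sqint P g ->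
  `|\int[P]_w (source j w * g w)| <= M * l2n P g.
Proof.
exists (\int[LL]_z (`|kern j z| * A)).
  by apply: Rintegral_ge0 => z _; rewrite mulr_ge0.
move=> g sg; rewrite (source_inner j sg).2.
have ik : LL.-integrable setT (EFin \o (fun z => `|kern j z| * A)).
  by under eq_fun do rewrite mulrC; apply: RintegrableZ; apply: Rintegrable_norm; exact: integrable_kern.
apply: le_trans (ler_norm_Rint (integrable_source_inner j sg)) _.
rewrite -RintegralZr//; apply: Rintegral_le.
- move=> [s y] /=; rewrite normrM -mulrA.
  have [sI|sI] := boolP (s \in `[0, t]%classic); last first.
    by rewrite /kern /= indicE (negbTE sI) !mul0r normr0 !mul0r.
  rewrite mem_setE in_itv/= in sI; have /andP[s0 st] := sI; have /andP[t0 tleT] := tT.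
  have sT : 0 <= s <= T by rewrite s0 (le_trans st).
  rewrite ler_wpM2l//; apply: le_trans (ler_norm_Rint (sqintM (sV y sT).1 sg)) _.
  exact: inner_bound.
- exact/Rintegrable_norm/integrable_source_inner.
- by under eq_fun do rewrite mulrC; exact: RintegrableZ.
Qed.

Definition duhamel_sum (w : Om) (z : R) : R :=
  \int[leb]_(s in `[0, t]) \int[leb]_y
    (heat_kernel (t - s) (x - y) * (\sum_j ee j y * ee j z) * V s y w).

(** The kernel has finite rank, so the variable [z] leaves the integrals; the exceptional null set
    therefore does not depend on [z]. *)
Lemma duhamel_sumE : {ae P, forall w z, duhamel_sum w z = \sum_j ee j z * source j w}.
Proof.
apply: filterS sourceE => w H z.
have E s y : \1_(`[0, t]%classic : set R) s *
    (heat_kernel (t - s) (x - y) * (\sum_j ee j y * ee j z) * V s y w) =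
    \sum_j ee j z * (kern j (s, y) * V s y w).
  rewrite mulr_sumr mulr_suml mulr_sumr; apply: eq_bigr => j _; rewrite /kern /=; ring.
rewrite /duhamel_sum Rint_itv_time.
under eq_Rintegral do under eq_Rintegral do rewrite E.
have iS : LL.-integrable setT (EFin \o (fun q => \sum_j ee j z * (kern j q * V q.1 q.2 w))).
  by apply: Rintegrable_sum => j _; apply: RintegrableZ; have [] := H j.
have [_ F] := Rfubini1 iS; rewrite F Rintegral_sum => [|j _]; last first.
  by apply: RintegrableZ; have [] := H j.
by apply: eq_bigr => j _; have [i ->] := H j; rewrite RintegralZl.
Qed.

Lemma measurable_duhamel_sum : measurable_fun setT (fun q : Om * R => duhamel_sum q.1 q.2).
Proof.
rewrite (_ : (fun q => _) = fun q : Om * R => \int[leb]_s \int[leb]_y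
    \sum_j ee j q.2 * (kern j (s, y) * V s y q.1)); last first.
  apply/funext => q; rewrite /duhamel_sum Rint_itv_time.
  apply: eq_Rintegral => s _; apply: eq_Rintegral => y _.
  rewrite mulr_sumr mulr_suml mulr_sumr; apply: eq_bigr => j _; rewrite /kern /=; ring.
apply: (@measurable_Rint1 _ _ _ _ _ leb (fun z : (Om * R) * R => \int[leb]_y
    \sum_j ee j z.1.2 * (kern j (z.2, y) * V z.2 y z.1.1))).
apply: (@measurable_Rint1 _ _ _ _ _ leb (fun z : ((Om * R) * R) * R =>
    \sum_j ee j z.1.1.2 * (kern j (z.1.2, z.2) * V z.1.2 z.2 z.1.1.1))).
have m0 : measurable_fun setT (fun z : ((Om * R) * R) * R => z.1.1).
  exact: (measurableT_comp measurable_fst measurable_fst).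
have m1 : measurable_fun setT (fun z : ((Om * R) * R) * R => (z.1.2, z.2)).
  apply/measurable_fun_pairP; split; last exact: measurable_snd.
  exact: (measurableT_comp measurable_snd measurable_fst).
have m2 : measurable_fun setT (fun z : ((Om * R) * R) * R => ((z.1.2, z.2), z.1.1.1)).
  apply/measurable_fun_pairP; split => //.
  exact: (measurableT_comp measurable_fst m0).
apply: measurable_sum => j; apply: measurable_funM.
  apply: (measurableT_comp (measurable_ee j)); exact: (measurableT_comp measurable_snd m0).
apply: measurable_funM; first exact: (measurableT_comp (measurable_kern j) m1).
exact: (measurableT_comp mV m2).
Qed.

Definition proj_coef (j : 'I_K) (DF : Om * R -> R) (w : Om) : R := \int[leb]_z (ee j z * DF (w, z)).

Lemma sqint_coef j DF : sqint (P \x leb)%E DF -> sqint P (proj_coef j DF).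
Proof. by move=> sD; have [] := sqint_contract (see j) sD. Qed.

(** By finite rank, [DF] contributes only through its [K] coefficients against the [ee j]. *)
Lemma duhamel_inner (DF : Om * R -> R) : sqint (P \x leb)%E DF ->
  P.-integrable setT (EFin \o (fun w => \int[leb]_z (duhamel_sum w z * DF (w, z)))) /\
  \int[P]_w \int[leb]_z (duhamel_sum w z * DF (w, z)) =
  \sum_j \int[P]_w (source j w * proj_coef j DF w).
Proof.
move=> sD; have [mD _] := sD.
have is_ j := (source_inner j (sqint_coef j sD)).1.
rewrite -Rintegral_sum//; apply: integrable_ae_eq.
- apply: (@measurable_Rint1 _ _ _ _ _ leb (fun z => duhamel_sum z.1 z.2 * DF (z.1, z.2))).
  apply: measurable_funM; first exact: measurable_duhamel_sum.
  by rewrite (_ : (fun z => _) = DF)//; apply/funext => -[].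
- apply: filterS2 duhamel_sumE (sqint_section1 sD) => w H sw.
  under eq_Rintegral do rewrite H mulr_suml.
  rewrite Rintegral_sum => [|j _]; last first.
    under eq_fun do rewrite mulrAC mulrC; apply: RintegrableZ; exact: sqintM.
  apply: eq_bigr => j _; under eq_Rintegral do rewrite mulrAC mulrC.
  by rewrite RintegralZl//; exact: sqintM.
- exact: Rintegrable_sum.
Qed.

(** [source_bound] applied to the coefficient of the difference, whose norm [sqint_contract] bounds
    by that of the difference itself. *)
Lemma coef_cvg j (Dn : nat -> Om * R -> R) D : (forall n, sqint (P \x leb)%E (Dn n)) ->
  sqint (P \x leb)%E D -> l2n (P \x leb)%E (fun z => Dn n z - D z) @[n --> \oo] --> 0 ->
  \int[P]_w (source j w * proj_coef j (Dn n) w) @[n --> \oo] --> \int[P]_w (source j w * proj_coef j D w).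
Proof.
move=> sn sD c; have [M M0 SM] := source_bound j.
apply/subr_cvg0; apply/norm_cvg0P.
apply: (@squeeze_cvgr _ _ _ _ (cst 0)
  (fun n => M * l2n leb (ee j) * l2n (P \x leb)%E (fun z => Dn n z - D z))).
- apply: nearW => n; rewrite normr_ge0/=.
  have sB := sqintB (sn n) sD.
  rewrite -RintegralB//; try exact: (source_inner j (sqint_coef j _)).1.
  rewrite [X in `|X|](_ : _ = \int[P]_w (source j w * proj_coef j (fun z => Dn n z - D z) w)).
    apply: le_trans (SM _ (sqint_coef j sB)) _; rewrite -mulrA ler_wpM2l//.
    by have [] := sqint_contract (see j) sB.
  apply: Rint_ae_eq.
  + by apply: measurable_funB; apply: measurable_funM; do ?[exact: measurable_source];
      [have [] := sqint_coef j (sn n)|have [] := sqint_coef j sD].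
  + by apply: measurable_funM; [exact: measurable_source|have [] := sqint_coef j sB].
  + apply: filterS2 (sqint_section1 (sn n)) (sqint_section1 sD) => w s1 s2.
    rewrite -mulrBr; congr (_ * _); rewrite /proj_coef -RintegralB//; [|exact: sqintM..].
    by apply: eq_Rintegral => z _; rewrite mulrBr.
- exact: cvg_cst.
- by under eq_fun do rewrite mulrC; exact: cvg0_Mr.
Qed.

End source.

(** * The weak formulation *)

Section poly_growth_closure.
Context (R : realType) (n : nat).
Implicit Types f g : 'rV[R]_n.+1 -> R.

Lemma poly_growthD f g : poly_growth f -> poly_growth g -> poly_growth (fun v => f v + g v).
Proof.
move=> [C [m fC]] [D [k gD]]; exists (`|C| + `|D|), (m + k)%N => v.
have v1 : 1 <= 1 + `|v| by rewrite lerDl.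
rewrite mulrDl (le_trans (ler_normD _ _))// lerD//.
- rewrite (le_trans (fC v))// (@le_trans _ _ (`|C| * (1 + `|v|) ^+ m))//.
    by rewrite ler_wpM2r ?ler_norm// exprn_ge0// (le_trans _ v1).
  by rewrite ler_wpM2l// ler_weXn2l// leq_addr.
- rewrite (le_trans (gD v))// (@le_trans _ _ (`|D| * (1 + `|v|) ^+ k))//.
    by rewrite ler_wpM2r ?ler_norm// exprn_ge0// (le_trans _ v1).
  by rewrite ler_wpM2l// ler_weXn2l// leq_addl.
Qed.

Lemma poly_growthZ f (a : R) : poly_growth f -> poly_growth (fun v => f v * a).
Proof.
by move=> [C [m fC]]; exists (C * `|a|), m => v; rewrite normrM mulrAC ler_wpM2r.
Qed.

Lemma poly_growth_sum (I : Type) (r : seq I) (F : I -> 'rV[R]_n.+1 -> R) :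
  (forall i, poly_growth (F i)) -> poly_growth (fun v => \sum_(i <- r) F i v).
Proof.
move=> H; elim: r => [|i r ih].
  by exists 0, 0%N => v; rewrite big_nil normr0 mul0r.
by under eq_fun do rewrite big_cons; exact: poly_growthD.
Qed.

End poly_growth_closure.

Section weak_form.
Context (R : realType) dW dB (OmW : measurableType dW) (OmB : measurableType dB).
Variables (PW : probability OmW R) (PB : probability OmB R) (W : R -> OmW -> R).
Hypothesis W_brownian : brownian_line PW W.
Local Notation leb := (@lebesgue_measure R).
Variables (T : R) (G : R -> set (set OmB)) (B : R -> OmB -> R).
Hypotheses (T0 : 0 <= T) (GF : filtration T G) (BB : brownian PB T G B).
Variables (K : nat) (ee : 'I_K -> R -> R) (C : R).
Hypotheses (cee : forall k, continuous (ee k)) (eeC : forall k z, `|ee k z| <= C) (C0 : 0 <= C).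
Hypotheses (see : forall k, sqint leb (ee k))
  (ortho : forall k l, \int[leb]_y (ee k y * ee l y) = (k == l)%:R).
Variables (u0 : R -> R) (M : R).
Hypotheses (mu0 : measurable_fun setT u0) (u0M : forall z, `|u0 z| <= M).
Variable Phi : (R * R) * (OmW * OmB) -> R.
Hypothesis mPhi : measurable_fun setT Phi.
Hypothesis wPhi : forall t x, 0 <= t <= T ->
  {ae PB, forall v, wiener_integral PW W (occ_fun T B ee t x v) (fun w => Phi ((t, x), (w, v)))}.
Local Notation V := (field PB T B ee u0 Phi).
Let A := field_bound T K C M.

Lemma sqint_V s y : 0 <= s <= T -> sqint PW (V s y) /\ l2n PW (V s y) <= A.
Proof. by move=> sT; exact: (sqint_field W_brownian T0 GF BB cee eeC C0 see ortho mu0 u0M mPhi wPhi). Qed.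

Lemma measurable_V : measurable_fun setT (fun z : (R * R) * OmW => V z.1.1 z.1.2 z.2).
Proof. exact: (measurable_field T0 GF BB cee mu0 mPhi). Qed.

Lemma A_ge0 : 0 <= A.
Proof. exact: (field_bound_ge0 T K C u0M). Qed.

Variables (t x : R).
Hypothesis tT : 0 <= t <= T.
Local Notation source := (source ee V t x).
Local Notation coef := (proj_coef ee).

Lemma sqint_tensor (g : OmW -> R) (h : R -> R) : sqint PW g -> sqint leb h ->
  sqint (PW \x leb)%E (fun z => g z.1 * h z.2).
Proof.
move=> [mg ig] [mh ih].
have m : measurable_fun setT (fun z : OmW * R => g z.1 * h z.2).
  by apply: measurable_funM; [exact: (measurableT_comp mg measurable_fst)|exact: (measurableT_comp mh measurable_snd)].
split => //; apply: (@integrable_prod _ _ _ _ _ PW leb _ (fun w => g w ^+ 2) (fun y => h y ^+ 2)) => //.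
- exact: measurable_funX.
- by move=> w y; rewrite /= ger0_norm ?sqr_ge0// exprMn.
Qed.

Lemma weak_form_smooth F DF : smooth_functional PW W F DF ->
  [/\ sqint PW F, sqint (PW \x leb)%E DF &
    \int[PW]_w (V t x w * F w) = heat_semigroup t u0 x * \int[PW]_w F w +
      \sum_j \int[PW]_w (source j w * coef j DF w)].
Proof.
move=> [n [f [hs [Is [sf wI -> ->]]]]].
have fdiff v : differentiable f v by have [H _] := sf [::]; exact: H.
have cf : continuous f by move=> v; exact: differentiable_continuous.
have fg : poly_growth f by have [_ H] := sf [::]; exact: H.
(* The definition of smoothness, read on words of length one, gives continuity and growth of the
   first derivatives; the empty word gives them for [f]. *)
have cdf i : continuous (fun v => 'D_(delta_mx ord0 i) f v).
  by have [H _] := sf [:: i]; move=> v; apply: differentiable_continuous; exact: H.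
have dfg i : poly_growth (fun v => 'D_(delta_mx ord0 i) f v) by have [_ H] := sf [:: i]; exact: H.
have sh i : sqint leb (hs i) by have [] := wiener_seq W_brownian (wI i).
have mI i : measurable_fun setT (Is i) by exact: (measurable_wiener W_brownian (wI i)).
have iI : PW.-integrable setT (EFin \o (fun w => exp_row (\row_i Is i w))).
  by apply: sqint_integrable; exact: (sqint_exp_row W_brownian wI).
have sdf i := sqint_wiener_row W_brownian wI (@cdf i) (dfg i).
have sF := sqint_wiener_row W_brownian wI cf fg.
pose gam (k : 'I_K) (i : 'I_n.+1) := \int[leb]_y (ee k y * hs i y).
have cdd j : continuous (dir_deriv f gam j) by exact: continuous_dir_deriv.
have ddg j : poly_growth (dir_deriv f gam j).
  by apply: poly_growth_sum => i; exact: poly_growthZ.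
have sDF : sqint (PW \x leb)%E (fun z => \sum_(i < n.+1)
    'D_(delta_mx ord0 i) f (\row_k Is k z.1) * hs i z.2).
  by apply: sqint_sum => i _; exact: (sqint_tensor (sdf i) (sh i)).
split => //.
(* The coefficient [<e_j, DF>] is again a polynomially growing function of the same Wiener
   integrals, so that [field_smooth] applies to it as it does to [F]. *)
have coefE j w : coef j (fun z => \sum_(i < n.+1)
    'D_(delta_mx ord0 i) f (\row_k Is k z.1) * hs i z.2) w = dir_deriv f gam j (\row_k Is k w).
  rewrite /proj_coef /dir_deriv; under eq_Rintegral do rewrite mulr_sumr.
  rewrite Rintegral_sum => [|i _]; last first.
    have := RintegrableZ ('D_(delta_mx ord0 i) f (\row_k Is k w)) (sqintM (see j) (sh i)).
    by congr (integrable _ _ (EFin \o _)); apply/funext => z; rewrite mulrCA.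
  apply: eq_bigr => i _; rewrite /gam -(RintegralZl _ measurableT (sqintM (see j) (sh i))).
  by apply: eq_Rintegral => z _; rewrite mulrCA.
pose Psi0 := smooth_mean PW f Is gam.
pose Psi j := smooth_mean PW (dir_deriv f gam j) Is gam.
have field_smooth' s y := @field_smooth _ _ _ _ _ _ _ _ W_brownian _ _ _ T0 GF BB _ _ _ cee eeC C0 see ortho
  _ _ mu0 u0M _ mPhi wPhi s y.
have E0 : Psi0 (fun=> 0) = \int[PW]_w f (\row_i Is i w).
  apply: eq_Rintegral => w _; congr f; apply/rowP => i; rewrite !mxE big1 ?addr0// => j _.
  by rewrite mul0r.
have e_f := poly_growth_exp fg.
have e_d j := poly_growth_exp (ddg j).
have D := @duhamel_smooth _ _ ee C u0 M cee eeC C0 mu0 u0M Psi0 Psi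
  (smooth_mean_bound gam cf e_f mI iI) (cvg_smooth_mean (gam := gam) cf e_f mI iI)
  (fun j => smooth_mean_bound gam (@cdd j) (e_d j) mI iI)
  (fun j => cvg_smooth_mean (gam := gam) (@cdd j) (e_d j) mI iI)
  _ _ _ PB T G B T0 GF BB t x tT.
rewrite (field_smooth' t x tT _ _ _ f wI cf fg) -/Psi0 -E0.
apply/eqP; rewrite addrC -subr_eq; apply/eqP; rewrite D; last first.
  move=> th s cth thC s0.
  by have := smooth_mean_diff gam fdiff fg cdf dfg mI iI cth thC s0.
apply: eq_bigr => j _.
rewrite (source_inner_itv cee eeC measurable_V A_ge0 sqint_V x tT); last exact: sqint_coef.
apply: eq_Rintegral => s; rewrite inE/= in_itv/= => /andP[s0 st].
have /andP[t0 tleT] := tT.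
have sT : 0 <= s <= T by rewrite s0 (le_trans st).
apply: eq_Rintegral => y _; congr (_ * (_ * _)).
under [RHS]eq_Rintegral do rewrite coefE.
by rewrite (field_smooth' s y sT _ _ _ (dir_deriv f gam j) wI (@cdd j) (ddg j)).
Qed.

Lemma weak_form F DF : malliavin_derivative PW W F DF ->
  [/\ sqint PW F, sqint (PW \x leb)%E DF &
    \int[PW]_w (V t x w * F w) = heat_semigroup t u0 x * \int[PW]_w F w +
      \sum_j \int[PW]_w (source j w * coef j DF w)].
Proof.
move=> [/Lfun2P sF /Lfun2P sD [Fn [DFn [sm cF cD]]]]; split => //.
have sFn n : sqint PW (Fn n) by have [] := weak_form_smooth (sm n).
have sDn n : sqint (PW \x leb)%E (DFn n) by have [] := weak_form_smooth (sm n).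
have E n : \int[PW]_w (V t x w * Fn n w) = heat_semigroup t u0 x * \int[PW]_w Fn n w +
      \sum_j \int[PW]_w (source j w * coef j (DFn n) w) by have [] := weak_form_smooth (sm n).
have {}cF := L2_cvgP sFn sF cF; have {}cD := L2_cvgP sDn sD cD.
have inner g : sqint PW g -> \int[PW]_w (g w * Fn n w) @[n --> \oo] --> \int[PW]_w (g w * F w).
  move=> sg; apply: (cvg_inner (fn := fun=> g)) => //.
  have -> : (fun n : nat => l2n PW (fun w => g w - g w)) = cst 0; last exact: cvg_cst.
  apply/funext => n; rewrite /l2n; under eq_Rintegral do rewrite subrr expr0n.
  by rewrite /Rintegral integral0 sqrtr0.
have h1 := inner _ (sqint_V x tT).1.
have h2 : \int[PW]_w Fn n w @[n --> \oo] --> \int[PW]_w F w.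
  have := inner _ (sqint_cst PW 1); apply: eq_cvgn.
    by move=> n; apply: eq_Rintegral => w _; rewrite mul1r.
  by apply: eq_Rintegral => w _; rewrite mul1r.
have h3 : heat_semigroup t u0 x * \int[PW]_w Fn n w +
      \sum_j \int[PW]_w (source j w * coef j (DFn n) w) @[n --> \oo] -->
    heat_semigroup t u0 x * \int[PW]_w F w + \sum_j \int[PW]_w (source j w * coef j DF w).
  apply: cvgD; first by apply: cvgM => //; exact: cvg_cst.
  apply: cvg_sumr => j.
  exact: (coef_cvg cee eeC see measurable_V A_ge0 sqint_V tT).
rewrite -(funext E) in h3.
by rewrite -(cvg_lim _ h1)// -(cvg_lim _ h3).
Qed.

End weak_form.

Theorem theorem4p1 (R : realType)
  (dW : measure_display) (OmegaW : measurableType dW)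
  (PW : probability OmegaW R) (W : R -> OmegaW -> R)
  (PW_complete : measure_is_complete PW)
  (W_brownian : brownian_line PW W)
  (W_generates : generated_by_wiener_integrals PW W)
  (T : R) (T_gt0 : 0 < T)
  (dB : measure_display) (OmegaB : measurableType dB)
  (PB : probability OmegaB R) (G : R -> set (set OmegaB)) (B : R -> OmegaB -> R)
  (G_filtration : filtration T G) (B_brownian : brownian PB T G B)
  (u0 : R -> R) (u0_bounded : exists M : R, forall x, `|u0 x| <= M)
  (u0_measurable : measurable_fun [set: R] u0)
  (K : nat) (K_gt0 : (0 < K)%N)
  (Phi : (R * R) * (OmegaW * OmegaB) -> R)
  (Phi_version : occupation_wiener_integral PW PB W B T K Phi) :
  weak_solution PW W T u0 K (feynman_kac PB B u0 K Phi).
Proof.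
have T0 := ltW T_gt0; have [M u0M] := u0_bounded; have [mPhi wPhi] := Phi_version.
(* Ordinals start at 0 and Hermite functions at 1. *)
pose ee (i : 'I_K) : R -> R := hermite_fun i.+1.
have cee i : continuous (ee i) by exact: continuous_hermite_fun.
have [C C0 eeC] : exists2 C : R, 0 <= C & forall (i : 'I_K) z, `|ee i z| <= C.
  have /choice[c Hc] : forall i : 'I_K, exists c : R, 0 <= c /\ forall z, `|ee i z| <= c.
    by move=> i; have [c] := @hermite_fun_bounded R i; exists c.
  exists (\sum_i c i) => [|i z]; first by apply: sumr_ge0 => i _; have [] := Hc i.
  have [_ H] := Hc i; rewrite (le_trans (H z))// (bigD1 i)//= lerDl.
  by apply: sumr_ge0 => j _; have [] := Hc j.
have see i : sqint (@lebesgue_measure R) (ee i) by exact: sqint_hermite_fun.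
have ortho (k l : 'I_K) : \int[@lebesgue_measure R]_y (ee k y * ee l y) = (k == l)%:R.
  exact: hermite_orthonormal.
(* [Phi] is measurable only over times in [[0, T]]; clamping the time yields a function measurable
   everywhere with the same values there. *)
pose Phic (z : (R * R) * (OmegaW * OmegaB)) := Phi ((clamp T z.1.1, z.1.2), z.2).
have mPhic : measurable_fun setT Phic.
  have mD : measurable ((`[0, T]%classic `*` [set: R]) `*` [set: OmegaW * OmegaB]).
    by apply: measurableX => //; exact: measurableX.
  apply: (measurable_comp mD _ mPhi) => [_ [z _ <-]|].
    by split => //; split => //=; rewrite in_itv/=; exact: clamp_itv.
  have mc : measurable_fun setT (@clamp R T).
    by apply: continuous_measurable_fun; exact: continuous_clamp.
  apply/measurable_fun_pairP; split; last exact: measurable_snd.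
  apply/measurable_fun_pairP; split.
    exact: (measurableT_comp mc (measurableT_comp measurable_fst measurable_fst)).
  exact: (measurableT_comp measurable_snd measurable_fst).
have PhicE t x w v : 0 <= t <= T -> Phic ((t, x), (w, v)) = Phi ((t, x), (w, v)).
  by move=> tT; rewrite /Phic /= clamp_id.
have occE t x v (j : 'I_K) : 0 <= t <= T ->
    occupation B j.+1 t x v = primitive (along ee T B x v j) t.
  move=> /andP[_ tT]; apply: eq_Rintegral => s; rewrite inE/= in_itv/= => /andP[s0 st].
  by rewrite /along /Bc clamp_id// s0 (le_trans st).
have wPhic t x : 0 <= t <= T -> {ae PB, forall v, wiener_integral PW W (occ_fun T B ee t x v)
    (fun w => Phic ((t, x), (w, v)))}.
  move=> tT; apply: filterS (wPhi t x tT) => v.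
  congr wiener_integral.
    apply/funext => y; rewrite big_add1 big_mkord.
    by apply: eq_bigr => j _; rewrite occE.
  by apply/funext => w; rewrite PhicE.
pose V := field PB T B ee u0 Phic.
have fkE t x w : 0 <= t <= T -> feynman_kac PB B u0 K Phi t x w = V t x w.
  move=> tT; apply: eq_Rintegral => v _.
  rewrite /field_integrand /dens /= PhicE// /Bc clamp_id//; congr (_ * expR (_ - _ * _)).
  by rewrite big_add1 big_mkord; apply: eq_bigr => j _; rewrite occE.
have sV := sqint_V W_brownian T0 G_filtration B_brownian cee eeC C0 see ortho u0_measurable u0M mPhic wPhic.
have mV := measurable_V T0 G_filtration B_brownian cee u0_measurable mPhic.
have A0 := A_ge0 T K C u0M.
move=> t x tT.
have -> : feynman_kac PB B u0 K Phi t x = V t x by apply/funext => w; exact: fkE.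
have [sVt _] := sV t x tT.
split; first exact/Lfun2P.
move=> F DF HF.
have [sF sDF E] := weak_form W_brownian T0 G_filtration B_brownian cee eeC C0 see ortho
  u0_measurable u0M mPhic wPhic x tT HF.
have [iD ED] := duhamel_inner cee eeC see mV A0 sV x tT sDF.
(* The Duhamel integral involves times in [[0, t]] only, where the clamped field coincides with the
   Feynman-Kac one. *)
have dE w z : duhamel K (feynman_kac PB B u0 K Phi) t x w z = duhamel_sum ee V t x w z.
  rewrite /duhamel /duhamel_sum; have /andP[t0 tleT] := tT.
  apply: eq_Rintegral => s; rewrite inE/= in_itv/= => /andP[s0 st].
  apply: eq_Rintegral => y _; rewrite fkE ?s0 ?(le_trans st)//.
  by rewrite big_add1 big_mkord.
have -> : (fun w => \int[lebesgue_measure]_z (duhamel K (feynman_kac PB B u0 K Phi) t x w z * DF (w, z))) =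
    (fun w => \int[lebesgue_measure]_z (duhamel_sum ee V t x w z * DF (w, z))).
  by apply/funext => w; apply: eq_Rintegral => z _; rewrite dE.
rewrite unlock -!EFin_Rintegral//; last 2 first.
- exact: sqint_integrable.
- exact: (sqintM sVt sF).
by rewrite E ED.
Qed.
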